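(* Let $\mathcal I$ be a prime differential ideal in $\mathcal F\{y_1,\dots,y_n\}$ of dimension $d$ and order $h$, and let $G(\mathbf u_0,\mathbf u_1,\ldots,\mathbf u_d)=g(\mathbf u;u_{00},u_{10},\ldots,u_{d0})$ be its generalized differential Chow form with respect to generic differential polynomials $\mathbb P_0,\dots,\mathbb P_d$ of orders $s_0,\dots,s_d$. Let $s=\sum_{l=0}^ds_l$. Then for each $i\in\{0,\dots,d\}$, $\operatorname{ord}(g,u_{i0})=h+s-s_i$, and moreover $\operatorname{ord}(G,\mathbf u_i)=h+s-s_i$.
   Context: $\mathcal F$ ordinary differential field of characteristic $0$, $\mathcal E$ universal differential extension. For $i=0,\dots,d$, $\mathbb P_i=u_{i0}+\sum_{j=1}^n\sum_{k=0}^{s_i}u_{ijk}y_j^{(k)}+f_i$ is a generic differential polynomial of order $s_i\ge0$ and degree $m_i\ge1$, where $f_i=\sum u_{i\alpha}\mu_\alpha$ runs over all monomials $\mu_\alpha$ of degree between $2$ and $m_i$ in $y_j^{(k)}$ ($k\le s_i$), and all coefficients $u_{i0},u_{ijk},u_{i\alpha}$ are differential indeterminates over $\mathcal F$ in $\mathcal E$; $\mathbf u_i$ is the tuple of coefficients of $\mathbb P_i$, and $\mathbf u$ the set of all coefficients other than the $u_{i0}$. Let $\xi$ be a generic point of $\mathcal I$ free from these coefficients and $\zeta_i=-\sum_{j,k}u_{ijk}\xi_j^{(k)}-f_i(\xi)$. The prime differential ideal of $\mathcal F\langle\mathbf u\rangle\{z_0,\dots,z_d\}$ with generic point $(\zeta_0,\dots,\zeta_d)$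 has dimension $d$ and is the saturation of an irreducible $g(\mathbf u;z)$, taken irreducible in $\mathcal F\{\mathbf u;z\}$; the generalized Chow form is $G=g(\mathbf u;u_{00},\dots,u_{d0})$. $\operatorname{ord}(G,\mathbf u_i)=\max_{u\in\mathbf u_i}\operatorname{ord}(g,u)$. Order of $\mathcal I$: the $h$ with $\operatorname{tr.deg}\mathcal F(\xi_i^{(j)}:j\le t)/\mathcal F=d(t+1)+h$ for large $t$. *)

(* Defs.v *)
From HB Require Import structures.
From mathcomp Require Import all_boot all_order all_algebra.
From mathcomp Require Import finmap.
From mathcomp.multinomials Require Import monalg.

Set Implicit Arguments.
Unset Strict Implicit.
Unset Printing Implicit Defensive.

Import Order.TTheory GRing.Theory Num.Theory.
Local Open Scope ring_scope.

Definition is_derivation (E : fieldType) (delta : E -> E) : Prop :=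
  (forall x y, delta (x + y) = delta x + delta y) /\
  (forall x y, delta (x * y) = delta x * y + x * delta y).

Definition is_dsubfield (E : fieldType) (delta : E -> E) (K : E -> Prop) : Prop :=
  K 0 /\ K 1 /\
  (forall x y, K x -> K y -> K (x - y)) /\
  (forall x y, K x -> K y -> K (x * y)) /\
  (forall x, K x -> K x^-1) /\
  (forall x, K x -> K (delta x)).

Definition dgen (E : fieldType) (delta : E -> E) (K S : E -> Prop) : E -> Prop :=
  fun x => forall L : E -> Prop, is_dsubfield delta L ->
    (forall y, K y -> L y) -> (forall y, S y -> L y) -> L x.

Definition coeffs_in (E : fieldType) (X : choiceType) (K : E -> Prop)
  (p : {malg E[{cmonom X}]}) : Prop := forall m, K (p@_m).

Definition peval (E : fieldType) (X : choiceType) (a : X -> E)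
  (p : {malg E[{cmonom X}]}) : E :=
  \sum_(m <- msupp p) p@_m * \prod_(x <- finsupp m) a x ^+ m x.

Definition alg_indep (E : fieldType) (K : E -> Prop) (xs : seq E) : Prop :=
  forall p : {malg E[{cmonom 'I_(size xs)}]}, coeffs_in K p ->
    peval (fun i : 'I_(size xs) => nth 0 xs i) p = 0 -> p = 0.

Definition has_trdeg (E : fieldType) (K : E -> Prop) (xs : seq E) (r : nat) : Prop :=
  (exists b : bitseq, alg_indep K (mask b xs) /\ size (mask b xs) = r) /\
  (forall b : bitseq, alg_indep K (mask b xs) -> (size (mask b xs) <= r)%N).

(* Differential polynomials: the variable x^(k) is the pair (x, k).   *)

Definition dpoly (E : fieldType) (X : choiceType) := {malg E[{cmonom (X * nat)%type}]}.

Definition dvar (E : fieldType) (X : choiceType) (x : X) (k : nat) : dpoly E X :=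
  << ucm (x, k) >>.

Definition deval (E : fieldType) (delta : E -> E) (X : choiceType) (a : X -> E)
  (p : dpoly E X) : E :=
  peval (fun xk : X * nat => iter xk.2 delta (a xk.1)) p.

Definition dmon (E : fieldType) (X : choiceType) (m : {cmonom (X * nat)%type}) : dpoly E X :=
  \sum_(xk <- finsupp m)
     ((m xk)%:R : E) *: << mulcm (divcm m (ucm xk)) (ucm (xk.1, xk.2.+1)) >>.

Definition dderiv (E : fieldType) (delta : E -> E) (X : choiceType) (p : dpoly E X)
  : dpoly E X :=
  \sum_(m <- msupp p) (<< delta (p@_m) *g m >> + p@_m *: dmon E m).

Definition occurs (E : fieldType) (X : choiceType) (p : dpoly E X) (x : X) (k : nat)
  : Prop := exists2 m, m \in msupp p & (0 < m (x, k))%N.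

Definition has_ord (E : fieldType) (X : choiceType) (p : dpoly E X) (x : X) (n : nat)
  : Prop := occurs p x n /\ forall k, occurs p x k -> (k <= n)%N.

Definition is_const (E : fieldType) (X : choiceType) (p : dpoly E X) : Prop :=
  exists c, p = c%:MP.

Definition irreducible_over (E : fieldType) (X : choiceType) (K : E -> Prop)
  (p : dpoly E X) : Prop :=
  [/\ coeffs_in K p, ~ is_const p &
      forall a b, coeffs_in K a -> coeffs_in K b -> p = a * b ->
        is_const a \/ is_const b].

Definition rank_le (N : nat) (a b : 'I_N * nat) : bool :=
  (a.2 < b.2)%N || ((a.2 == b.2) && (a.1 <= b.1)%N).

Definition var_occurs (E : fieldType) (N : nat) (q : dpoly E 'I_N) (v : 'I_N * nat)
  : Prop := occurs q v.1 v.2.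

Definition is_leader (E : fieldType) (N : nat) (q : dpoly E 'I_N) (v : 'I_N * nat)
  : Prop := var_occurs q v /\ forall w, var_occurs q w -> rank_le w v.

Definition vdeg (E : fieldType) (X : choiceType) (q : dpoly E X) (v : X * nat) : nat :=
  \max_(m <- msupp q) m v.

Definition initial (E : fieldType) (X : choiceType) (q : dpoly E X) (v : X * nat)
  : dpoly E X :=
  \sum_(m <- msupp q | m v == vdeg q v)
     << q@_m *g divcm m (expcmn (ucm v) (m v)) >>.

Definition separant (E : fieldType) (X : choiceType) (q : dpoly E X) (v : X * nat)
  : dpoly E X :=
  \sum_(m <- msupp q | (0 < m v)%N)
     << (m v)%:R * q@_m *g divcm m (ucm v) >>.

Definition in_dideal (E : fieldType) (delta : E -> E) (X : choiceType)
  (K : E -> Prop) (q p : dpoly E X) : Prop :=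
  exists (r : nat) (c : nat -> dpoly E X),
    (forall i, coeffs_in K (c i)) /\
    p = \sum_(i < r) c i * iter i (@dderiv E delta X) q.

Definition in_sat (E : fieldType) (delta : E -> E) (N : nat) (K : E -> Prop)
  (q p : dpoly E 'I_N) : Prop :=
  coeffs_in K p /\
  exists v, is_leader q v /\
    exists e : nat,
      in_dideal delta K q ((initial q v * separant q v) ^+ e * p).

(* Monomials in y_j^(k) (j < n, k <= s) of total degree <= m; the
   coefficient of the generic differential polynomial attached to the
   monomial mu is u_mu (the zero monomial gives u_{i0}). *)
Definition gmon (n s m : nat) : finType :=
  {mu : {ffun 'I_n * 'I_s.+1 -> 'I_m.+1} | (\sum_x (mu x : nat) <= m)%N}.

Definition gmon_deg (n s m : nat) (mu : gmon n s m) : nat :=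
  \sum_x ((val mu) x : nat).

Definition gmon_eval (E : fieldType) (delta : E -> E) (n s m : nat)
  (xi : 'I_n -> E) (mu : gmon n s m) : E :=
  \prod_(x : 'I_n * 'I_s.+1) iter x.2 delta (xi x.1) ^+ (val mu x).

Definition coef_idx (n d : nat) (s m : 'I_d.+1 -> nat) : finType :=
  {i : 'I_d.+1 & gmon n (s i) (m i)}.

Definition subst_u (E : fieldType) (delta : E -> E) (n d : nat)
  (s m : 'I_d.+1 -> nat) (u : coef_idx n s m -> E)
  (g : dpoly E (coef_idx n s m)) : dpoly E 'I_d.+1 :=
  \sum_(mo <- msupp g) g@_mo *:
    \prod_(xk <- finsupp mo)
      (if gmon_deg (tagged xk.1) == 0%N then dvar E (tag xk.1) xk.2
       else (iter xk.2 delta (u xk.1))%:MP) ^+ mo xk.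

Lemma gmon0_proof (n s m : nat) :
  (\sum_(x : 'I_n * 'I_s.+1) (([ffun _ => ord0] : {ffun 'I_n * 'I_s.+1 -> 'I_m.+1}) x : nat)
    <= m)%N.
Proof. by rewrite big1 // => x _; rewrite ffunE. Qed.

Definition gmon0 (n s m : nat) : gmon n s m := @exist {ffun 'I_n * 'I_s.+1 -> 'I_m.+1}
    (fun mu => (\sum_x (mu x : nat) <= m)%N) _ (gmon0_proof n s m).

Definition cvar (n d : nat) (s m : 'I_d.+1 -> nat) (i : 'I_d.+1)
  (mu : gmon n (s i) (m i)) : coef_idx n s m :=
  Tagged (fun i => gmon n (s i) (m i)) mu.

(* zeta_i = - sum_{j,k} u_{ijk} xi_j^(k) - f_i(xi)
          = - sum over the nonconstant monomials mu of u_{i,mu} mu(xi) *)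
Definition gen_zeta (E : fieldType) (delta : E -> E) (n d : nat)
  (s m : 'I_d.+1 -> nat) (xi : 'I_n -> E) (u : coef_idx n s m -> E)
  (i : 'I_d.+1) : E :=
  - \sum_(mu : gmon n (s i) (m i) | gmon_deg mu != 0%N)
      u (cvar mu) * gmon_eval delta xi mu.

(* ord(G, u_i) = max_{u in u_i} ord(g, u) = N, where u_i are the
   coefficients of P_i (u_{i0} being the variable z_i of g) *)
Definition has_ordG (E : fieldType) (n d : nat) (s m : 'I_d.+1 -> nat)
  (g : dpoly E (coef_idx n s m)) (i : 'I_d.+1) (N : nat) : Prop :=
  (exists mu : gmon n (s i) (m i), occurs g (cvar mu) N) /\
  (forall (mu : gmon n (s i) (m i)) k, occurs g (cvar mu) k -> (k <= N)%N).

(* Main.v *)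
(* Let [zeta_i^(k)] be the derivatives of the generic values of the forms, [e_i = h + s - s_i], and
   call relation a nonzero polynomial over [F] in the coefficients vanishing at the generic point.
   Since [zeta_j^(k)] is algebraic over the coefficients and the derivatives of [xi] of order at
   most [k + s_j], and those of order at most [s + h] have transcendence degree at most
   [d (s + h + 1) + h], the [(d + 1)(s + h + 1) - s] values with [k <= e_j] are dependent: there is
   a relation [p] of order at most [e_j] in every [u_j0].
   Conversely every relation has order at least [e_i] in [u_i0]. Specializing the forms other than
   the [i]-th to [z_j - y_b^(s_j)], for [b] in a parametric set of the prime ideal, shows that the
   [zeta_j^(k)] with [j <> i] are independent, even over the derivatives of [xi] of order at most
   [T] when [k + s_j > T]. If some [zeta_i^(N)] were algebraic over them and the lower derivatives
   of [zeta_i], so would be all derivatives of [xi]; counting gives [N >= e_i].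
   By the saturation property a nonzero polynomial vanishing at the generic point is not free of
   the variables of rank at least that of the leader [v] of [g]. Applied to [p], this gives
   [v = z_i^(e_i)] for some [i], and [p], from which [v] cannot be eliminated by means of [g], is a
   multiple of [g]. So [g] has order at most, hence exactly, [e_i] in each [u_i0]. If another coefficient [u_mu] of the [i]-th
   form occurred with a derivative of order [k > e_i], the partial derivative of [g] with respect to
   [u_mu^(k)] would vanish at the generic point, hence be a multiple of [g]. *)

(* Two coefficient fields are in play. The polynomial [g] is irreducible over [F] with all
   coefficients of the forms as variables, while the saturation property concerns polynomials in the
   [z_i] alone over the differential field generated by the other coefficients. Since these are
   independent, evaluating them is injective on polynomials over [F] and makes no [z_i^(k)]
   disappear; this carries relations from one side to the other. The lower bound needs [xi] to be
   algebraic over the coefficients and the values of all forms. A relation holds identically in the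
   coefficients. If [M] is its order in [u_i0], moving [u_mu^(M)] alone shows that, at the generic
   point, its partial derivative in [u_mu^(M)] is [mu(xi)] times the one in [u_i0^(M)]. For a
   relation of least degree the latter is not zero, and the monomials [mu = y_j] give each [xi_j] as
   a quotient. Eliminating the leader must produce a nonzero polynomial over [F] without division,
   so irreducibility of [g] is combined with a resultant; this is why unique factorization is
   developed. *)
Require Import Defs.
From HB Require Import structures.
From mathcomp Require Import all_boot all_order all_algebra.
From mathcomp Require Import finmap.
From mathcomp.multinomials Require Import monalg.
From mathcomp Require Import boolp ring zify.

Set Implicit Arguments.
Unset Strict Implicit.
Unset Printing Implicit Defensive.

Import GRing.Theory.
Local Open Scope ring_scope.

Local Notation "x ** y" := (mmul x y) (at level 40, left associativity).

(** * Polynomials in arbitrarily many variables *)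

Section Evaluation.
Context (X : choiceType) (R A : comNzRingType).

Definition mnm_ev (a : X -> A) (m : {cmonom X}) : A :=
  \prod_(x <- finsupp m) a x ^+ m x.

Lemma mnm_evEw (a : X -> A) (m : {cmonom X}) (d : {fset X}) :
  (finsupp m `<=` d)%fset -> mnm_ev a m = \prod_(x <- d) a x ^+ m x.
Proof.
move=> le; rewrite /mnm_ev [LHS](big_fset_incl _ le) //= => x xd.
by rewrite -cmE_eq0 => /eqP ->; rewrite expr0.
Qed.

Lemma mnm_ev_mmorphism (a : X -> A) : mmorphism (mnm_ev a).
Proof.
split=> [m1 m2|]; last by rewrite /mnm_ev mdom1 big_seq_fset0.
rewrite !(mnm_evEw a (d := (finsupp m1 `|` finsupp m2)%fset)) ?mdomD //.
- by rewrite -big_split; apply: eq_bigr => x _; rewrite cmM exprD.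
- exact: fsubsetUr.
- exact: fsubsetUl.
Qed.

HB.instance Definition _ (a : X -> A) :=
  isMultiplicative.Build {cmonom X} A (mnm_ev a) (mnm_ev_mmorphism a).

Definition pev (f : {rmorphism R -> A}) (a : X -> A) : {malg R[{cmonom X}]} -> A :=
  mmap f (mnm_ev a).

HB.instance Definition _ f a := GRing.RMorphism.on (pev f a).

Lemma mnm_evU a x : mnm_ev a (ucm x) = a x.
Proof. by rewrite /mnm_ev mdomU big_seq_fset1 cmUU expr1. Qed.

Lemma pevC f a c : pev f a c%:MP = f c.
Proof. exact: mmapC. Qed.

Lemma pevU f a c m : pev f a << c *g m >> = f c * mnm_ev a m.
Proof. exact: mmapU. Qed.

Lemma pevX f a x : pev f a << ucm x >> = a x.
Proof. by rewrite pevU rmorph1 mul1r mnm_evU. Qed.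

End Evaluation.

Definition subring_pred (R : nzRingType) (K : R -> Prop) := [/\ K 1,
  forall x y, K x -> K y -> K (x - y) & forall x y, K x -> K y -> K (x * y)].

Section SubringPred.
Context (R : nzRingType) (K : R -> Prop) (sK : subring_pred K).

Lemma subring_pred0 : K 0.
Proof. by case: sK => K1 KB _; rewrite -(subrr 1); apply: KB. Qed.

Lemma subring_predN x : K x -> K (- x).
Proof. by case: sK => K1 KB _ Kx; rewrite -sub0r; apply/KB => //; apply: subring_pred0. Qed.

Lemma subring_predD x y : K x -> K y -> K (x + y).
Proof.
by case: sK => K1 KB _ Kx Ky; rewrite -[y]opprK; apply: KB => //; apply: subring_predN.
Qed.

Lemma subring_predMn x n : K x -> K (x *+ n).
Proof.
move=> Kx; elim: n => [|n IHn]; first by rewrite mulr0n; apply: subring_pred0.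
by rewrite mulrS; apply: subring_predD.
Qed.

Lemma subring_pred_sum (I : Type) (r : seq I) (P : pred I) (F : I -> R) :
  (forall i, P i -> K (F i)) -> K (\sum_(i <- r | P i) F i).
Proof.
by move=> KF; elim/big_ind: _ => //; [exact: subring_pred0 | exact: subring_predD].
Qed.

Lemma subring_predX x n : K x -> K (x ^+ n).
Proof.
case: sK => K1 _ KM Kx; elim: n => [|n IHn]; first by rewrite expr0.
by rewrite exprS; apply: KM.
Qed.

End SubringPred.

Section Monomials.
Context (X : choiceType).

Lemma cmonom_ind (P : {cmonom X} -> Prop) :
  P mone -> (forall m x, P m -> P (m ** ucm x)) -> forall m, P m.
Proof.
move=> P1 PM m; move: {2}(mdeg m) (erefl (mdeg m)) => n.
elim: n m => [|n IHn] m; first by move/mdeg_eq0I ->.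
move=> dm; have [x xm]: exists x, x \in finsupp m.
  apply/fset0Pn; apply/eqP => m0.
  by move: dm; rewrite mdegE m0 big_seq_fset0.
have -> : m = (divcm m (ucm x) ** ucm x).
  apply/eqP/cmP => y; rewrite cmM divcmE cmU.
  case: eqP => [<-|_]; last by rewrite subn0 addn0.
  by rewrite subnK // lt0n cmE_neq0.
apply/PM/IHn; have: mdeg m = mdeg (divcm m (ucm x) ** ucm x).
  congr (mdeg _); apply/eqP/cmP => y; rewrite cmM divcmE cmU.
  case: eqP => [<-|_]; last by rewrite subn0 addn0.
  by rewrite subnK // lt0n cmE_neq0.
by rewrite mdegM mdegU dm addn1 => -[].
Qed.

Lemma expcmnE (m : {cmonom X}) n x : expcmn m n x = (n * m x)%N.
Proof.
elim: n => [|[|n] IHn]; [exact: onecmE | by rewrite mul1n |].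
by rewrite mulSn -IHn -mulcmE.
Qed.

Lemma cmonomP (m1 m2 : {cmonom X}) : (forall x, m1 x = m2 x) -> m1 = m2.
Proof. by move=> e; apply/eqP/cmP. Qed.

Lemma divcmK (m m0 : {cmonom X}) : (forall x, m0 x <= m x)%N -> divcm m m0 ** m0 = m.
Proof. by move=> le; apply: cmonomP => x; rewrite cmM divcmE subnK. Qed.

Lemma divcmUK (m : {cmonom X}) x : (0 < m x)%N -> divcm m (ucm x) ** ucm x = m.
Proof. by move=> mx; apply: divcmK => y; rewrite cmU; case: eqP => // <-. Qed.

Lemma mulcmK (m m0 : {cmonom X}) : divcm (m ** m0) m0 = m.
Proof. by apply: cmonomP => x; rewrite divcmE cmM addnK. Qed.

End Monomials.

(* The ring structure of [malg] is transparent, and failing unification problems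
   between two products unfold it; [mp] is an opaque copy. *)
Lemma mp_model (X : choiceType) (R : comNzRingType) :
  {M : comNzRingType & {i : {rmorphism {malg R[{cmonom X}]} -> M} &
    {j : {rmorphism M -> {malg R[{cmonom X}]}} | cancel i j /\ cancel j i}}}.
Proof.
by exists {malg R[{cmonom X}]}, idfun, idfun.
Qed.

Definition mp (X : choiceType) (R : comNzRingType) : comNzRingType := projT1 (mp_model X R).

Section Mp.
Context (X : choiceType) (R : comNzRingType).
Local Notation mp := (mp X R).
Implicit Types (p q : mp) (w : X) (K : R -> Prop) (S : X -> Prop).

Definition to_mp : {rmorphism {malg R[{cmonom X}]} -> mp} := projT1 (projT2 (mp_model X R)).
Definition of_mp : {rmorphism mp -> {malg R[{cmonom X}]}} :=
  proj1_sig (projT2 (projT2 (mp_model X R))).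

Lemma to_mpK : cancel to_mp of_mp.
Proof. exact: (proj1 (proj2_sig (projT2 (projT2 (mp_model X R))))). Qed.

Lemma of_mpK : cancel of_mp to_mp.
Proof. exact: (proj2 (proj2_sig (projT2 (projT2 (mp_model X R))))). Qed.

Lemma mpc_model : {h : {rmorphism R -> mp} | forall c, h c = to_mp c%:MP}.
Proof. by exists (to_mp \o @malgC {cmonom X} R : {rmorphism R -> mp}). Qed.

Definition mpc : {rmorphism R -> mp} := proj1_sig mpc_model.

Lemma mpcE c : mpc c = to_mp c%:MP.
Proof. exact: (proj2_sig mpc_model). Qed.

Definition mpm (m : {cmonom X}) : mp := to_mp << m >>.
Definition mpx (x : X) : mp := mpm (ucm x).
Definition mcf p m : R := (of_mp p)@_m.

Lemma mpP p q : (forall m, mcf p m = mcf q m) <-> p = q.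
Proof.
by split=> [e|->//]; apply: (can_inj of_mpK); apply/malgP.
Qed.

Lemma mcf0 m : mcf 0 m = 0.
Proof. by rewrite /mcf rmorph0 mcoeff0. Qed.
Lemma mcfD p q m : mcf (p + q) m = mcf p m + mcf q m.
Proof. by rewrite /mcf rmorphD mcoeffD. Qed.
Lemma mcfMn p n m : mcf (p *+ n) m = mcf p m *+ n.
Proof. by rewrite /mcf rmorphMn mcoeffMn. Qed.
Lemma mcf_sum (I : Type) (r : seq I) (P : pred I) (F : I -> mp) m :
  mcf (\sum_(i <- r | P i) F i) m = \sum_(i <- r | P i) mcf (F i) m.
Proof. by elim/big_rec2: _ => [|i y1 y2 _ <-]; rewrite ?mcf0 ?mcfD. Qed.
Lemma mcfC c m : mcf (mpc c) m = c *+ (m == mone).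
Proof. by rewrite /mcf mpcE to_mpK mcoeffC. Qed.

Lemma mcfMm p (m0 m : {cmonom X}) : mcf (p * mpm m0) (m ** m0) = mcf p m.
Proof.
rewrite /mcf rmorphM to_mpK; move: (of_mp p) => {}p.
rewrite [p in LHS]monalgE [p in RHS]monalgE mulr_suml !raddf_sum /=.
apply: eq_bigr => k _; rewrite malgM_def fgmulUU !mcoeffU mulr1; congr (_ *+ nat_of_bool _).
by apply/eqP/eqP => [/(congr1 (fun m => divcm m m0))|->] //; rewrite !mulcmK.
Qed.

Lemma mcfMm0 p (m0 m : {cmonom X}) x : (m x < m0 x)%N -> mcf (p * mpm m0) m = 0.
Proof.
move=> lt; rewrite /mcf rmorphM to_mpK; move: (of_mp p) => {}p.
rewrite [p]monalgE mulr_suml raddf_sum big1 //= => k _.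
rewrite malgM_def fgmulUU mcoeffU; case: eqP => // e; move: lt.
by rewrite -e cmM ltnNge leq_addl.
Qed.

Lemma mcfMX p x m :
  mcf (p * mpx x) m = if (0 < m x)%N then mcf p (divcm m (ucm x)) else 0.
Proof.
case: ifP => mx; first by rewrite -{1}(divcmUK mx) mcfMm.
by rewrite (@mcfMm0 _ _ _ x) // cmUU ltnS leqNgt mx.
Qed.

Lemma mcfCM c p m : mcf (mpc c * p) m = c * mcf p m.
Proof. by rewrite /mcf rmorphM mpcE to_mpK mcoeffCM. Qed.

Lemma mpmM (m m' : {cmonom X}) : mpm (m ** m') = mpm m * mpm m'.
Proof.
have <- : to_mp (<< m >> * << m' >>) = mpm m * mpm m' by exact: rmorphM.
by rewrite malgM_def fgmulUU mulr1.
Qed.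

Lemma mpm1 : mpm mone = 1.
Proof. exact: (rmorph1 to_mp). Qed.

Lemma mpmX x n : mpm (expcmn (ucm x) n) = mpx x ^+ n.
Proof.
elim: n => [|n IHn]; first by rewrite expr0 -mpm1.
rewrite exprS -IHn -mpmM; congr mpm.
by apply: cmonomP => y; rewrite cmM !expcmnE mulSn.
Qed.

Definition mpsupp p : {fset {cmonom X}} := msupp (of_mp p).

Lemma mcf_neq0 p m : (mcf p m != 0) = (m \in mpsupp p).
Proof. exact: mcoeff_neq0. Qed.

Lemma mcf_out p m : m \notin mpsupp p -> mcf p m = 0.
Proof. by rewrite -mcf_neq0 negbK => /eqP. Qed.

Lemma mpE p : p = \sum_(m <- mpsupp p) mpc (mcf p m) * mpm m.
Proof.
rewrite -{1}[p]of_mpK {1}[of_mp p]monalgE rmorph_sum; apply: eq_bigr => m _.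
have <- : to_mp ((mcf p m)%:MP * << m >>) = mpc (mcf p m) * mpm m by rewrite mpcE; exact: rmorphM.
by rewrite malgM_def fgmulUU mulr1 mul1m.
Qed.

Section Mpev.
Context (A : comNzRingType) (f : {rmorphism R -> A}) (a : X -> A).

Lemma mpev_model :
  {h : {rmorphism mp -> A} | forall q : {malg R[{cmonom X}]}, h (to_mp q) = pev f a q}.
Proof. by exists (pev f a \o of_mp : {rmorphism mp -> A}) => p /=; rewrite to_mpK. Qed.

Definition mpev : {rmorphism mp -> A} := proj1_sig mpev_model.

Lemma mpevE (q : {malg R[{cmonom X}]}) : mpev (to_mp q) = pev f a q.
Proof. exact: (proj2_sig mpev_model). Qed.

Lemma mpevC c : mpev (mpc c) = f c.
Proof. by rewrite mpcE mpevE pevC. Qed.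

Lemma mpevX x : mpev (mpx x) = a x.
Proof. by rewrite mpevE pevX. Qed.

End Mpev.

(** A predicate on one ambient ring, because the coefficient field and the set of variables change
    from step to step. *)
Definition pover K S p :=
  forall m, m \in mpsupp p -> K (mcf p m) /\ forall x, (0 < m x)%N -> S x.

(** Most facts on evaluations and derivations below are proved along these generators, so that
    products of monomials need not be expanded. *)
Lemma pover_ind K S (P : mp -> Prop) :
  P 0 -> (forall p q, P p -> P q -> P (p + q)) -> (forall c, K c -> P (mpc c)) ->
  (forall p x, S x -> P p -> P (p * mpx x)) ->
  forall p, pover K S p -> P p.
Proof.
move=> P0 PD PC PM p pK; rewrite [p]mpE big_seq.
elim/big_ind: _ => // m /pK[]; move: (mcf p m) => c Kc.
elim/cmonom_ind: m => [|m x IH] mS; first by rewrite mpm1 mulr1; apply: PC.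
rewrite mpmM mulrA; apply: PM; first by apply: mS; rewrite cmM cmUU addn1.
by apply: IH => y my; apply: mS; rewrite cmM addn_gt0 my.
Qed.

Lemma mp_ind (P : mp -> Prop) :
  (forall p q, P p -> P q -> P (p + q)) -> (forall c, P (mpc c)) ->
  (forall p x, P p -> P (p * mpx x)) -> forall p, P p.
Proof.
move=> PD PC PM p.
have pT : pover (fun=> True) (fun=> True) p by move=> m _; split.
apply: (pover_ind _ PD (fun c _ => PC c) (fun q x _ => PM q x) pT).
by rewrite -(rmorph0 mpc).
Qed.

Lemma poverS K K' S S' p : (forall c, K c -> K' c) -> (forall x, S x -> S' x) ->
  pover K S p -> pover K' S' p.
Proof.
move=> KK SS pK m pm; have [Km mS] := pK m pm.
by split=> [|x mx]; [apply: KK | apply/SS/mS].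
Qed.

Lemma poverX K S x : subring_pred K -> S x -> pover K S (mpx x).
Proof.
case=> K1 _ _ Sx m; rewrite /mpsupp to_mpK msuppU1 in_fset1 => /eqP ->.
rewrite /mcf to_mpK mcoeffUU.
by split=> // y; rewrite cmU; case: eqP => // <-.
Qed.

Lemma poverC K S c : K c -> pover K S (mpc c).
Proof.
move=> Kc m; rewrite -mcf_neq0 mcfC; case: (m =P mone) => [-> _|_]; last by rewrite eqxx.
by split=> [|x]; [exact: Kc | rewrite cm1].
Qed.

Section Subring.
Context (K : R -> Prop) (S : X -> Prop) (sK : subring_pred K).

Lemma pover_coef p m : pover K S p -> K (mcf p m).
Proof.
move=> pK; have [pm|] := boolP (m \in mpsupp p); first by case: (pK m pm).
by move/mcf_out ->; apply: (subring_pred0 sK).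
Qed.

Lemma pover0 : pover K S 0.
Proof. by rewrite -(rmorph0 mpc); apply: poverC; apply: (subring_pred0 sK). Qed.

Lemma poverD p q : pover K S p -> pover K S q -> pover K S (p + q).
Proof.
move=> pK qK m mpq; split.
  by rewrite mcfD; apply: (subring_predD sK); apply: pover_coef.
have: (m \in mpsupp p) || (m \in mpsupp q).
  apply: contraTT mpq; rewrite negb_or => /andP[mp mq].
  by rewrite -mcf_neq0 mcfD !mcf_out // addr0 negbK.
by case/orP=> [mp|mq]; [case: (pK m mp)|case: (qK m mq)].
Qed.

Lemma pover_subring : subring_pred (pover K S).
Proof.
have [K1 KB KM] := sK.
have pM p c : K c -> pover K S p -> pover K S (mpc c * p).
  move=> Kc pK m; rewrite -mcf_neq0 mcfCM => nz.
  have mp : m \in mpsupp p by rewrite -mcf_neq0; apply: contraNneq nz => ->; rewrite mulr0.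
  by have [Km mS] := pK m mp; split=> //; apply: KM.
have pX p x : S x -> pover K S p -> pover K S (p * mpx x).
  move=> Sx pK m; rewrite -mcf_neq0 mcfMX; case: ifP => mx; last by rewrite eqxx.
  rewrite mcf_neq0 => mp; have [Km mS] := pK _ mp; split=> // y my.
  case: (x =P y) => [<-//|/eqP xy]; apply: mS.
  by rewrite divcmE cmU (negPf xy) subn0.
split.
- by rewrite -(rmorph1 mpc); apply: poverC.
- move=> p q pK qK; apply: poverD => //; rewrite -[q]mul1r -(rmorph1 mpc) -mulNr -rmorphN.
  by apply: pM qK; apply: (subring_predN sK).
move=> p q pK; elim/pover_ind => {q} [|q r IHq IHr|c Kc|q x Sx IH].
- by rewrite mulr0; apply: pover0.
- by rewrite mulrDr; apply: poverD.
- by rewrite mulrC; apply: pM.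
- by rewrite mulrA; apply: pX.
Qed.

Lemma pover_sum (I : Type) (r : seq I) (P : pred I) (F : I -> mp) :
  (forall i, P i -> pover K S (F i)) -> pover K S (\sum_(i <- r | P i) F i).
Proof. exact: (subring_pred_sum pover_subring). Qed.

Lemma poverM p q : pover K S p -> pover K S q -> pover K S (p * q).
Proof. by have [_ _] := pover_subring; apply. Qed.

Lemma poverXn p n : pover K S p -> pover K S (p ^+ n).
Proof. exact: (subring_predX pover_subring). Qed.

End Subring.

End Mp.

Arguments to_mp {X R}.
Arguments of_mp {X R}.
Arguments mpc {X R}.
Arguments mpcE {X R}.
Arguments mpm {X R}.
Arguments mpx {X R}.
Arguments of_mpK {X R}.
Arguments to_mpK {X R}.

(** Term by term the formula of [separant], but for an arbitrary variable. *)
HB.lock Definition pder (X : choiceType) (R : comNzRingType) (w : X) (p : mp X R) : mp X R :=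
  \sum_(m <- mpsupp p | (0 < m w)%N) mpc ((m w)%:R * mcf p m) * mpm (divcm m (ucm w)).

(* The coefficient of [w ^ k] in [p], as a polynomial in the other variables. *)
HB.lock Definition part (X : choiceType) (R : comNzRingType) (w : X) (k : nat) (p : mp X R) : mp X R :=
  \sum_(m <- mpsupp p | m w == k) mpc (mcf p m) * mpm (divcm m (expcmn (ucm w) k)).

Section MpPartials.
Context (X : choiceType) (R : comNzRingType).
Local Notation mp := (mp X R).
Implicit Types (p q : mp) (w : X) (K : R -> Prop) (S : X -> Prop).

Lemma mcfm (c : R) (m m' : {cmonom X}) : mcf (mpc c * mpm m) m' = c *+ (m == m').
Proof. by rewrite mcfCM /mcf to_mpK mcoeffU mulrnAr mulr1. Qed.

Lemma pder_coef w p m : mcf (pder w p) m = mcf p (m ** ucm w) *+ (m w).+1.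
Proof.
rewrite unlock mcf_sum /=.
have [pm|] := boolP (m ** ucm w \in mpsupp p); last first.
  move/mcf_out => p0; rewrite p0 mul0rn big1_seq // => k /andP[kw kp].
  rewrite mcfm; case: eqP => // mk; move: kp; rewrite -mcf_neq0.
  by rewrite -(divcmUK kw) mk p0 eqxx.
rewrite big_mkcond (big_fsetD1 _ pm) /= cmM cmUU addn1 /= big1_seq ?addr0 => [|k].
  by rewrite mcfm mulr_natl mulcmK eqxx.
rewrite in_fsetD1 => /andP[_ /andP[/eqP km kp]]; case: ifP => // kw; rewrite mcfm.
by case: eqP => // mk; case: km; rewrite -mk divcmUK.
Qed.

Lemma pderD w p q : pder w (p + q) = pder w p + pder w q.
Proof. by apply/mpP => m; rewrite mcfD !pder_coef mcfD mulrnDl. Qed.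

Lemma pderC w c : pder w (mpc c : mp) = 0.
Proof.
apply/mpP => m; rewrite pder_coef mcf0 mcfC; case: eqP; rewrite ?mul0rn //.
by move=> /(congr1 (fun m : {cmonom X} => m w)); rewrite cmM cmUU cm1 addn1.
Qed.

Lemma pder0 w : pder w 0 = 0 :> mp.
Proof. by rewrite -[X in pder w X](rmorph0 mpc) pderC. Qed.

Lemma pderMX w p x : pder w (p * mpx x) = pder w p * mpx x + p *+ (x == w).
Proof.
apply/mpP => m; rewrite pder_coef mcfD mcfMn !mcfMX pder_coef cmM cmU divcmE cmU.
case: (x =P w) => [->|/eqP nxw].
  rewrite eqxx addn1 /= mulrSr mulcmK mulr1n.
  congr (_ + _); case: ifP => [mw|]; last by case: (m w) => // _; rewrite mulr0n.
  by rewrite subn1 prednK // divcmUK.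
rewrite eq_sym (negPf nxw) mulr0n addr0 subn0 addn0; case: ifP => mx; last by rewrite mul0rn.
congr (mcf p _ *+ _); apply: cmonomP => y; rewrite cmM !divcmE cmM !cmU.
case: (x =P y) => [<-|_]; last by rewrite !subn0.
by rewrite eq_sym (negPf nxw) !addn0.
Qed.

Lemma pderX w x : pder w (mpx x) = (x == w)%:R :> mp.
Proof. by rewrite -[mpx x]mul1r pderMX -[X in pder w X](rmorph1 mpc) pderC mul0r add0r. Qed.

Lemma pderM w p q : pder w (p * q) = pder w p * q + p * pder w q.
Proof.
elim/mp_ind: q => [q r IHq IHr|c|q x IH].
- by rewrite mulrDr !pderD IHq IHr !mulrDr addrACA.
- rewrite pderC mulr0 addr0; apply/mpP => m.
  rewrite pder_coef ![_ * mpc c]mulrC !mcfCM pder_coef mulrnAr //.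
rewrite mulrA !pderMX IH mulrDl mulrDr -!mulrA -addrA mulrnAr; congr (_ + _).
Qed.

Definition mpsize p := msize (of_mp p).

Definition occ p x := exists2 m, m \in mpsupp p & (0 < m x)%N.

Lemma pover_occ K S p : subring_pred K ->
  pover K S p <-> (forall m, K (mcf p m)) /\ (forall x, occ p x -> S x).
Proof.
move=> sK; split=> [pK|[Km Sx] m pm].
  by split=> [m|x [m pm mx]]; [exact: (pover_coef sK m pK) | have [_] := pK m pm; apply].
by split=> // x mx; apply: Sx; exists m.
Qed.

Lemma pder_occ w p x : occ (pder w p) x -> occ p x.
Proof.
case=> m; rewrite -mcf_neq0 pder_coef => nz mx.
exists (m ** ucm w); last by rewrite cmM addn_gt0 mx.
by rewrite -mcf_neq0; apply: contraNneq nz => ->; rewrite mul0rn.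
Qed.

Lemma pover_pder w K S p : subring_pred K -> pover K S p -> pover K S (pder w p).
Proof.
move=> sK /(pover_occ _ _ sK)[Kp Sp]; apply/(pover_occ _ _ sK).
split=> [m|x /pder_occ/Sp//].
by rewrite pder_coef; apply: (subring_predMn sK).
Qed.

Lemma pder_eq0 w p : ~ occ p w -> pder w p = 0.
Proof.
move=> np; apply/mpP => m; rewrite pder_coef mcf0.
have [pm|] := boolP (m ** ucm w \in mpsupp p); last first.
  by move/mcf_out ->; rewrite mul0rn.
by case: np; exists (m ** ucm w) => //; rewrite cmM cmUU addn1.
Qed.

Lemma pder_mpsize w p : p != 0 -> (mpsize (pder w p) < mpsize p)%N.
Proof.
rewrite -(can_eq of_mpK) rmorph0 -msize_eq0 -lt0n => p0; rewrite /mpsize -(prednK p0) ltnS msizeE.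
apply/bigmax_leqP_seq => m; rewrite -mcf_neq0 pder_coef => nz _.
have pm : m ** ucm w \in mpsupp p.
  by rewrite -mcf_neq0; apply: contraNneq nz => ->; rewrite mul0rn.
by rewrite -ltnS prednK //; have := msize_mdeg_lt pm; rewrite mdegM mdegU addn1.
Qed.

Lemma part_coef w k p m : mcf (part w k p) m =
  if m w == 0%N then mcf p (m ** expcmn (ucm w) k) else 0.
Proof.
have dK (m' : {cmonom X}) : m' w = k ->
    divcm m' (expcmn (ucm w) k) ** expcmn (ucm w) k = m'.
  move=> mk; apply: divcmK => y; rewrite expcmnE cmU; case: eqP => [<-|_]; last by rewrite muln0.
  by rewrite muln1 mk.
rewrite unlock mcf_sum /=; case: eqP => mw; last first.
  rewrite big1 // => k' /eqP kk; rewrite mcfm; case: eqP => // mE; case: mw.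
  by rewrite -mE divcmE expcmnE cmUU kk muln1 subnn.
have [pm|] := boolP (m ** expcmn (ucm w) k \in mpsupp p); last first.
  move/mcf_out => p0; rewrite p0 big1_seq // => k' /andP[/eqP kw kp].
  rewrite mcfm; case: eqP => // mk; move: kp; rewrite -mcf_neq0.
  by rewrite -(dK _ kw) mk p0 eqxx.
rewrite big_mkcond (big_fsetD1 _ pm) /= cmM mw expcmnE cmUU muln1 eqxx /= big1_seq ?addr0 => [|k'].
  by rewrite mcfm mulcmK eqxx.
rewrite in_fsetD1 => /andP[_ /andP[/eqP km kp]]; case: eqP => // kw; rewrite mcfm.
by case: eqP => // mk; case: km; rewrite -mk dK.
Qed.

Lemma partD w k p q : part w k (p + q) = part w k p + part w k q.
Proof. by apply/mpP => m; rewrite mcfD !part_coef mcfD; case: ifP; rewrite ?addr0. Qed.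

Lemma part0 w k : part w k 0 = 0 :> mp.
Proof. by apply/mpP => m; rewrite part_coef !mcf0 if_same. Qed.

Lemma part_sum w k (I : Type) (r : seq I) (P : pred I) (F : I -> mp) :
  part w k (\sum_(i <- r | P i) F i) = \sum_(i <- r | P i) part w k (F i).
Proof. by elim/big_rec2: _ => [|i y1 y2 _ <-]; rewrite ?part0 ?partD. Qed.

Lemma part_mulXn w k n p : ~ occ p w ->
  part w k (p * mpx w ^+ n) = p *+ (k == n).
Proof.
move=> nw; have p0 (m : {cmonom X}) : (0 < m w)%N -> mcf p m = 0.
  by move=> mw; apply: mcf_out; apply/negP => pm; case: nw; exists m.
apply/mpP => m; rewrite part_coef -mpmX mcfMn.
case: eqP => [mw|/eqP]; last by rewrite -lt0n => /p0 ->; rewrite mul0rn.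
have [<-|ne] := eqVneq k n; first by rewrite mcfMm.
rewrite mulr0n; have [lt|] := ltnP k n.
  by rewrite (@mcfMm0 _ _ _ _ _ w) // cmM mw !expcmnE cmUU !muln1.
rewrite leq_eqVlt eq_sym (negPf ne) => lt.
have -> : expcmn (ucm w) k = expcmn (ucm w) (k - n) ** expcmn (ucm w) n.
  by apply: cmonomP => y; rewrite cmM !expcmnE -mulnDl subnK // ltnW.
rewrite mulmA mcfMm p0 // cmM mw expcmnE cmUU muln1 subn_gt0 //.
Qed.

Lemma part_free w k p : ~ occ (part w k p) w.
Proof.
case=> m; rewrite -mcf_neq0 part_coef; case: ifP => [/eqP -> //|_].
by rewrite eqxx.
Qed.

Lemma part_occ w k p x : occ (part w k p) x -> occ p x /\ x != w.
Proof.
move=> ox; split; last by apply: contraPneq ox => ->; exact: part_free.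
case: ox => m; rewrite -mcf_neq0 part_coef; case: ifP => [mw|]; last by rewrite eqxx.
rewrite mcf_neq0 => pm mx.
by exists (m ** expcmn (ucm w) k) => //; rewrite cmM addn_gt0 mx.
Qed.

Lemma pover_part w k K S p : subring_pred K -> pover K S p ->
  pover K (fun x => S x /\ x != w) (part w k p).
Proof.
move=> sK /(pover_occ _ _ sK)[Kp Sp]; apply/(pover_occ _ _ sK).
split=> [m|x /part_occ[/Sp ? ?] //].
by rewrite part_coef; case: ifP => // _; apply: (subring_pred0 sK).
Qed.

Lemma partM_coef w k p m :
  mcf (part w k p * mpx w ^+ k) m = if m w == k then mcf p m else 0.
Proof.
rewrite -mpmX; have [lt|le] := ltnP (m w) k.
  by rewrite (@mcfMm0 _ _ _ _ _ w) ?ltn_eqF // expcmnE cmUU muln1.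
have dK : divcm m (expcmn (ucm w) k) ** expcmn (ucm w) k = m.
  apply: divcmK => y; rewrite expcmnE cmU; case: eqP => [<-|_]; last by rewrite muln0.
  by rewrite muln1.
rewrite -{1}dK mcfMm part_coef divcmE expcmnE cmUU muln1 dK subn_eq0.
by rewrite [RHS](_ : _ = if (m w <= k)%N then mcf p m else 0) // eqn_leq le andbT.
Qed.

Lemma part_sumE w p : exists N, p = \sum_(k < N) part w k p * mpx w ^+ k.
Proof.
pose N := (\max_(m <- mpsupp p) (m w)).+1; exists N; apply/mpP => m; rewrite mcf_sum.
transitivity (\sum_(k < N) if m w == k then mcf p m else 0); last first.
  by apply: eq_bigr => k _; rewrite partM_coef.
have [pm|pm] := boolP (m \in mpsupp p); last first.
  by rewrite (mcf_out pm) big1 // => k _; rewrite if_same.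
have lt : (m w < N)%N by rewrite ltnS; apply: leq_bigmax_seq.
rewrite (bigD1 (Ordinal lt)) //= eqxx big1 ?addr0 // => k.
by rewrite -val_eqE /= eq_sym => /negPf ->.
Qed.

End MpPartials.

Lemma pder_neq0 (E : fieldType) (X : choiceType) (p : mp X E) w :
  [pchar E] =i pred0 -> occ p w -> pder w p != 0.
Proof.
move=> /pcharf0P ch [m pm mw]; apply/eqP => /mpP/(_ (divcm m (ucm w))).
rewrite pder_coef mcf0 divcmE cmUU subn1 prednK // divcmUK //.
by apply/eqP; rewrite -mulr_natr mulf_neq0 ?mcf_neq0 // ch -lt0n.
Qed.

Definition rdvd (R : idomainType) (a b : R) := exists c, b = c * a.

Definition prime_elt (R : idomainType) (p : R) :=
  [/\ p != 0, p \isn't a GRing.unit &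
      forall a b, rdvd p (a * b) -> rdvd p a \/ rdvd p b].

Definition irred_elt (R : idomainType) (p : R) :=
  [/\ p != 0, p \isn't a GRing.unit &
      forall a b, p = a * b -> a \is a GRing.unit \/ b \is a GRing.unit].

Definition prime_fact (R : idomainType) (c : R) := exists2 l : seq R,
  {in l, forall p, prime_elt p} & exists2 u, u \is a GRing.unit & c = u * \prod_(p <- l) p.

(** Asking for prime rather than irreducible factors builds uniqueness of the factorization into its
    existence. *)
Definition ufd (R : idomainType) := forall c : R, c != 0 -> prime_fact c.

(** * Unique factorization *)

Section Divisibility.
Context (R : idomainType).
Implicit Types a b c p : R.

Lemma rdvd_mull a b c : rdvd a c -> rdvd a (b * c).
Proof. by case=> d ->; exists (b * d); rewrite mulrA. Qed.

Lemma rdvd_mulr a b c : rdvd a b -> rdvd a (b * c).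
Proof. by rewrite mulrC; apply: rdvd_mull. Qed.

Lemma rdvd_add a b c : rdvd a b -> rdvd a c -> rdvd a (b + c).
Proof. by move=> [x ->] [y ->]; exists (x + y); rewrite mulrDl. Qed.

Lemma rdvd_opp a b : rdvd a b -> rdvd a (- b).
Proof. by move=> [x ->]; exists (- x); rewrite mulNr. Qed.

Lemma rdvd0 a : rdvd a 0.
Proof. by exists 0; rewrite mul0r. Qed.

Lemma rdvd_refl a : rdvd a a.
Proof. by exists 1; rewrite mul1r. Qed.

Lemma rdvd_sum a (I : Type) (r : seq I) (P : pred I) (F : I -> R) :
  (forall i, P i -> rdvd a (F i)) -> rdvd a (\sum_(i <- r | P i) F i).
Proof. by move=> dF; elim/big_ind: _ => //; [exact: rdvd0 | exact: rdvd_add]. Qed.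

Lemma prime_irred p : prime_elt p -> irred_elt p.
Proof.
case=> p0 pu pp; split=> // a b e.
have /pp[[c ea]|[c eb]] : rdvd p (a * b) by rewrite -e; apply: rdvd_refl.
  right; have /(mulfI p0) bc : p * (b * c) = p * 1 by rewrite mulr1 [RHS]e ea; ring.
  by apply/unitrP; exists c; rewrite mulrC bc.
left; have /(mulfI p0) ac : p * (a * c) = p * 1 by rewrite mulr1 [RHS]e eb; ring.
by apply/unitrP; exists c; rewrite mulrC ac.
Qed.

Lemma prime_dvd_prod p (u : R) (l : seq R) : prime_elt p -> u \is a GRing.unit ->
  rdvd p (u * \prod_(q <- l) q) -> exists2 q, q \in l & rdvd p q.
Proof.
case=> p0 pu pp uu; elim: l u uu => [|q l IHl] u uu.
  rewrite big_nil mulr1 => -[c e]; case/negP: pu.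
  by move: uu; rewrite e unitrM => /andP[].
rewrite big_cons mulrCA => /pp[pq|/(IHl u uu)[r rl pr]].
  by exists q; rewrite ?mem_head.
by exists r; rewrite // inE rl orbT.
Qed.

Lemma prime_fact_mul a b : prime_fact a -> prime_fact b -> prime_fact (a * b).
Proof.
move=> [l lp [u uu ->]] [l' lp' [u' uu' ->]]; exists (l ++ l').
  by move=> p; rewrite mem_cat => /orP[/lp|/lp'].
by exists (u * u'); rewrite ?unitrM ?uu // big_cat /= mulrACA.
Qed.

Lemma prime_fact_prime p : prime_elt p -> prime_fact p.
Proof.
move=> pp; exists [:: p]; first by move=> q; rewrite inE => /eqP ->.
by exists 1; rewrite ?unitr1 // big_seq1 mul1r.
Qed.

End Divisibility.

Section Gauss.
Context (R : idomainType).
Implicit Types (c p : R) (f g h : {poly R}).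

Lemma rdvd_polyC p f : rdvd p%:P f <-> forall i, rdvd p f`_i.
Proof.
split=> [[q ->] i|pf]; first by exists q`_i; rewrite coefMC.
have [c cE] := choice pf; exists (\poly_(i < size f) c i).
apply/polyP => i; rewrite coefMC coef_poly; case: ltnP => [_|/leq_sizeP/(_ _ (leqnn _)) ->].
  exact: cE.
by rewrite mul0r.
Qed.

(** Gauss's lemma. If [i] and [j] are the least indices of coefficients of [f] and [g] not divisible
    by [p], all terms but one of the coefficient of index [i + j] of the product are divisible by
    [p]. *)
Lemma prime_polyC p : prime_elt p -> prime_elt p%:P.
Proof.
case=> p0 pu pp; split=> [||f g pfg]; rewrite ?polyC_eq0 //.
  by rewrite poly_unitE coefC eqxx negb_and pu orbT.
have [|nf] := pselect (rdvd p%:P f); first by left.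
have [|ng] := pselect (rdvd p%:P g); first by right.
have ex h : ~ rdvd p%:P h -> exists i, `[< ~ rdvd p h`_i >].
  rewrite rdvd_polyC => /existsNP[i ni]; exists i; exact/asboolP.
case: (ex_minnP (ex _ nf)) => i /asboolP ni mi; case: (ex_minnP (ex _ ng)) => j /asboolP nj mj.
have mi' k : (k < i)%N -> rdvd p f`_k.
  by move=> ki; have [//|/asboolP/mi] := pselect (rdvd p f`_k); rewrite leqNgt ki.
have mj' k : (k < j)%N -> rdvd p g`_k.
  by move=> kj; have [//|/asboolP/mj] := pselect (rdvd p g`_k); rewrite leqNgt kj.
move/rdvd_polyC/(_ (i + j)%N): pfg; rewrite coefM.
have ij : (i < (i + j).+1)%N by rewrite ltnS leq_addr.
rewrite (bigD1 (Ordinal ij)) //= addKn => pd.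
have /pp[]// : rdvd p (f`_i * g`_j).
rewrite -[f`_i * _](addrK (\sum_(k < (i + j).+1 | k != Ordinal ij) f`_k * g`_(i + j - k))).
apply/(rdvd_add pd)/rdvd_opp/rdvd_sum => k nk.
have [ki|ik|e] := ltngtP k i.
- exact/rdvd_mulr/mi'.
- apply/rdvd_mull/mj'; rewrite ltn_subLR ?ltn_add2r //.
  by rewrite -ltnS ltn_ord.
- by case/eqP: nk; apply: val_inj.
Qed.

(** The prime factors of [c] stay prime as constant polynomials, so each divides [a] or [b] and can
    be cancelled in turn; the unit is moved into [a]. *)
Lemma cancel_const c f a b : prime_fact c -> c%:P * f = a * b ->
  exists a' b' c1 c2, [/\ f = a' * b', a = c1%:P * a' & b = c2%:P * b'].
Proof.
case=> l lp [u uu ->]; elim: l lp f a b => [|p l IHl] lp f a b.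
  rewrite big_nil mulr1 => e; exists (u^-1%:P * a), b, u, 1; split.
  - by rewrite -mulrA -e mulrA -polyCM mulVr // mul1r.
  - by rewrite mulrA -polyCM mulrV // mul1r.
  - by rewrite mul1r.
have [p0 pu pp] := prime_polyC (lp p (mem_head _ _)).
rewrite big_cons mulrCA polyCM -mulrA => e.
have lp' : {in l, forall p, prime_elt p} by move=> q ql; apply: lp; rewrite inE ql orbT.
have /pp[[x ea]|[x eb]] : rdvd p%:P (a * b).
  by rewrite -e mulrC; apply/rdvd_mull/rdvd_refl.
- have /(mulfI p0) : p%:P * ((u * \prod_(q <- l) q)%:P * f) = p%:P * (x * b).
    by rewrite e ea; ring.
  move/(IHl lp')=> [a' [b' [c1 [c2 [-> xE ->]]]]].
  exists a', b', (p * c1), c2; split=> //.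
  by rewrite ea xE polyCM; ring.
- have /(mulfI p0) : p%:P * ((u * \prod_(q <- l) q)%:P * f) = p%:P * (a * x).
    by rewrite e eb; ring.
  move/(IHl lp')=> [a' [b' [c1 [c2 [-> -> xE]]]]].
  exists a', b', c1, (p * c2); split=> //.
  by rewrite eb xE polyCM; ring.
Qed.

Hypothesis facR : ufd R.

(** Cancelling [c] takes only a constant out of [f], and that constant is a unit because [f] is
    irreducible of positive degree. *)
Lemma irred_cancel_const f g h c : irred_elt f -> (1 < size f)%N -> c != 0 ->
  c%:P * h = g * f -> rdvd f h.
Proof.
move=> [f0 fu irr] sf c0 /(cancel_const (facR c0))[g' [f' [c1 [c2 [-> _ fE]]]]].
case: (irr _ _ fE) => [u|]; last first.
  rewrite poly_unitE => /andP[/eqP sf' _]; move: sf; rewrite fE ltnNge.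
  by case/negP; rewrite (leq_trans (size_polyMleq _ _)) // sf' addn1 size_polyC leq_b1.
by exists (g' * c2%:P^-1); rewrite fE -mulrA [_^-1 * _]mulrA mulVr // mul1r.
Qed.

(* The alternative to divisibility is coprimality over the fraction field,
   which the resultant turns into a relation with coefficients in [R]. *)
Lemma irred_dvd_or_coprime f g : irred_elt f -> (1 < size f)%N ->
  rdvd f g \/ exists2 r : R, r != 0 & exists u v, r%:P = u * f + v * g.
Proof.
move=> irrf sf; have [f0 fu irr] := irrf.
have [sg|sg] := leqP (size g) 1.
  have [g0|g0] := eqVneq g`_0 0.
    by left; rewrite (size1_polyC sg) g0; apply: rdvd0.
  right; exists g`_0 => //; exists 0, 1.
  by rewrite mul0r add0r mul1r -size1_polyC.
have [r0|r0] := eqVneq (resultant f g) 0; last first.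
  right; exists (resultant f g) => //.
  by have [[u v] /= _ ->] := resultant_in_ideal sf sg; exists u, v.
(* The resultant vanishes, so the gcd over the fraction field has positive degree. Up to a constant
   it is a factor [d] of [f]; irreducibility makes the cofactor a unit, hence [f] divides a constant
   multiple of [g]. *)
left; move/eqP: r0; rewrite resultant_eq0 => sd.
have [[c1 c10 e1] [c2 c20 e2]] :
    (exists2 c, c != 0 & exists q, c *: f = q * gcdp f g) /\
    (exists2 c, c != 0 & exists q, c *: g = q * gcdp f g).
  have /Pdiv.Idomain.dvdpP[[c q] /= c0 e] := dvdp_gcdl f g.
  have /Pdiv.Idomain.dvdpP[[c' q'] /= c0' e'] := dvdp_gcdr f g.
  by split; [exists c => //; exists q|exists c' => //; exists q'].
have [q1 e1'] := e1; have [q2 e2'] := e2.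
rewrite -mul_polyC in e1'; rewrite -mul_polyC in e2'.
have [q [d [k1 [k2 [fE _ dE]]]]] := cancel_const (facR c10) e1'.
have sd' : (1 < size d)%N.
  apply: leq_trans sd _; rewrite dE mul_polyC; exact: size_scale_leq.
have uq : q \is a GRing.unit.
  case: (irr _ _ fE) => //; rewrite poly_unitE => /andP[/eqP s1 _].
  by rewrite s1 in sd'.
apply: (irred_cancel_const (g := q2 * k2%:P * q^-1) irrf sf c20).
by rewrite e2' dE fE -!mulrA; congr (_ * (_ * _)); rewrite mulrA mulVr ?mul1r.
Qed.

(** Multiplying the combination of [f] and [g] equal to a constant by [h] shows that a nonzero
    constant times [h] is a multiple of [f]; the constant is then cancelled. *)
Lemma irred_poly_prime f : irred_elt f -> (1 < size f)%N -> prime_elt f.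
Proof.
move=> irrf sf; have [f0 fu irr] := irrf; split=> // g h [k gh].
have [|[r r0 [u [v e]]]] := irred_dvd_or_coprime g irrf sf; first by left.
right; apply: (irred_cancel_const (g := u * h + v * k) irrf sf r0).
by rewrite e; transitivity (u * h * f + v * (g * h)); [ring | rewrite gh; ring].
Qed.

(** Two descents: on the degree as long as [f] splits into factors of positive degree, then on the
    number of prime factors of its leading coefficient as long as a nonunit constant divides [f].
    What remains is irreducible, hence prime. *)
Lemma factorial_poly : ufd {poly R}.
Proof.
move=> f; move: {2}(size f) (leqnn (size f)) => n.
elim: n f => [|n IHn] f; first by rewrite leqn0 size_poly_eq0 => ->.
move=> sfn f0; have [sf|sf] := leqP (size f) 1.
  have c0 : f`_0 != 0 by apply: contraNneq f0 => e; rewrite (size1_polyC sf) e.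
  have [l lp [u uu e]] := facR c0; exists [seq p%:P | p <- l].
    by move=> _ /mapP[p pl ->]; apply/prime_polyC/lp.
  exists u%:P; first by rewrite poly_unitE coefC eqxx uu size_polyC (memPn _ _ uu) ?unitr0.
  by rewrite {1}(size1_polyC sf) e polyCM rmorph_prod big_map.
have [[a [b [e sa sb]]]|nfac] :=
    pselect (exists a b, [/\ f = a * b, (1 < size a)%N & (1 < size b)%N]).
  have a0 : a != 0 by rewrite -size_poly_gt0 ltnW.
  have b0 : b != 0 by rewrite -size_poly_gt0 ltnW.
  have sab : size f = (size a + size b).-1 by rewrite e size_mul.
  rewrite e; apply: prime_fact_mul; apply: IHn => //.
    by rewrite -ltnS (leq_trans _ sfn) // sab -(subnKC sb) addnCA addSn /= addSn ltnS leq_addr.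
  by rewrite -ltnS (leq_trans _ sfn) // sab -(subnKC sa) !addSn /= ltnS leq_addl.
have lf0 : lead_coef f != 0 by rewrite lead_coef_eq0.
have [l lp [u uu e]] := facR lf0.
have [k] := ubnP (size l); clear IHn sfn lf0.
elim: k f l f0 sf nfac lp u uu e => // k IHk f l f0 sf nfac lp u uu e sl.
have [[a [au [f1 fE]]]|irrf] :=
    pselect (exists a : R, a \isn't a GRing.unit /\ rdvd a%:P f); last first.
  apply/prime_fact_prime/irred_poly_prime => //; split=> //.
    by rewrite poly_unitE gtn_eqF.
  move=> a b fab; have [sa|sa] := leqP (size a) 1; last have [sb|sb] := leqP (size b) 1.
  - left; rewrite (size1_polyC sa); apply: contrapT => nu; apply: irrf; exists a`_0; split.
      by apply/negP => ua; apply: nu; apply: rmorph_unit.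
    by exists b; rewrite -(size1_polyC sa) mulrC.
  - right; rewrite (size1_polyC sb); apply: contrapT => nu; apply: irrf; exists b`_0; split.
      by apply/negP => ub; apply: nu; apply: rmorph_unit.
    by exists a; rewrite -(size1_polyC sb).
  - by case: nfac; exists a, b.
have f10 : f1 != 0 by apply: contraNneq f0; rewrite fE => ->; rewrite mul0r.
have a0 : a != 0 by apply: contraNneq f0; rewrite fE => ->; rewrite polyC0 mulr0.
have [[|q la] lap [ua uua aE]] := facR a0.
  by move: au; rewrite aE big_nil mulr1 uua.
have qp : prime_elt q by apply: lap; rewrite mem_head.
have qa : rdvd q a by exists (ua * \prod_(p <- la) p); rewrite aE big_cons; ring.
(* A prime factor of the constant divides the leading coefficient, so it is associated to one of the
   listed primes; dividing [f] by that one shortens the list. *)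
have [p pl [x px]] : exists2 p, p \in l & rdvd q p.
  apply: prime_dvd_prod qp uu _; rewrite -e fE lead_coefM lead_coefC.
  exact: rdvd_mull.
have [p0 pu _] := lp p pl; have [_ _ irrp] := prime_irred (lp p pl).
have ux : x \is a GRing.unit.
  by case: (irrp _ _ px) => // uq; case: qp; rewrite uq.
have [f2 f2E] : rdvd p%:P f.
  rewrite fE; apply: rdvd_mull; case: qa => y ->; exists (y * x^-1)%:P.
  by rewrite -polyCM px mulrA divrK.
have f20 : f2 != 0 by apply: contraNneq f0; rewrite f2E => ->; rewrite mul0r.
have sf2 : size f2 = size f.
  by rewrite f2E mulrC mul_polyC size_scale.
rewrite f2E; apply: prime_fact_mul; last exact/prime_fact_prime/prime_polyC/lp.
apply: (IHk f2 (rem p l) _ _ _ _ u) => //; rewrite ?sf2 //.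
- move=> [c [d [f2cd sc sd]]]; case: nfac; exists c, (d * p%:P).
  split=> //; first by rewrite f2E f2cd mulrA.
  by rewrite mulrC mul_polyC size_scale.
- by move=> r /mem_rem/lp.
- apply: (mulfI p0); rewrite mulrCA -(big_cons _ _ p (rem p l) xpredT id) -(perm_big _ (perm_to_rem pl)) /=.
  by rewrite -e f2E lead_coefM lead_coefC mulrC.
- by rewrite size_rem // -ltnS prednK // lt0n size_eq0; apply: contraTneq pl => ->.
Qed.

End Gauss.

Lemma factorial_field (F : fieldType) : ufd F.
Proof.
by move=> c c0; exists [::] => //; exists c; rewrite ?unitfE // big_nil mulr1.
Qed.

(** Unique factorization is inherited one variable at a time, and the variable added last is the one
    to be eliminated. *)
Fixpoint ipoly (F : fieldType) n : idomainType :=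
  if n is n'.+1 then {poly (ipoly F n')} else F.

Lemma factorial_ipoly (F : fieldType) n : ufd (ipoly F n).
Proof. by elim: n => [|n IHn]; [exact: factorial_field | exact: factorial_poly]. Qed.

(** * Iterated polynomials as polynomials in finitely many variables *)

Section IteratedEvaluation.
Context (F : fieldType) (A : comNzRingType) (f : {rmorphism F -> A}) (a : nat -> A).

Fixpoint iev n : {rmorphism ipoly F n -> A} :=
  if n is n'.+1 then
    (horner_eval (a n') \o map_poly (iev n') : {rmorphism {poly ipoly F n'} -> A})
  else f.

Lemma ievS n (P : ipoly F n.+1) : iev n.+1 P = (map_poly (iev n) P).[a n].
Proof. by []. Qed.

Lemma iev_const n c : exists P, iev n P = f c.
Proof.
elim: n => [|n [P PE]]; first by exists c.
by exists (P%:P : {poly ipoly F n}); rewrite ievS map_polyC hornerC /= PE.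
Qed.

Lemma iev_var n k : (k < n)%N -> exists P, iev n P = a k.
Proof.
elim: n => // n IHn; rewrite ltnS leq_eqVlt => /predU1P[->|/IHn[P PE]].
  by exists ('X : {poly ipoly F n}); rewrite ievS map_polyX hornerX.
by exists (P%:P : {poly ipoly F n}); rewrite ievS map_polyC hornerC /= PE.
Qed.

Lemma ievE n (P : {poly ipoly F n}) :
  iev n.+1 P = \sum_(i < size P) iev n P`_i * a n ^+ i.
Proof.
rewrite ievS horner_coef (big_ord_widen _ (fun i => (map_poly (iev n) P)`_i * a n ^+ i) (size_poly _ _)).
rewrite big_mkcond; apply: eq_bigr => i _; rewrite coef_map; case: ltnP => //.
by move/leq_sizeP/(_ _ (leqnn _)); rewrite coef_map => ->; rewrite mul0r.
Qed.

End IteratedEvaluation.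

Section Transfer.
Context (F E : fieldType) (f : {rmorphism F -> E}) (V : choiceType) (x0 : V) (L : seq V).
Hypothesis uL : uniq L.

Local Notation mpV := (mp V E).
Local Notation KF := (fun x : E => exists y, x = f y).
Local Notation psi := (iev ((@mpc V E) \o f : {rmorphism F -> mpV}) (fun k => mpx (nth x0 L k))).

Lemma image_subring : subring_pred KF.
Proof.
split=> [|_ _ [x ->] [y ->]|_ _ [x ->] [y ->]].
- by exists 1; rewrite rmorph1.
- by exists (x - y); rewrite rmorphB.
- by exists (x * y); rewrite rmorphM.
Qed.

Lemma psi_pover n (P : ipoly F n) : (n <= size L)%N ->
  pover KF (fun x => x \in take n L) (psi n P).
Proof.
elim: n P => [|n IHn] P nL.
  by apply: poverC; exists P.
have sK := image_subring; rewrite ievE; apply: (pover_sum sK) => i _.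
apply: (poverM sK); last first.
  apply: (poverXn sK); apply: (poverX sK).
  by rewrite (take_nth x0 nL) mem_rcons inE eqxx.
apply: poverS (IHn _ (ltnW nL)) => // x.
by rewrite (take_nth x0 nL) mem_rcons inE => ->; rewrite orbT.
Qed.

Lemma psi_surj n (p : mpV) : pover KF (fun x => x \in take n L) p ->
  (n <= size L)%N -> exists P, psi n P = p.
Proof.
move=> pK nL; elim/pover_ind: pK => {p} [|p q [P <-] [Q <-]|_ [y ->]|p x xL [P <-]].
- by exists 0; rewrite rmorph0.
- by exists (P + Q); rewrite rmorphD.
- exact: (iev_const (mpc \o f : {rmorphism F -> mpV})).
have xi : (index x L < n)%N by rewrite -in_take ?(mem_take xL).
have [Q QE] := iev_var (mpc \o f : {rmorphism F -> mpV}) (fun k => mpx (nth x0 L k)) xi.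
by exists (P * Q); rewrite rmorphM QE nth_index // (mem_take xL).
Qed.

(** As [L] has no repetition, the images of the coefficients are free of the last variable, so they
    can be read off in the multivariate ring. *)
Lemma part_psi n (P : ipoly F n.+1) k : (n < size L)%N ->
  part (nth x0 L n) k (psi n.+1 P) = psi n (P : {poly ipoly F n})`_k.
Proof.
move=> nL; rewrite ievE part_sum.
have free i : ~ occ (psi n (P : {poly ipoly F n})`_i) (nth x0 L n).
  have /(pover_occ _ _ image_subring)[_ oc] := @psi_pover n (P : {poly ipoly F n})`_i (ltnW nL).
  move=> /oc /(nthP x0); rewrite size_takel ?(ltnW nL) // => -[j jn].
  by rewrite nth_take // => /eqP; rewrite nth_uniq ?(ltn_trans jn) // ltn_eqF.
have [lt|ge] := ltnP k (size (P : {poly ipoly F n})).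
  rewrite (bigD1 (Ordinal lt)) //= part_mulXn // eqxx mulr1n big1 ?addr0 // => i.
  by rewrite part_mulXn // -val_eqE /= eq_sym => /negPf ->; rewrite mulr0n.
rewrite big1 => [|i _]; first by rewrite nth_default // rmorph0.
by rewrite part_mulXn // gtn_eqF ?mulr0n // (leq_trans (ltn_ord i)).
Qed.

Lemma psi_inj n : (n <= size L)%N -> injective (psi n).
Proof.
move=> nL; apply: raddf_inj; elim: n nL => [|n IHn] nL P.
  move=> e; apply: (fmorph_inj f); rewrite rmorph0.
  have := congr1 (fun p => mcf p mone) e.
  by rewrite mcf0 mcfC eqxx mulr1n.
move=> e; apply/polyP => i; rewrite coef0; apply: IHn (ltnW nL) _ _.
by have := part_psi P i nL; rewrite e part0 => /esym.
Qed.

End Transfer.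

Section IrreducibleRelations.
Context (F E : fieldType) (f : {rmorphism F -> E}) (V : choiceType).
Local Notation mpV := (mp V E).
Local Notation KF := (fun x : E => exists y, x = f y).
Implicit Types (p g : mpV) (w : V).

Lemma mpc_image (x y : F) : mpc (f (x * y)) = mpc (f x) * mpc (f y) :> mpV.
Proof.
have fM : f (x * y) = f x * f y by rewrite rmorphM.
by rewrite fM (rmorphM mpc).
Qed.

Definition mpvars p : seq V := flatten [seq enum_fset (finsupp m) | m : {cmonom V} <- mpsupp p].

Lemma occ_vars p x : occ p x <-> x \in mpvars p.
Proof.
split=> [[m pm mx]|/flattenP[_ /mapP[m pm ->] xm]].
  apply/flattenP; exists (enum_fset (finsupp m)); last by rewrite -cmE_neq0 -lt0n.
  by apply/mapP; exists m.
by exists m => //; rewrite lt0n cmE_neq0.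
Qed.

(** With [w] placed last, degree in [w] is the degree of a univariate polynomial over a unique
    factorization domain, and a polynomial from which [w] has been eliminated lies in the image of
    [psi0]. *)
Lemma ipoly_model w (Ls : seq V) : exists n (psi : {rmorphism {poly ipoly F n} -> mpV})
  (psi0 : ipoly F n -> mpV),
  [/\ injective psi, forall p, pover KF (fun x => x \in w :: Ls) p -> exists P, psi P = p,
    forall P, pover KF (fun x => x \in w :: Ls) (psi P),
    forall P k, part w k (psi P) = psi0 P`_k &
    [/\ injective psi0, forall c, psi c%:P = psi0 c &
      forall c, pover KF (fun x => x \in w :: Ls /\ x != w) (psi0 c)]].
Proof.
pose L0 := [seq x <- undup Ls | x != w].
pose L := rcons L0 w; pose n := size L0.
have uL : uniq L.
  by rewrite rcons_uniq filter_uniq ?undup_uniq // mem_filter eqxx.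
have sL : size L = n.+1 by rewrite size_rcons.
have Ln : nth w L n = w by rewrite nth_rcons ltnn eqxx.
have tL : take n L = L0 by rewrite /L -cats1 take_size_cat.
have memL x : (x \in L) = (x \in w :: Ls).
  by rewrite mem_rcons !inE mem_filter mem_undup; case: eqP.
pose psi k := iev (mpc \o f : {rmorphism F -> mpV}) (fun k => mpx (nth w L k)) k.
exists n, (psi n.+1), (psi n); split.
- by apply: (@psi_inj _ _ f V w L uL n.+1); rewrite sL.
- move=> p pL; apply: (@psi_surj _ _ f V w L n.+1); rewrite ?sL //.
  by apply: poverS pL => // x; rewrite -sL take_size memL.
- move=> P; apply: poverS (@psi_pover _ _ f V w L n.+1 P _); rewrite ?sL // => x.
  by rewrite -sL take_size memL.
- by move=> P k; have := part_psi f w uL P k; rewrite sL Ln => /(_ (ltnSn n)).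
split.
- by apply: (@psi_inj _ _ f V w L uL n); rewrite sL.
- by move=> c; rewrite /psi ievS map_polyC hornerC.
- move=> c; apply: poverS (@psi_pover _ _ f V w L n c _); rewrite ?sL // => x.
  by rewrite tL mem_filter mem_undup inE => /andP[-> ->]; rewrite orbT.
Qed.

Lemma occ_part p w : occ p w <-> exists2 k, (0 < k)%N & part w k p != 0.
Proof.
split=> [[m pm mw]|[k k0]].
  exists (m w) => //; apply: contra_neq (_ : mcf p m != 0); last by rewrite mcf_neq0.
  move/(congr1 (fun p => mcf p (divcm m (expcmn (ucm w) (m w))))).
  rewrite part_coef divcmE expcmnE cmUU muln1 subnn eqxx mcf0 divcmK // => y.
  by rewrite expcmnE cmU; case: eqP => [<-|_]; rewrite ?muln1 ?muln0.
apply: contra_neqP => nw; have [N pE] := part_sumE w p; apply/mpP => m.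
rewrite part_coef mcf0; case: ifP => // _; apply: mcf_out; apply/negP => pm; case: nw.
by exists (mmul m (expcmn (ucm w) k)); rewrite // cmM expcmnE cmUU muln1 addn_gt0 k0 orbT.
Qed.

Lemma occ_size n (psi : {rmorphism {poly ipoly F n} -> mpV}) (psi0 : ipoly F n -> mpV) w
    (P : {poly ipoly F n}) :
  injective psi0 -> (forall c, psi c%:P = psi0 c) ->
  (forall P k, part w k (psi P) = psi0 P`_k) -> occ (psi P) w <-> (1 < size P)%N.
Proof.
move=> inj psiC partP; have psi00 : psi0 0 = 0 by rewrite -psiC rmorph0.
rewrite occ_part; split=> [[k k0]|sP].
  rewrite partP ltnNge; apply: contra => sP.
  by rewrite nth_default ?psi00 // (leq_trans sP).
exists (size P).-1; first by rewrite -subn1 subn_gt0.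
rewrite partP -lead_coefE -psi00; apply: contra_neq (_ : lead_coef P != 0); first exact: inj.
by rewrite lead_coef_eq0 -size_poly_gt0 ltnW.
Qed.

(** This is [irred_dvd_or_coprime] transported through [ipoly_model]: the nonzero constant of the
    coprime case becomes a combination of [g] and [p] that no longer contains [w]. *)
Lemma irreducible_coprime g p w : pover KF xpredT g -> pover KF xpredT p ->
  (forall a b, pover KF xpredT a -> pover KF xpredT b -> g = a * b ->
    (exists c, a = mpc c) \/ (exists c, b = mpc c)) ->
  occ g w ->
  (exists2 q, pover KF xpredT q & p = q * g) \/
  exists u v r, [/\ r = u * g + v * p, r != 0 &
    pover KF (fun x => (occ g x \/ occ p x) /\ x != w) r].
Proof.
move=> gK pK girr gw; have sK := image_subring f.
have [n [psi [psi0 [inj surj psiK partP [inj0 psiC psi0K]]]]] := ipoly_model w (mpvars g ++ mpvars p).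
have memL x : occ g x \/ occ p x -> x \in w :: mpvars g ++ mpvars p.
  by move=> o; rewrite inE mem_cat; case: o => /occ_vars ->; rewrite ?orbT.
have [G GE] : exists G, psi G = g.
  apply: surj; have [gF _] := proj1 (pover_occ _ _ sK) gK.
  by apply/(pover_occ _ _ sK); split=> // x ox; apply: memL; left.
have [P PE] : exists P, psi P = p.
  apply: surj; have [pF _] := proj1 (pover_occ _ _ sK) pK.
  by apply/(pover_occ _ _ sK); split=> // x ox; apply: memL; right.
have psiKT Q : pover KF xpredT (psi Q) by apply: poverS (psiK Q).
have sG : (1 < size G)%N by apply/(occ_size G inj0 psiC partP); rewrite GE.
(* Constant factors are given with values in [E]; as coefficients of an image of [psi] they come
   from [F], where they are invertible. *)
have constU (Q : {poly ipoly F n}) c : Q != 0 -> psi Q = mpc c -> Q \is a GRing.unit.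
  move=> Q0 Qc; have [y cy] : KF c.
    by have := pover_coef sK mone (psiKT Q); rewrite Qc mcfC eqxx mulr1n.
  have y0 : y != 0.
    apply: contraNneq Q0 => y0; apply/eqP/inj.
    by rewrite Qc cy y0 !rmorph0.
  have [Q' Q'E] : exists Q', psi Q' = mpc (f y^-1).
    by apply: surj; apply: poverC; exists y^-1.
  apply/unitrPr; exists Q'; apply: inj.
  have -> : psi 1 = 1 by exact: rmorph1.
  rewrite rmorphM Qc Q'E cy; apply: etrans (esym (mpc_image y y^-1)) _.
  by rewrite (divff y0) (rmorph1 f) (rmorph1 (@mpc V E)).
have irrG : irred_elt G.
  split; first by rewrite -size_poly_gt0 ltnW.
    by rewrite poly_unitE gtn_eqF.
  move=> A B GAB; have A0 : A != 0.
    by apply: contraTneq sG; rewrite GAB => ->; rewrite mul0r size_poly0.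
  have B0 : B != 0.
    by apply: contraTneq sG; rewrite GAB => ->; rewrite mulr0 size_poly0.
  have := girr _ _ (psiKT A) (psiKT B); rewrite -rmorphM -GE GAB.
  by move=> /(_ erefl)[[c /constU]|[c /constU]] H; [left|right]; apply: H.
have [[Q PQ]|[r r0 [u [v ruv]]]] := irred_dvd_or_coprime (@factorial_ipoly F n) P irrG sG.
  by left; exists (psi Q); rewrite // -PE -GE -rmorphM -PQ.
right; exists (psi u), (psi v), (psi0 r); split.
- by rewrite -psiC ruv rmorphD !rmorphM GE PE.
- apply: contra_neq r0 => e; apply: inj0.
  by rewrite e -psiC rmorph0.
- have e : psi0 r = psi u * g + psi v * p by rewrite -psiC ruv rmorphD !rmorphM GE PE.
  apply: poverS (psi0K r) => // x [xL xw]; split=> //.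
  move: xL; rewrite inE (negPf xw) /= mem_cat => /orP[/occ_vars gx|/occ_vars px]; [by left|by right].
Qed.

End IrreducibleRelations.

Lemma vars_list (V : choiceType) (R : comNzRingType) (p : mp V R) (l : seq V) :
  exists L, [/\ uniq L, {subset l <= L} & forall x, occ p x -> x \in L].
Proof.
exists (undup (l ++ flatten [seq enum_fset (finsupp m) | m : {cmonom V} <- mpsupp p])).
split=> [|x xl|x [m pm mx]]; rewrite ?undup_uniq // mem_undup mem_cat ?xl //.
apply/orP; right; apply/flattenP; exists (enum_fset (finsupp m)).
  by apply/mapP; exists m.
by rewrite -cmE_neq0 -lt0n.
Qed.

Section Multiples.
Context (E : fieldType) (V : choiceType).
Implicit Types (p q g : mp V E) (w : V).

Lemma model_of_mp w (ps : seq (mp V E)) :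
  exists n (psi : {rmorphism {poly ipoly E n} -> mp V E}) (psi0 : ipoly E n -> mp V E),
  [/\ injective psi, forall p, p \in ps -> exists P, psi P = p,
    forall P k, part w k (psi P) = psi0 P`_k, injective psi0 & forall c : ipoly E n, psi c%:P = psi0 c].
Proof.
have [n [psi [psi0 [inj surj _ partP [inj0 psiC _]]]]] :=
  ipoly_model (idfun : {rmorphism E -> E}) w (flatten [seq mpvars p | p <- ps]).
exists n, psi, psi0; split=> // p pps; apply: surj => m pm; split; first by exists (mcf p m).
move=> x mx; rewrite inE; apply/orP; right; apply/flattenP; exists (mpvars p); first exact: map_f.
by apply/occ_vars; exists m.
Qed.

Lemma occ_multiple c g w : c * g != 0 -> occ g w -> occ (c * g) w.
Proof.
move=> cg0 gw; have [n [psi [psi0 [inj surj partP inj0 psiC]]]] := model_of_mp w [:: c; g].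
have [C CE] := surj c (mem_head _ _); have [|G GE] := surj g; first by rewrite !inE eqxx orbT.
have C0 : C != 0 by apply: contraNneq cg0 => e; rewrite -CE e rmorph0 mul0r.
have G0 : G != 0 by apply: contraNneq cg0 => e; rewrite -GE e rmorph0 mulr0.
have sG : (1 < size G)%N by apply/(occ_size G inj0 psiC partP); rewrite GE.
rewrite -CE -GE -rmorphM; apply/(occ_size _ inj0 psiC partP).
rewrite size_mul // -subn1 ltn_subRL addnC.
by apply: leq_trans (leq_add (_ : 0 < size C)%N sG) _; rewrite ?size_poly_gt0 // addnC.
Qed.

Lemma part_pder w k p : part w k (pder w p) = part w k.+1 p *+ k.+1.
Proof.
apply/mpP => m; rewrite part_coef mcfMn part_coef; case: eqP => mw; last by rewrite mul0rn.
rewrite pder_coef cmM mw expcmnE cmUU muln1 add0n; congr (mcf p _ *+ _).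
by apply: cmonomP => y; rewrite !cmM !expcmnE mulSn; lia.
Qed.

(** In characteristic zero the derivative is nonzero, yet its degree in [w] is smaller than that of
    [g]: its coefficient at the top degree of [c * g] vanishes. *)
Lemma pder_not_multiple c g w : [pchar E] =i pred0 -> occ g w -> pder w g = c * g -> False.
Proof.
move=> ch gw e; have [n [psi [psi0 [inj surj partP inj0 psiC]]]] := model_of_mp w [:: c; g].
have [C CE] := surj c (mem_head _ _); have [|G GE] := surj g; first by rewrite !inE eqxx orbT.
have dg0 := pder_neq0 ch gw; have psi00 : psi0 0 = 0 by rewrite -psiC rmorph0.
have C0 : C != 0 by apply: contraNneq dg0 => e0; rewrite e -CE e0 rmorph0 mul0r.
have G0 : G != 0 by apply: contraNneq dg0 => e0; rewrite e -GE e0 rmorph0 mulr0.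
have CG0 : C * G != 0 by rewrite mulf_neq0.
have : lead_coef (C * G) != 0 by rewrite lead_coef_eq0.
rewrite lead_coefE => /negP; apply; apply/eqP/inj0; rewrite -partP rmorphM CE GE -e part_pder.
rewrite -GE partP nth_default ?psi00 ?mul0rn //.
have sC : (0 < size C)%N by rewrite size_poly_gt0.
have sG : (0 < size G)%N by rewrite size_poly_gt0.
by rewrite size_mul //; move: (size C) (size G) sC sG => a b; lia.
Qed.

End Multiples.

Definition addl (T : eqType) (S : T -> Prop) (l : seq T) : T -> Prop :=
  fun x => S x \/ x \in l.

Definition is_subfield (E : fieldType) (L : E -> Prop) : Prop :=
  [/\ L 1, forall x y, L x -> L y -> L (x - y), forall x y, L x -> L y -> L (x * y)
    & forall x, L x -> L x^-1].

(** * Algebraic dependence in a field *)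

Section SubfieldType.
Context (E : fieldType) (L : E -> Prop) (sL : is_subfield L).

(** The dummy [let] makes the predicate depend on the proof [sL], which the algebraic instances
    declared on it require. *)
Definition sf_pred : {pred E} := let _ := sL in fun x => `[< L x >].

Lemma sf_predP x : reflect (L x) (x \in sf_pred).
Proof. exact: asboolP. Qed.

Lemma sf_pred_divring : divring_closed sf_pred.
Proof.
have [L1 LB LM LV] := sL; split=> [|x y /sf_predP Lx /sf_predP Ly|x y /sf_predP Lx /sf_predP Ly];
  apply/sf_predP => //; first exact: LB.
exact/LM/LV.
Qed.

HB.instance Definition _ := GRing.isDivringClosed.Build E sf_pred sf_pred_divring.

Record sf_type : predArgType := SF {sf_val : E; sf_valP : sf_val \in sf_pred}.
HB.instance Definition _ := [isSub for sf_val].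
HB.instance Definition _ := [Choice of sf_type by <:].
HB.instance Definition _ := [SubChoice_isSubIntegralDomain of sf_type by <:].
HB.instance Definition _ := [SubIntegralDomain_isSubField of sf_type by <:].

Definition sf_inj : {rmorphism sf_type -> E} := (val : sf_type -> E).

Lemma sf_injP x : L x <-> exists y, x = sf_inj y.
Proof.
split=> [/sf_predP Lx|[[y yL] ->]]; last exact/sf_predP.
by exists (SF Lx).
Qed.

End SubfieldType.

Section AlgebraicClosure.
Context (E : fieldType).
Implicit Types (L S : E -> Prop) (x y : E).

Definition fgen S x := forall L, is_subfield L -> (forall y, S y -> L y) -> L x.

Definition alg_over L x :=
  exists p : {poly E}, [/\ p != 0, forall i, L p`_i & root p x].

Definition acl S := alg_over (fgen S).

Lemma subfield0 L : is_subfield L -> L 0.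
Proof. by case=> L1 LB _ _; rewrite -(subrr 1); apply: LB. Qed.

Lemma subfieldN L x : is_subfield L -> L x -> L (- x).
Proof. by move=> sL Lx; have [_ LB _ _] := sL; have := LB _ _ (subfield0 sL) Lx; rewrite sub0r. Qed.

Lemma subfieldD L x y : is_subfield L -> L x -> L y -> L (x + y).
Proof. by move=> sL Lx Ly; have [_ LB _ _] := sL; have := LB _ _ Lx (subfieldN sL Ly); rewrite opprK. Qed.

Lemma subfieldX L x n : is_subfield L -> L x -> L (x ^+ n).
Proof.
move=> sL Lx; case: (sL) => L1 _ LM _; elim: n => [|n IHn]; rewrite ?expr0 // exprS.
exact: LM.
Qed.

Lemma subfield_sum L (I : Type) (r : seq I) (P : pred I) (F : I -> E) :
  is_subfield L -> (forall i, P i -> L (F i)) -> L (\sum_(i <- r | P i) F i).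
Proof.
move=> sL LF; elim/big_ind: _ => //; first exact: subfield0.
by move=> x y; apply: subfieldD.
Qed.

Lemma subfield_prod L (I : Type) (r : seq I) (P : pred I) (F : I -> E) :
  is_subfield L -> (forall i, P i -> L (F i)) -> L (\prod_(i <- r | P i) F i).
Proof. by move=> sL LF; case: (sL) => L1 _ LM _; elim/big_ind: _. Qed.

Lemma subfield_horner L (p : {poly E}) x :
  is_subfield L -> (forall i, L p`_i) -> L x -> L p.[x].
Proof.
move=> sL Lp Lx; rewrite horner_coef; apply: subfield_sum => // i _.
by have [_ _ LM _] := sL; apply: LM => //; apply: subfieldX.
Qed.

Lemma fgen_subfield S : is_subfield (fgen S).
Proof.
split=> [L [] //|x y Sx Sy L sL SL|x y Sx Sy L sL SL|x Sx L sL SL];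
  case: (sL) => L1 LB LM LV; [apply: LB|apply: LM|apply: LV];
  by [apply: Sx|apply: Sy].
Qed.

Lemma fgen_ext S x : S x -> fgen S x.
Proof. by move=> Sx L _; apply. Qed.

(** Passes to the subfield as a type, where sums, products and inverses of algebraic elements are
    known to be algebraic. *)
Lemma alg_overP L (sL : is_subfield L) x : alg_over L x <-> algebraicOver (sf_inj sL) x.
Proof.
split=> [[p [p0 Lp px]]|[p p0 px]]; last first.
  exists (map_poly (sf_inj sL) p); split=> //; first by rewrite map_poly_eq0.
  by move=> i; rewrite coef_map; apply/sf_injP; exists p`_i.
have /choice[c cE] i : exists y : sf_type sL, p`_i = sf_inj sL y by apply/sf_injP.
have pE : p = map_poly (sf_inj sL) (\poly_(i < size p) c i).
  apply/polyP => i; rewrite coef_map coef_poly; case: ltnP => [_|/leq_sizeP->//].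
  exact: cE.
exists (\poly_(i < size p) c i); last by rewrite -pE.
by apply: contraNneq p0 => e; rewrite pE e rmorph0.
Qed.

Lemma alg_over_ext L x : is_subfield L -> L x -> alg_over L x.
Proof.
by move=> sL Lx; apply/(alg_overP sL); have /sf_injP[y ->] := Lx; apply: algebraic_id.
Qed.

Lemma alg_over_subfield L : is_subfield L -> is_subfield (alg_over L).
Proof.
move=> sL; split=> [|x y /(alg_overP sL) ax /(alg_overP sL) ay|
    x y /(alg_overP sL) ax /(alg_overP sL) ay|x /(alg_overP sL) ax]; apply/(alg_overP sL).
- exact: algebraic1.
- exact: algebraic_sub.
- exact: algebraic_mul.
- exact: algebraic_inv.
Qed.

Lemma alg_over_idem L x : is_subfield L -> alg_over (alg_over L) x -> alg_over L x.
Proof.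
move=> sL [p [p0 Lp px]]; apply/(alg_overP sL)/integral_algebraic.
apply: integral_root p0 px _ => _ /(nthP 0)[i _ <-].
exact/integral_algebraic/(alg_overP sL).
Qed.

Lemma alg_over_mono L L' x : (forall y, L y -> L' y) -> alg_over L x -> alg_over L' x.
Proof. by move=> LL [p [p0 Lp px]]; exists p; split=> // i; apply: LL. Qed.

Lemma acl_subfield S : is_subfield (acl S).
Proof. exact/alg_over_subfield/fgen_subfield. Qed.

Lemma fgen_acl S x : fgen S x -> acl S x.
Proof. exact/alg_over_ext/fgen_subfield. Qed.

Lemma acl_ext S x : S x -> acl S x.
Proof. by move/fgen_ext/fgen_acl. Qed.

Lemma acl_min S S' x : (forall y, S y -> acl S' y) -> acl S x -> acl S' x.
Proof.
move=> SS; move=> aS; apply: alg_over_idem; first exact: fgen_subfield.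
by apply: alg_over_mono aS => y; apply=> //; apply: acl_subfield.
Qed.

Lemma fgen_mono S S' x : (forall y, S y -> S' y) -> fgen S x -> fgen S' x.
Proof. by move=> SS; apply=> [|y /SS]; [exact: fgen_subfield|exact: fgen_ext]. Qed.

Lemma fgen_frac S y x : fgen (addl S [:: y]) x ->
  exists p q : {poly E}, [/\ forall i, fgen S p`_i, forall i, fgen S q`_i, q.[y] != 0
    & x = p.[y] / q.[y]].
Proof.
have sS := fgen_subfield S; have [S1 SB SM SV] := sS; have S0 := subfield0 sS.
have C c : fgen S c -> forall i, fgen S (c%:P)`_i by move=> Sc i; rewrite coefC; case: eqP.
have B (p q : {poly E}) : (forall i, fgen S p`_i) -> (forall i, fgen S q`_i) ->
    forall i, fgen S (p - q)`_i by move=> Sp Sq i; rewrite coefB; apply: SB.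
have M (p q : {poly E}) : (forall i, fgen S p`_i) -> (forall i, fgen S q`_i) ->
    forall i, fgen S (p * q)`_i.
  by move=> Sp Sq i; rewrite coefM; apply: subfield_sum => // j _; apply: SM.
pose L z := exists p q : {poly E}, [/\ forall i, fgen S p`_i, forall i, fgen S q`_i,
  q.[y] != 0 & z = p.[y] / q.[y]].
move=> /(_ L); apply=> [|z [Sz|]].
- split.
  + by exists 1%:P, 1%:P; rewrite hornerC oner_eq0 divr1; split=> //; apply: C.
  + move=> _ _ [p [q [Sp Sq q0 ->]]] [p' [q' [Sp' Sq' q0' ->]]].
    exists (p * q' - p' * q), (q * q'); rewrite !hornerE mulf_neq0 //; split=> //.
    * by apply: B; apply: M.
    * exact: M.
    * by rewrite -mulNr addf_div // mulNr.
  + move=> _ _ [p [q [Sp Sq q0 ->]]] [p' [q' [Sp' Sq' q0' ->]]].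
    exists (p * p'), (q * q'); rewrite !hornerM mulf_neq0 //; split=> //; try exact: M.
    by rewrite mulf_div.
  + move=> _ [p [q [Sp Sq q0 ->]]]; have [p0|p0] := eqVneq p.[y] 0.
      by exists 0%:P, 1%:P; rewrite !hornerC oner_eq0 p0 !mul0r invr0; split=> //; apply: C.
    by exists q, p; rewrite invf_div; split.
- exists z%:P, 1%:P; rewrite !hornerC oner_eq0 divr1; split=> //; apply: C => //.
  exact: fgen_ext.
- rewrite inE => /eqP ->; exists 'X, 1%:P; rewrite hornerC hornerX oner_eq0 divr1; split=> //.
    by move=> i; rewrite coefX; case: eqP.
  exact: C.
Qed.

(* An equation for [x] over [S(y)], cleared of denominators, is an equation for
   [y] over [S(x)]; it is nonzero because [x] is transcendental over [S]. *)
Lemma acl_exch S x y : acl (addl S [:: y]) x -> ~ acl S x -> acl (addl S [:: x]) y.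
Proof.
have sS := fgen_subfield S; have [S1 SB SM SV] := sS; have S0 := subfield0 sS.
move=> [c [c0 Sc cx]] nx.
have /choice[p /choice[q pq]] i := fgen_frac (Sc i).
pose n := size c; pose Q i := \prod_(j < n | j != i :> nat) q j.
pose r i := p i * Q i.
have Sr i j : fgen S (r i)`_j.
  have [Sp _ _ _] := pq i; rewrite coefM; apply: subfield_sum => // k _; apply: (SM) => //.
  rewrite /Q; elim/big_ind: _ (j - k)%N => [l|f g Hf Hg l|l _ l'].
  - by rewrite coefC; case: eqP.
  - by rewrite coefM; apply: subfield_sum => // t _; apply: (SM).
  - by have [] := pq l.
pose D := \prod_(j < n) (q j).[y].
have D0 : D != 0 by apply/prodf_neq0 => j _; have [] := pq j.
have rE i : (i < n)%N -> (r i).[y] = D * c`_i.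
  move=> ni; have [_ _ q0 ->] := pq i; rewrite /r hornerM horner_prod.
  have -> : D = (q i).[y] * \prod_(j < n | j != i :> nat) (q j).[y].
    by rewrite /D (bigD1 (Ordinal ni)).
  by field.
pose N := \max_(i < n) size (r i).
have szr (i : 'I_n) : (size (r i) <= N)%N by apply: leq_bigmax.
(* The array of coefficients is transposed: [R j] is the factor of [y ^ j], read as a polynomial in
   [x]. *)
pose R j := \poly_(i < n) (r i)`_j.
have RE : \sum_(j < N) (R j).[x] * y ^+ j = 0.
  transitivity (\sum_(i < n) (r i).[y] * x ^+ i).
    under eq_bigr do rewrite horner_poly mulr_suml.
    rewrite exchange_big; apply: eq_bigr => i _ /=.
    rewrite (horner_coef_wide _ (szr i)) mulr_suml; apply: eq_bigr => j _; ring.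
  under eq_bigr do rewrite rE ?ltn_ord // -mulrA.
  by rewrite -mulr_sumr -horner_coef (rootP cx) mulr0.
pose W := \poly_(j < N) (R j).[x].
exists W; split; last first.
- by apply/rootP; rewrite horner_poly.
- move=> j; rewrite coef_poly; case: ifP => _; last first.
    exact: (subfield0 (fgen_subfield _)).
  apply: (@subfield_horner (fgen (addl S [:: x]))); first exact: fgen_subfield.
    move=> i; apply: (@fgen_mono S); first by move=> z; left.
    by rewrite coef_poly; case: ifP.
  by apply: fgen_ext; right; rewrite inE.
have [i ni ci] : exists2 i, (i < n)%N & c`_i != 0.
  exists n.-1; last by rewrite -lead_coefE lead_coef_eq0.
  by rewrite prednK // size_poly_gt0.
have : (r i).[y] != 0 by rewrite rE // mulf_neq0.
apply: contraNneq => W0; suff -> : r i = 0 by rewrite horner0.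
apply/polyP => j; rewrite coef0; have [jN|Nj] := ltnP j N; last first.
  by apply: nth_default; apply: leq_trans Nj; apply: (szr (Ordinal ni)).
have Rx : (R j).[x] = 0 by have := congr1 (fun w : {poly E} => w`_j) W0; rewrite coef_poly jN coef0.
have R0 : R j = 0.
  apply: contra_notP nx => /eqP nR; exists (R j); split=> //; last exact/rootP.
  by move=> k; rewrite coef_poly; case: ifP.
by have := congr1 (fun w : {poly E} => w`_i) R0; rewrite coef_poly ni coef0.
Qed.

Lemma fgen_finite S x : fgen S x ->
  exists2 l : seq E, (forall y, y \in l -> S y) & fgen (fun y => y \in l) x.
Proof.
have mono (l l' : seq E) z : fgen (fun y => y \in l) z -> {subset l <= l'} ->
  fgen (fun y => y \in l') z by move=> H sub; apply: fgen_mono H.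
pose L z := exists2 l : seq E, (forall y, y \in l -> S y) & fgen (fun y => y \in l) z.
move=> /(_ L); apply=> [|y Sy]; last first.
  by exists [:: y] => [z|]; rewrite ?inE; [move/eqP->|apply: fgen_ext; rewrite inE].
have two (f : E -> E -> E) : (forall S x y, fgen S x -> fgen S y -> fgen S (f x y)) ->
    forall x y, (exists2 l : seq E, (forall y, y \in l -> S y) & fgen (fun y => y \in l) x) ->
    (exists2 l : seq E, (forall y, y \in l -> S y) & fgen (fun y => y \in l) y) ->
    exists2 l : seq E, (forall y, y \in l -> S y) & fgen (fun y => y \in l) (f x y).
  move=> Hf a b [l lS la] [l' lS' lb]; exists (l ++ l').
    by move=> y; rewrite mem_cat => /orP[/lS|/lS'].
  by apply: Hf; [apply: mono la _|apply: mono lb _] => y; rewrite mem_cat => ->; rewrite ?orbT.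
split.
- by exists [::] => //; have [] := fgen_subfield (fun y => y \in [::]).
- by apply: two => S' a b; have [_ + _ _] := fgen_subfield S'; apply.
- by apply: two => S' a b; have [_ _ + _] := fgen_subfield S'; apply.
- by move=> a [l lS la]; exists l => //; have [_ _ _] := fgen_subfield (fun y => y \in l); apply.
Qed.

Lemma acl_finite S x : acl S x ->
  exists2 l : seq E, (forall y, y \in l -> S y) & acl (fun y => y \in l) x.
Proof.
case=> p [p0 Sp px].
have /choice[l lP] i : exists l : seq E,
    (forall y, y \in l -> S y) /\ fgen (fun y => y \in l) p`_i.
  by have [l l1 l2] := fgen_finite (Sp i); exists l.
exists (flatten [seq l i | i <- iota 0 (size p)]).
  by move=> y /flattenP[_ /mapP[i _ ->] yl]; have [+ _] := lP i; apply.
exists p; split=> // i; have [ip|pi] := ltnP i (size p); last first.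
  by rewrite nth_default //; exact: (subfield0 (fgen_subfield _)).
have [_] := lP i; apply: fgen_mono => y yl.
by apply/flattenP; exists (l i) => //; apply: map_f; rewrite mem_iota.
Qed.

End AlgebraicClosure.

(** * Independence and exchange for algebraic closure *)

Section TranscendenceMatroid.
Context (E : fieldType).
Implicit Types (S : E -> Prop) (x y : E) (xs ys zs : seq E).

Lemma acl_mono S S' x : (forall y, S y -> S' y) -> acl S x -> acl S' x.
Proof. by move=> SS; apply: acl_min => y /SS/acl_ext. Qed.

(** The recursive form suits adding one element at a time; that the order of the list does not
    matter is [ind_perm]. *)
Fixpoint ind (S : E -> Prop) (xs : seq E) : Prop :=
  if xs is x :: xs' then ~ acl (addl S xs') x /\ ind S xs' else True.

Definition spans (S : E -> Prop) (ys xs : seq E) := forall x, x \in xs -> acl (addl S ys) x.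

Lemma spans_refl S xs ys : {subset xs <= ys} -> spans S ys xs.
Proof. by move=> sub x /sub xy; apply: acl_ext; right. Qed.

Lemma spans_cl S ys xs x : spans S ys xs -> acl (addl S xs) x -> acl (addl S ys) x.
Proof. by move=> sp; apply: acl_min => y [Sy|/sp//]; apply: acl_ext; left. Qed.

Lemma spans_trans S xs ys zs : spans S zs ys -> spans S ys xs -> spans S zs xs.
Proof. by move=> zy yx x /yx; apply: spans_cl. Qed.

Lemma exchange_list S ys x : acl (addl S ys) x -> ~ acl S x ->
  exists l1 y l2, ys = l1 ++ y :: l2 /\ acl (addl S (x :: l1 ++ l2)) y.
Proof.
elim: ys S => [|y ys IHys] S clx nx.
  by case: nx; apply: acl_min clx => z [/acl_ext|].
have [cy|ny] := pselect (acl (addl S [:: y]) x).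
  exists [::], y, ys; split=> //; apply: acl_mono (acl_exch cy nx) => z.
  by rewrite /addl !inE => -[?|->]; [left|right].
have [|l1 [z [l2 [-> cz]]]] := IHys (addl S [:: y]) _ ny.
  apply: acl_mono clx => z [Sz|]; first by left; left.
  by rewrite inE => /orP[zy|zys]; [left; right; rewrite inE|right].
exists (y :: l1), z, l2; split=> //; apply: acl_mono cz => t.
rewrite /addl !inE => -[[St|->]|]; [by left|by right; rewrite !orbT|].
by case/orP=> [->|tl]; right; rewrite ?orbT // tl !orbT.
Qed.

Lemma steinitz S xs ys : ind S xs -> spans S ys xs ->
  exists zs, [/\ (size xs + size zs = size ys)%N, {subset zs <= ys} & spans S (xs ++ zs) ys].
Proof.
elim: xs => [|x xs IHxs] /=; first by exists ys; split=> //; exact: spans_refl.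
move=> [nx ixs] sp; have [|zs [sz zsub zsp]] := IHxs ixs.
  by move=> y yx; apply: sp; rewrite inE yx orbT.
have cx : acl (addl (addl S xs) zs) x.
  apply: acl_mono (spans_cl zsp (sp x (mem_head _ _))) => y.
  by rewrite /addl mem_cat => -[?|/orP[?|?]]; [left; left|left; right|right].
have [l1 [y [l2 [zE cy]]]] := exchange_list cx nx.
exists (l1 ++ l2); split.
- by rewrite -sz zE !size_cat /= !addnS.
- by move=> z zl; apply: zsub; rewrite zE; move: zl; rewrite !mem_cat inE => /orP[]->; rewrite ?orbT.
- apply: spans_trans zsp => z; rewrite mem_cat => /orP[zx|].
    by apply: acl_ext; right; rewrite /= inE mem_cat zx orbT.
  rewrite zE mem_cat inE => /or3P[zl|/eqP ->|zl].
  + by apply: acl_ext; right; rewrite /= inE !mem_cat zl !orbT.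
  + apply: acl_mono cy => t; rewrite /addl /= !inE !mem_cat.
    by move=> [[St|->]|/or3P[]->]; rewrite ?orbT; [left|right|right|right|right].
  + by apply: acl_ext; right; rewrite /= inE !mem_cat zl !orbT.
Qed.

Lemma ind_leq S xs ys : ind S xs -> spans S ys xs -> (size xs <= size ys)%N.
Proof. by move=> ix /(steinitz ix)[zs [<- _ _]]; rewrite leq_addr. Qed.

(** A description that ignores the order of the list; change of base, permutation and passage to a
    spanning list of the same size follow from it. *)
Lemma indP S xs : ind S xs <-> forall ys, spans S ys xs -> (size xs <= size ys)%N.
Proof.
split=> [ix ys|]; first exact: ind_leq.
elim: xs => //= x xs IHxs H; split.
  move=> cx; have /H : spans S xs (x :: xs).
    by move=> y; rewrite inE => /predU1P[->//|yx]; apply: acl_ext; right.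
  by rewrite /= ltnn.
apply: IHxs => ys sp; have /H : spans S (x :: ys) (x :: xs).
  move=> y; rewrite inE => /predU1P[->|/sp].
    by apply: acl_ext; right; rewrite mem_head.
  by apply: acl_mono => z; rewrite /addl inE => -[?|->]; [left|right; rewrite orbT].
by [].
Qed.

Lemma ind_of_span S xs ys : ind S xs -> spans S ys xs -> (size ys <= size xs)%N -> ind S ys.
Proof.
move=> ix sp le; apply/indP => zs zy; apply: leq_trans le (ind_leq ix _).
exact: spans_trans zy sp.
Qed.

Lemma ind_cat S xs ys : ind S (xs ++ ys) <-> ind S ys /\ ind (addl S ys) xs.
Proof.
elim: xs => [|x xs IHxs] /=; first by split=> [|[]].
rewrite IHxs; have cE : acl (addl S (xs ++ ys)) x <-> acl (addl (addl S ys) xs) x.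
  split; apply: acl_mono => y; rewrite /addl mem_cat.
      by case=> [?|/orP[?|?]]; [left; left|right|left; right].
    by case=> [[?|->]|->]; [left|right; rewrite orbT|right].
by rewrite cE; tauto.
Qed.

Lemma spans_sub S S' xs ys ys' : (forall x, S x -> acl S' x) -> {subset ys <= ys'} ->
  spans S ys xs -> spans S' ys' xs.
Proof.
move=> SS sub sp x /sp; apply: acl_min => y [/SS|/sub yy]; last by apply: acl_ext; right.
by apply: acl_mono => z; left.
Qed.

Lemma ind_base S S' xs : (forall x, S x -> acl S' x) -> ind S' xs -> ind S xs.
Proof. by move=> SS /indP H; apply/indP => ys sp; apply/H/(spans_sub SS _ sp). Qed.

Lemma ind_perm S xs ys : perm_eq xs ys -> ind S xs -> ind S ys.
Proof.
move=> pxy /indP H; apply/indP => zs sp; rewrite -(perm_size pxy); apply: H.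
by move=> x; rewrite (perm_mem pxy) => /sp.
Qed.

Lemma basis_mask S xs : exists b, ind S (mask b xs) /\ spans S (mask b xs) xs.
Proof.
elim: xs => [|x xs [b [ib sp]]]; first by exists [::].
have [cx|ncx] := pselect (acl (addl S (mask b xs)) x).
  by exists (false :: b); split=> //= y; rewrite inE => /predU1P[->//|/sp].
exists (true :: b); split=> //= y; rewrite inE => /predU1P[->|/sp].
  by apply: acl_ext; right; rewrite mem_head.
by apply: acl_mono => z; rewrite /addl inE => -[?|->]; [left|right; rewrite orbT].
Qed.

End TranscendenceMatroid.

Section Relations.
Context (E : fieldType) (V : choiceType) (a : V -> E).
Implicit Types (K L : E -> Prop) (S : V -> Prop) (p q : mp V E).
Local Notation ev := (mpev (idfun : {rmorphism E -> E}) a).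

Lemma subfield_subring K : is_subfield K -> subring_pred K.
Proof. by case=> K1 KB KM _; split. Qed.

Lemma subfield_ev K S L p : is_subfield L -> (forall c, K c -> L c) ->
  (forall x, S x -> L (a x)) -> pover K S p -> L (ev p).
Proof.
move=> sL KL SL pK; have [L1 LB LM LV] := sL.
elim/pover_ind: pK => {p} [|p q Lp Lq|c Kc|p x Sx Lp].
- by rewrite rmorph0; apply: subfield0.
- by rewrite rmorphD; apply: subfieldD.
- by rewrite mpevC; apply: KL.
- by rewrite rmorphM mpevX; apply: LM => //; apply: SL.
Qed.

Lemma clear_denominators (A : E -> Prop) (n : nat) (c : nat -> E) :
  A 1 -> (forall x y, A x -> A y -> A (x * y)) ->
  (forall i, exists x y, [/\ A x, A y, y != 0 & c i = x / y]) ->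
  exists2 D, D != 0 & forall i, (i < n)%N -> A (D * c i).
Proof.
move=> A1 AM cE.
suff [D [D0 AD Dc]] : exists D, [/\ D != 0, A D & forall i, (i < n)%N -> A (D * c i)].
  by exists D.
elim: n => [|k [D [D0 AD Dc]]]; first by exists 1; rewrite oner_neq0.
have [x [y [Ax Ay y0 ck]]] := cE k.
exists (D * y); split; [exact: mulf_neq0 D0 y0 | exact: (AM _ _ AD Ay) |].
move=> i; rewrite ltnS leq_eqVlt => /predU1P[->|/Dc ADc].
  have -> : D * y * c k = D * x by rewrite ck; field.
  exact: AM.
by rewrite mulrAC; apply: AM.
Qed.

Lemma fgen_ratio K S z : is_subfield K ->
  fgen (fun y => K y \/ exists2 x, S x & y = a x) z ->
  exists p q, [/\ pover K S p, pover K S q, ev q != 0 & z = ev p / ev q].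
Proof.
move=> sK; have sKr := subfield_subring sK; have [K1 _ _ _] := sK.
pose L z := exists p q, [/\ pover K S p, pover K S q, ev q != 0 & z = ev p / ev q].
have P1 : pover K S 1 by have [] := pover_subring S sKr.
move=> /(_ L); apply=> [|y [Ky|[x Sx ->]]].
- split.
  + by exists 1, 1; rewrite rmorph1 oner_eq0 divr1; split.
  + move=> _ _ [p [q [Sp Sq q0 ->]]] [p' [q' [Sp' Sq' q0' ->]]].
    exists (p * q' - p' * q), (q * q'); rewrite rmorphB !rmorphM mulf_neq0 //; split=> //.
    * by have [_ PB _] := pover_subring S sKr; apply: PB; apply: (poverM sKr).
    * exact: (poverM sKr).
    * by field; rewrite q0 q0'.
  + move=> _ _ [p [q [Sp Sq q0 ->]]] [p' [q' [Sp' Sq' q0' ->]]].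
    exists (p * p'), (q * q'); rewrite !rmorphM mulf_neq0 //; split=> //; try exact: (poverM sKr).
    by rewrite mulf_div.
  + move=> _ [p [q [Sp Sq q0 ->]]]; have [p0|p0] := eqVneq (ev p) 0.
      exists 0, 1; rewrite rmorph0 rmorph1 oner_eq0 p0 !mul0r invr0; split=> //.
      exact: (pover0 _ sKr).
    by exists q, p; rewrite invf_div; split.
- by exists (mpc y), 1; rewrite rmorph1 mpevC oner_eq0 divr1; split=> //; apply: poverC.
- by exists (mpx x), 1; rewrite rmorph1 mpevX oner_eq0 divr1; split=> //; apply: (poverX sKr).
Qed.

(** Expanded in powers of the first variable, [p] becomes an equation of its value over the
    remaining ones. Independence makes the equation trivial, and induction applies to its
    coefficients. *)
Lemma ind_no_relation K (L : seq V) p : is_subfield K -> ind K (map a L) ->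
  pover K (fun x => x \in L) p -> ev p = 0 -> p = 0.
Proof.
move=> sK; have sKr := subfield_subring sK.
elim: L p => [|w L IHL] p /= iL pK ep.
  have [c pc] : exists c, p = mpc c.
    elim/pover_ind: pK => {p ep} [|_ _ [c ->] [c' ->]|c _|//].
    - by exists 0; rewrite rmorph0.
    - by exists (c + c'); rewrite rmorphD.
    - by exists c.
  by move: ep; rewrite pc mpevC => /= ->; rewrite rmorph0.
have [nw iL'] := iL; have [N pE] := part_sumE w p.
pose W := \poly_(k < N) ev (part w k p).
have partK k : pover K (fun x => x \in L) (part w k p).
  apply: poverS (pover_part sKr pK) => // x; rewrite inE.
  by case=> /predU1P[->|//]; rewrite eqxx.
have W0 : W = 0.
  apply: contra_notP nw => /eqP W0; exists W; split=> //.
    move=> i; rewrite coef_poly; case: ifP => _; last exact: (subfield0 (fgen_subfield _)).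
    apply: (subfield_ev (fgen_subfield _) _ _ (partK i)) => [c Kc|x xL]; apply: fgen_ext.
      by left.
    by right; apply: map_f.
  apply/rootP; rewrite horner_poly -[RHS]ep [in RHS]pE rmorph_sum.
  by apply: eq_bigr => k _; rewrite rmorphM rmorphXn mpevX.
rewrite pE big1 // => k _; rewrite (IHL _ iL' (partK k)) ?mul0r //.
have := congr1 (fun W : {poly E} => W`_k) W0.
by rewrite coef_poly ltn_ord coef0.
Qed.

(** The relation is an algebraic equation of one value over independent ones, with denominators
    cleared. Since [L] has no repetition its coefficients are free of [w], so a nonzero coefficient
    keeps the whole nonzero. *)
Lemma dependent_relation K (L : seq V) : is_subfield K -> uniq L -> ~ ind K (map a L) ->
  exists p, [/\ pover K (fun x => x \in L) p, p != 0 & ev p = 0].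
Proof.
move=> sK; have sKr := subfield_subring sK; have [K1 _ _ _] := sK.
elim: L => [|w L IHL] /=; first by move=> _ [].
case/andP=> wL uL niL.
have [iL|niL'] := pselect (ind K (map a L)); last first.
  have [p [pK p0 ep]] := IHL uL niL'; exists p; split=> //.
  by apply: poverS pK => // x xL; rewrite inE xL orbT.
have [c [c0 cK cw]] : acl (addl K (map a L)) (a w) by apply: contrapT => n; apply: niL.
pose S x := x \in L.
have fr i : exists p q, [/\ pover K S p, pover K S q, ev q != 0 & c`_i = ev p / ev q].
  apply: fgen_ratio => //; apply: fgen_mono (cK i) => y [Ky|/mapP[x xL ->]]; first by left.
  by right; exists x.
pose A z := exists2 p, pover K S p & z = ev p.
have [D D0 AD] : exists2 D, D != 0 & forall i, (i < size c)%N -> A (D * c`_i).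
  apply: clear_denominators => [|_ _ [p pK ->] [q qK ->]|i].
  - by exists 1; rewrite ?rmorph1 //; have [] := pover_subring S sKr.
  - by exists (p * q); rewrite ?rmorphM //; apply: (poverM sKr).
  - have [p [q [pK qK q0 ->]]] := fr i.
    by exists (ev p), (ev q); split=> //; [exists p|exists q].
have /choice[r rP] i : exists r, (i < size c)%N -> pover K S r /\ D * c`_i = ev r.
  have [/AD[r rK e]|] := ltnP i (size c); first by exists r.
  by exists 0.
exists (\sum_(i < size c) r i * mpx w ^+ i); split.
- apply: (pover_sum sKr) => i _; have [rK _] := rP i (ltn_ord i); apply: (poverM sKr).
    by apply: poverS rK => // x xL; rewrite inE; apply/orP; right.
  by apply: (poverXn sKr); apply: (poverX sKr); rewrite mem_head.
- have ic : ((size c).-1 < size c)%N by rewrite prednK // size_poly_gt0.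
  have ci : c`_(size c).-1 != 0 by rewrite -lead_coefE lead_coef_eq0.
  have free (i : 'I_(size c)) : ~ occ (r i) w.
    have [rK _] := rP i (ltn_ord i).
    by have [_ oS] := proj1 (pover_occ _ _ sKr) rK; move/oS; rewrite /S (negPf wL).
  have : r (size c).-1 != 0.
    have [_ e] := rP _ ic; apply: contraNneq (mulf_neq0 D0 ci) => r0.
    by rewrite e r0 rmorph0.
  apply: contra_neq => s0; have := part0 E w (size c).-1; rewrite -[X in part _ _ X]s0 part_sum.
  rewrite (bigD1 (Ordinal ic)) //= (part_mulXn _ _ (free (Ordinal ic))) eqxx mulr1n big1 ?addr0 // => i.
  by rewrite -val_eqE /= eq_sym part_mulXn // => /negPf ->; rewrite mulr0n.
- transitivity (D * c.[a w]); last by rewrite (rootP cw) mulr0.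
  rewrite rmorph_sum horner_coef mulr_sumr.
  apply: eq_bigr => i _; rewrite rmorphM rmorphXn mpevX mulrA.
  by have [_ ->] := rP i (ltn_ord i).
Qed.

End Relations.

Section AlgIndep.
Context (E : fieldType) (K : E -> Prop) (sK : is_subfield K).

Lemma mpev_peval (X : choiceType) (a : X -> E) (p : {malg E[{cmonom X}]}) :
  mpev (idfun : {rmorphism E -> E}) a (to_mp p) = peval a p.
Proof. by rewrite mpevE. Qed.

Lemma pover_to_mp (X : choiceType) (S : X -> Prop) (p : {malg E[{cmonom X}]}) :
  coeffs_in K p -> (forall m, m \in msupp p -> forall x, (0 < m x)%N -> S x) ->
  pover K S (to_mp p).
Proof.
by move=> Kp Sp m; rewrite /mpsupp /mcf to_mpK => mp; split; [exact: Kp | exact: Sp].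
Qed.

Lemma alg_indepP xs : alg_indep K xs <-> ind K xs.
Proof.
pose a (i : 'I_(size xs)) := nth 0 xs i.
have xsE : map a (enum 'I_(size xs)) = xs.
  by rewrite /a (map_comp (nth 0 xs)) val_enum_ord -/(mkseq _ _) mkseq_nth.
split=> [ai|ixs p Kp ep].
  apply: contrapT; rewrite -xsE.
  move=> /(dependent_relation sK (enum_uniq _))[p [pK p0 ep]].
  case/eqP: p0; apply: (can_inj of_mpK); rewrite rmorph0.
  apply: ai; first by move=> m; apply: (pover_coef (subfield_subring sK) m pK).
  by rewrite -mpev_peval of_mpK.
have /(congr1 of_mp) : to_mp p = 0.
  apply: (ind_no_relation sK (a := a) (L := enum 'I_(size xs))); first by rewrite xsE.
    by apply: pover_to_mp => // m _ x _; rewrite mem_enum.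
  by rewrite mpev_peval.
by rewrite to_mpK rmorph0.
Qed.

End AlgIndep.

Section Rank.
Context (E : fieldType).
Implicit Types (S : E -> Prop) (xs ys zs : seq E).

(** The basis is chosen; [rank_le_size] and [rank_ge] show that its size does not depend on the
    choice. *)
Definition rank S xs : nat := size (mask (sval (cid (basis_mask S xs))) xs).

Lemma rank_basis S xs : exists ys,
  [/\ {subset ys <= xs}, ind S ys, spans S ys xs & size ys = rank S xs].
Proof.
rewrite /rank; case: (cid _) => b /= [ib sp]; exists (mask b xs); split=> //.
by move=> x; apply: mem_mask.
Qed.

Lemma rank_le_size S xs ys : spans S ys xs -> (rank S xs <= size ys)%N.
Proof.
have [zs [sub iz _ <-]] := rank_basis S xs; move=> sp; apply: ind_leq iz _.
by move=> z /sub/sp.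
Qed.

Lemma rank_ge S xs ys : ind S ys -> spans S xs ys -> (size ys <= rank S xs)%N.
Proof.
have [zs [_ _ sp <-]] := rank_basis S xs; move=> iy sp'; apply: ind_leq iy _.
exact: spans_trans sp sp'.
Qed.

Lemma rank_mono S xs ys : spans S ys xs -> (rank S xs <= rank S ys)%N.
Proof.
have [zs [_ _ sp <-]] := rank_basis S ys => sp'; apply: rank_le_size.
exact: spans_trans sp sp'.
Qed.

Lemma rank_eq_mem S xs ys : xs =i ys -> rank S xs = rank S ys.
Proof.
by move=> e; apply/eqP; rewrite eqn_leq !rank_mono //; apply: spans_refl => x; rewrite e.
Qed.

Lemma rank_cat S xs ys : rank S (xs ++ ys) = (rank (addl S ys) xs + rank S ys)%N.
Proof.
have [X [Xs iX spX <-]] := rank_basis (addl S ys) xs.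
have [Y [Ys iY spY <-]] := rank_basis S ys.
rewrite -size_cat.
have iXY : ind S (X ++ Y).
  apply/ind_cat; split=> //; apply: ind_base iX => y [Sy|/Ys yY]; apply: acl_ext; first by left.
  by right.
have sp : spans S (X ++ Y) (xs ++ ys).
  move=> x; rewrite mem_cat => /orP[/spX|/spY].
    apply: acl_min => y [[Sy|/spY]|yX].
    - by apply: acl_ext; left.
    - by apply: acl_mono => z [Sz|zY]; [left|right; rewrite mem_cat zY orbT].
    - by apply: acl_ext; right; rewrite mem_cat yX.
  by apply: acl_mono => z [Sz|zY]; [left|right; rewrite mem_cat zY orbT].
apply/eqP; rewrite eqn_leq rank_le_size //= rank_ge //.
apply: spans_refl => x; rewrite !mem_cat => /orP[/Xs->|/Ys->]; by rewrite ?orbT.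
Qed.

Lemma has_trdeg_rank K xs r : is_subfield K -> has_trdeg K xs r -> rank K xs = r.
Proof.
move=> sK [[b [/(alg_indepP sK) ib <-]] mx]; apply/eqP; rewrite eqn_leq.
apply/andP; split.
  by rewrite /rank; case: (cid _) => b' /= [/(alg_indepP sK)/mx].
by apply: rank_ge => //; apply: spans_refl => x; apply: mem_mask.
Qed.

Lemma ind_rank_span S xs ys : spans S ys xs -> (size ys <= rank S xs)%N -> ind S ys.
Proof.
have [zs [sub iz spz <-]] := rank_basis S xs => sp le.
by apply: ind_of_span iz _ le => z /sub/sp.
Qed.

End Rank.

(** * Derivations and prolongations of the generic point *)

Section Derivation.
Context (E : fieldType) (delta : E -> E).
Hypotheses (Hdelta : is_derivation delta) (Hchar : [pchar E] =i pred0).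
Implicit Types (S : E -> Prop) (x y : E).

Lemma derD x y : delta (x + y) = delta x + delta y.
Proof. exact: (proj1 Hdelta). Qed.

Lemma derM x y : delta (x * y) = delta x * y + x * delta y.
Proof. exact: (proj2 Hdelta). Qed.

Lemma der0 : delta 0 = 0.
Proof. by apply: (addIr (delta 0)); rewrite add0r -derD addr0. Qed.

Lemma der1 : delta 1 = 0.
Proof.
have := derM 1 1; rewrite !mulr1 mul1r => e.
by apply: (addIr (delta 1)); rewrite add0r -e.
Qed.

Lemma derN x : delta (- x) = - delta x.
Proof. by apply: (addIr (delta x)); rewrite addNr -derD addNr der0. Qed.

Lemma derB x y : delta (x - y) = delta x - delta y.
Proof. by rewrite derD derN. Qed.

Lemma derV x : delta x^-1 = - delta x * x^-1 ^+ 2.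
Proof.
have [->|x0] := eqVneq x 0; first by rewrite invr0 der0 oppr0 mul0r.
have := derM x x^-1; rewrite divff // der1 => e.
apply: (mulfI x0); have -> : x * delta x^-1 = - (delta x / x).
  by apply: (addrI (delta x / x)); rewrite -e subrr.
by field.
Qed.

Lemma derXn x n : delta (x ^+ n) = (x ^+ n.-1 * delta x) *+ n.
Proof.
elim: n => [|n IHn]; first by rewrite expr0 der1 mulr0n.
rewrite exprS derM IHn /= mulrS mulrC; congr (_ + _).
case: n {IHn} => [|n]; first by rewrite !mulr0n mulr0.
by rewrite mulrnAr mulrA -exprS.
Qed.

Lemma der_sum (I : Type) (r : seq I) (P : pred I) (F : I -> E) :
  delta (\sum_(i <- r | P i) F i) = \sum_(i <- r | P i) delta (F i).
Proof. by elim/big_rec2: _ => [|i y1 y2 _ <-]; rewrite ?der0 ?derD. Qed.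

(* Differentiating an equation of minimal degree of [x] gives a linear equation for [delta x]. *)
Lemma acl_delta S S' x :
  (forall y, S y -> acl S' y) -> (forall y, S y -> acl S' (delta y)) ->
  acl S x -> acl S' (delta x).
Proof.
move=> SS dS aSx; have aS'x := acl_min SS aSx.
have sA := acl_subfield S'; have [A1 AB AM AV] := sA.
have dfgen y : fgen S y -> acl S' y /\ acl S' (delta y).
  pose L y := acl S' y /\ acl S' (delta y).
  move=> /(_ L); apply=> [|z Sz]; last by split; [exact: SS | exact: dS].
  split=> [|a b [Aa Ada] [Ab Adb]|a b [Aa Ada] [Ab Adb]|a [Aa Ada]].
  - by split; rewrite ?der1; [exact: A1 | exact: subfield0 sA].
  - by split; rewrite ?derB; exact: AB.
  - by split; rewrite ?derM; [exact: (AM) | apply: (subfieldD sA); exact: (AM)].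
  - split; rewrite ?derV; [exact: (AV) | apply: (AM); first exact: subfieldN].
    by apply: (subfieldX _ sA); exact: (AV).
have ex : exists n, `[< exists p : {poly E},
    [/\ p != 0, forall i, fgen S p`_i, root p x & size p = n] >].
  by have [p [p0 Sp px]] := aSx; exists (size p); apply/asboolP; exists p.
case: (ex_minnP ex) => n /asboolP[p [p0 Sp px sp]] mn.
have sp1 : (1 < size p)%N.
  rewrite ltnNge; apply/negP => le; move: px p0; rewrite (size1_polyC le) rootC => /eqP ->.
  by rewrite polyC0 eqxx.
have dp : p^`().[x] != 0.
  apply/negP => /eqP dpx.
  have dp0 : p^`() != 0.
    apply/eqP => /(congr1 (fun q : {poly E} => q`_(size p).-2)).
    rewrite coef_deriv coef0 prednK; last by rewrite -subn1 subn_gt0.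
    apply/eqP; rewrite -mulr_natr mulf_neq0 -?lead_coefE ?lead_coef_eq0 //.
    move/pcharf0P: Hchar => ->; rewrite -lt0n -subn1 subn_gt0 //.
  have /mn : `[< exists q : {poly E},
      [/\ q != 0, forall i, fgen S q`_i, root q x & size q = size p^`()] >].
    apply/asboolP; exists p^`(); split=> // [i|]; last exact/rootP.
    rewrite coef_deriv -mulr_natr; have [S1 SB SM SV] := fgen_subfield S.
    apply: (SM) => //; elim: (i.+1) => [|k IHk]; first exact: (subfield0 (fgen_subfield S)).
    by rewrite -addn1 natrD; apply: (subfieldD (fgen_subfield S)).
  by rewrite -sp leqNgt lt_size_deriv.
have e : p^`().[x] * delta x = - \sum_(i < size p) delta p`_i * x ^+ i.
  apply/eqP; rewrite -addr_eq0; apply/eqP.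
  transitivity (delta p.[x]); last by rewrite (rootP px) der0.
  rewrite [in RHS]horner_coef der_sum -(big_mkord xpredT (fun i => delta (p`_i * x ^+ i))).
  rewrite (eq_bigr (fun i => delta p`_i * x ^+ i + p`_i * (x ^+ i.-1 * delta x) *+ i)); last first.
    by move=> i _; rewrite derM derXn mulrnAr.
  rewrite big_split [RHS]addrC /=; congr (_ + _); last by rewrite big_mkord.
  rewrite (horner_coef_wide (n := (size p).-1)) ?size_deriv //; last first.
    by rewrite -ltnS prednK ?lt_size_deriv // ltnW.
  rewrite -(prednK (ltnW sp1)) big_nat_recl // mulr0n add0r /= big_mkord mulr_suml.
  by apply: eq_bigr => i _; rewrite coef_deriv mulrA mulrnAl mulrnAl.
rewrite -[delta x](mulKf dp) e; apply: (AM).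
  apply: (AV); apply: (subfield_horner sA) => // i; rewrite coef_deriv -mulr_natr.
  apply: (AM); first by have [] := dfgen _ (Sp i.+1).
  elim: (i.+1) => [|k IHk]; first exact: (subfield0 sA).
  by rewrite -addn1 natrD; apply: (subfieldD sA).
apply/(subfieldN sA)/(subfield_sum _ sA) => i _; apply: (AM).
  by have [] := dfgen _ (Sp i).
exact: subfieldX.
Qed.

End Derivation.

Section GenericPoint.
Context (E : fieldType) (delta : E -> E) (F : E -> Prop) (n : nat) (xi : 'I_n -> E).
Hypotheses (Hdelta : is_derivation delta) (Hchar : [pchar E] =i pred0).
Hypotheses (sF : is_subfield F) (dF : forall x, F x -> F (delta x)).

Definition jet t := [seq iter j delta (xi j0) | j0 <- enum 'I_n, j <- iota 0 t.+1].
Definition level (B : seq 'I_n) k := [seq iter k delta (xi b) | b <- B].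

Definition range (B : seq 'I_n) t r := [seq iter k delta (xi b) | k <- iota t.+1 r, b <- B].

Lemma rangeP B t r x : x \in range B t r <->
  exists k b, [/\ (t < k <= t + r)%N, b \in B & x = iter k delta (xi b)].
Proof.
split=> [/allpairsP[[k b] [ki bB ->]]|[k [b [ki bB ->]]]].
  by exists k, b; split=> //; move: ki; rewrite mem_iota addSn ltnS.
by apply/allpairsP; exists (k, b); split=> //; rewrite mem_iota addSn ltnS.
Qed.

Lemma jetP t x : x \in jet t <-> exists i k, (k <= t)%N /\ x = iter k delta (xi i).
Proof.
split=> [/allpairsP[[i k] [_ ki ->]]|[i [k [kt ->]]]].
  by exists i, k; move: ki; rewrite mem_iota.
by apply/allpairsP; exists (i, k); rewrite mem_enum mem_iota.
Qed.

Lemma jet_mono t t' : (t <= t')%N -> {subset jet t <= jet t'}.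
Proof.
by move=> tt x /jetP[i [k [kt ->]]]; apply/jetP; exists i, k; split=> //; apply: leq_trans tt.
Qed.

Lemma jet_delta t x : x \in jet t -> delta x \in jet t.+1.
Proof. by move=> /jetP[i [k [kt ->]]]; apply/jetP; exists i, k.+1. Qed.

Lemma jetS t : jet t.+1 =i level (enum 'I_n) t.+1 ++ jet t.
Proof.
move=> x; rewrite mem_cat; apply/idP/orP.
  case/jetP=> i [k []]; rewrite leq_eqVlt => /predU1P[->|kt] ->.
    by left; apply/mapP; exists i; rewrite ?mem_enum.
  by right; apply/jetP; exists i, k.
case=> [/mapP[i _ ->]|]; last exact: jet_mono.
by apply/jetP; exists i, t.+1.
Qed.

(** By [acl_delta], differentiating the dependences at one order yields those at the next, so the
    same indices serve at all later orders. *)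
Lemma level_persistence B t : spans (addl F (jet t)) (level B t.+1) (level (enum 'I_n) t.+1) ->
  forall r, spans (addl F (jet (t + r))) (level B (t + r).+1) (level (enum 'I_n) (t + r).+1).
Proof.
move=> sp; elim=> [|r IHr]; rewrite ?addn0 // addnS => _ /mapP[i _ ->] /=.
apply: (acl_delta Hdelta Hchar (S := addl (addl F (jet (t + r))) (level B (t + r).+1))).
- move=> y [[Fy|yJ]|yB]; apply: acl_ext; left; [by left| by right; exact: jet_mono yJ|].
  by right; case/mapP: yB => b _ ->; apply/jetP; exists b, (t + r).+1.
- move=> y [[Fy|yJ]|yB]; apply: acl_ext; [by left; left; exact: dF|by left; right; exact: jet_delta|].
  by right; case/mapP: yB => b bB ->; apply/mapP; exists b.
- by apply: IHr; apply/mapP; exists i; rewrite ?mem_enum.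
Qed.

Lemma level_basis t : exists B : seq 'I_n, ind (addl F (jet t)) (level B t.+1) /\
  spans (addl F (jet t)) (level B t.+1) (level (enum 'I_n) t.+1).
Proof.
have [b] := basis_mask (addl F (jet t)) (level (enum 'I_n) t.+1).
by rewrite -map_mask; exists (mask b (enum 'I_n)).
Qed.

Lemma rank_jetS t : rank F (jet t.+1) =
  (rank (addl F (jet t)) (level (enum 'I_n) t.+1) + rank F (jet t))%N.
Proof. by rewrite (rank_eq_mem _ (jetS t)) rank_cat. Qed.

Context (d h T : nat).
Hypothesis Hxi : forall t, (T <= t)%N -> has_trdeg F (jet t) (d * t.+1 + h)%N.

Lemma rank_jet t : (T <= t)%N -> rank F (jet t) = (d * t.+1 + h)%N.
Proof. by move=> Tt; apply: has_trdeg_rank (Hxi Tt). Qed.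

(** A basis of one level spans every later one by [level_persistence], and far enough the increment
    is exactly [d]; hence it is nowhere smaller. *)
Lemma rank_jet_incr t : (rank F (jet t) + d <= rank F (jet t.+1))%N.
Proof.
have [B [iB spB]] := level_basis t.
have szB : (d <= size B)%N.
  have := rank_le_size (level_persistence spB (r := T)); rewrite size_map.
  have := rank_jetS (t + T); rewrite !rank_jet ?leq_addl //; try lia.
rewrite rank_jetS addnC leq_add2r; apply: leq_trans szB _.
rewrite -(size_map (fun b => iter t.+1 delta (xi b))); apply: rank_ge iB _.
by apply: spans_refl => x /mapP[b _ ->]; apply/mapP; exists b; rewrite ?mem_enum.
Qed.

(** Going down from the known value at [T], the rank drops by at least [d] at each order. The bound
    is needed at order [s + h], which may lie below [T]. *)
Lemma rank_jet_le t : (rank F (jet t) <= d * t.+1 + h)%N.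
Proof.
have [Tt|tT] := leqP T t; first by rewrite rank_jet.
rewrite -(leq_add2r (d * (T - t))).
apply: leq_trans (_ : rank F (jet (t + (T - t))) <= _)%N; last first.
  by rewrite subnKC ?(ltnW tT) // rank_jet // -subSS; nia.
elim: (T - t)%N => [|k IHk]; first by rewrite muln0 !addn0.
rewrite mulnS addnCA addnS; apply: leq_trans (rank_jet_incr _).
by rewrite addnC leq_add2r.
Qed.

(** [B] is a parametric set: a basis of the level just above [T], of size [d] by the rank formula.
    With [X] it spans every later jet, and the list has exactly as many elements as the rank of that
    jet, so it is independent. *)
Lemma jet_basis : exists (B : seq 'I_n) (X : seq E), size B = d /\ [/\ {subset X <= jet T},
  size X = (d * T.+1 + h)%N, ind F X, spans F X (jet T) &
  forall r, ind F (range B T r ++ X)].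
Proof.
have [B [iB spB]] := level_basis T.
have [X [XJ iX spX szX]] := rank_basis F (jet T).
have szB : size B = d.
  rewrite -(size_map (fun b => iter T.+1 delta (xi b))) -/(level B T.+1).
  have -> : size (level B T.+1) = rank (addl F (jet T)) (level (enum 'I_n) T.+1).
    apply/eqP; rewrite eqn_leq rank_le_size // andbT; apply: rank_ge => //.
    by apply: spans_refl => x /mapP[b _ ->]; apply/mapP; exists b; rewrite ?mem_enum.
  by have := rank_jetS T; rewrite !rank_jet //; lia.
exists B, X; split=> //; split=> //; first by rewrite szX rank_jet.
move=> r; apply: (@ind_rank_span _ _ (jet (T + r))); last first.
  rewrite size_cat /range size_allpairs size_iota szB szX !rank_jet ?leq_addr //; nia.
elim: r => [|r IHr]; first by rewrite addn0.
have rS : {subset range B T r ++ X <= range B T r.+1 ++ X}.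
  move=> z; rewrite [_ \in _ ++ X]mem_cat [_ \in range B T r.+1 ++ X]mem_cat.
  case/orP=> [/rangeP[k [b [ki bB ->]]]|->]; last by rewrite orbT.
  by apply/orP; left; apply/rangeP; exists k, b; split=> //; lia.
have mono z : acl (addl F (range B T r ++ X)) z -> acl (addl F (range B T r.+1 ++ X)) z.
  by apply: acl_mono => t [Ft|/rS]; [left|right].
rewrite addnS => x; rewrite jetS mem_cat => /orP[xl|/IHr/mono//].
have := level_persistence spB (r := r) xl.
apply: acl_min => y [[Fy|/IHr/mono//]|/mapP[b bB ->]]; apply: acl_ext; first by left.
right; rewrite mem_cat; apply/orP; left.
by apply/rangeP; exists (T + r).+1, b; split=> //; lia.
Qed.

End GenericPoint.

Lemma mp_rmorph_eq (V : choiceType) (R A : comNzRingType) (f g : {rmorphism mp V R -> A}) :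
  (forall c, f (mpc c) = g (mpc c)) -> (forall x, f (mpx x) = g (mpx x)) -> f =1 g.
Proof.
move=> fgc fgx p; elim/mp_ind: p => [p q IHp IHq|c|p x IHp]; last by rewrite !rmorphM IHp fgx.
  by rewrite !rmorphD IHp IHq.
exact: fgc.
Qed.

Lemma mcf_map (W : choiceType) (R R' : comNzRingType) (f : {rmorphism R -> R'}) (P : mp W R) m :
  mcf (mpev (mpc \o f : {rmorphism R -> mp W R'}) mpx P) m = f (mcf P m).
Proof.
elim/mp_ind: P m => [p q IHp IHq|c|p x IHp] m.
- by rewrite rmorphD !mcfD IHp IHq rmorphD.
- by rewrite mpevC /= !mcfC rmorphMn.
- by rewrite rmorphM mpevX !mcfMX IHp; case: ifP; rewrite // rmorph0.
Qed.

(** * Substitution and differential polynomials *)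

Section DualNumbers.
Context (E : fieldType) (V : choiceType) (a D : V -> E).
Local Notation ev := (mpev (idfun : {rmorphism E -> E}) a).
Local Notation evd := (mpev (@polyC E : {rmorphism E -> {poly E}})
  (fun x => (a x)%:P + D x *: 'X)).

(** First-order Taylor expansion on the line through [a] with direction [D]. *)
Lemma mpev_dual (L : seq V) (p : mp V E) : uniq L -> (forall x, occ p x -> x \in L) ->
  (evd p)`_0 = ev p /\ (evd p)`_1 = \sum_(x <- L) D x * ev (pder x p).
Proof.
move=> uL pL; have pK : pover (fun=> True) (fun x => x \in L) p.
  by move=> m pm; split=> // x mx; apply: pL; exists m.
elim/pover_ind: pK => {p pL} [|p q [p0 p1] [q0 q1]|c _|p x xL [p0 p1]].
- by rewrite !rmorph0 !coef0 big1 // => x _; rewrite pder0 rmorph0 mulr0.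
- rewrite !rmorphD !coefD p0 p1 q0 q1 -big_split; split=> //; apply: eq_bigr => x _.
  by rewrite pderD rmorphD mulrDr.
- rewrite !mpevC !coefC big1 // => x _.
  by rewrite pderC rmorph0 mulr0.
rewrite !rmorphM !mpevX; split.
  by rewrite coefM big_ord1 coefD coefC coefZ coefX mulr0 addr0 p0.
rewrite coefM big_ord_recl big_ord1 /= !coefD !coefC !coefZ !coefX /= p0 p1 !mulr0 !mulr1.
rewrite !addr0 add0r.
under [RHS]eq_bigr => y _ do rewrite pderMX rmorphD rmorphM mpevX rmorphMn mulrDr mulrA.
rewrite big_split /= -mulr_suml addrC; congr (_ + _).
rewrite (bigD1_seq x) //= eqxx mulr1n big1 ?addr0; first by rewrite mulrC.
by move=> y /negPf yx; rewrite eq_sym yx mulr0n mulr0.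
Qed.

End DualNumbers.

Section Substitution.
Context (E : fieldType) (V W : choiceType) (z : W -> V) (sigma : V -> W + V).
Hypotheses (sigmaz : forall w, sigma (z w) = inl w)
  (sigmaE : forall x, match sigma x with inl w => x = z w | inr y => x = y end).
Context (a : V -> E) (K : E -> Prop) (sK : subring_pred K).
Local Notation ev := (mpev (idfun : {rmorphism E -> E}) a).

Definition sub_mp : {rmorphism mp V E -> mp W E} :=
  mpev (@mpc W E) (fun x => match sigma x with inl w => mpx w | inr y => mpc (a y) end).

Lemma sub_mp_pover (S : V -> Prop) (K' : E -> Prop) p : subring_pred K' ->
  (forall c, K c -> K' c) -> (forall x y, sigma x = inr y -> K' (a y)) ->
  pover K S p -> pover K' (fun w => S (z w)) (sub_mp p).
Proof.
move=> sK' KK aK pK; elim/pover_ind: pK => {p} [|p q Hp Hq|c Kc|p x Sx Hp].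
- by rewrite rmorph0; apply: (pover0 _ sK').
- by rewrite rmorphD; apply: (poverD sK').
- by rewrite mpevC; apply: poverC; apply: KK.
rewrite rmorphM mpevX; apply: (poverM sK') => //.
have := sigmaE x; case sx: (sigma x) => [w|y] xE; last by apply/poverC/(aK x).
by apply: (poverX sK'); rewrite -xE.
Qed.

Hypothesis indep : forall q : mp V E, pover K (fun=> True) q -> ev q = 0 -> q = 0.

(** [Psi] keeps the variables to be evaluated inside the coefficients, so the substitution becomes
    the coefficientwise evaluation [red], which loses nothing by independence; [back] recovers [p]
    from [Psi p]. *)
Lemma sub_mp_inj p : pover K (fun=> True) p -> sub_mp p = 0 -> p = 0.
Proof.
move=> pK p0.
pose Psi : {rmorphism mp V E -> mp W (mp V E)} :=
  mpev (mpc \o mpc : {rmorphism E -> mp W (mp V E)})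
    (fun x => match sigma x with inl w => mpx w | inr y => mpc (mpx y) end).
have sKK := pover_subring (fun _ : V => True) sK.
have PsiK : pover (pover K (fun=> True)) (fun=> True) (Psi p).
  elim/pover_ind: pK {p0} => {p} [|p q Hp Hq|c Kc|p x _ Hp].
  - by rewrite rmorph0; apply: (pover0 _ sKK).
  - by rewrite rmorphD; apply: (poverD sKK).
  - by rewrite mpevC /=; apply/poverC/poverC.
  rewrite rmorphM mpevX; apply: (poverM sKK) => //.
  by case: (sigma x) => [w|y]; [apply: (poverX sKK) | apply/poverC/(poverX sK)].
have Psic c : Psi (mpc c) = mpc (mpc c) by rewrite /Psi mpevC.
have Psix x : Psi (mpx x) = match sigma x with inl w => mpx w | inr y => mpc (mpx y) end.
  by rewrite /Psi mpevX.
pose red : {rmorphism mp W (mp V E) -> mp W E} :=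
  mpev (mpc \o ev : {rmorphism mp V E -> mp W E}) mpx.
have redc q : red (mpc q) = mpc (ev q) by rewrite /red mpevC.
have redE : red \o Psi =1 sub_mp.
  apply: mp_rmorph_eq => [c|x] /=; first by rewrite Psic redc !mpevC.
  by rewrite Psix mpevX; case: (sigma x) => [w|y]; rewrite ?redc ?mpevX.
pose back : {rmorphism mp W (mp V E) -> mp V E} :=
  mpev (idfun : {rmorphism mp V E -> mp V E}) (fun w => mpx (z w)).
have backE : back \o Psi =1 idfun.
  apply: mp_rmorph_eq => [c|x] /=; first by rewrite Psic mpevC.
  by rewrite Psix; have := sigmaE x; case: (sigma x) => [w|y] ->; rewrite ?mpevX // mpevC.
suff Psi0 : Psi p = 0 by rewrite -[p]/(idfun p) -backE /= Psi0 rmorph0.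
apply/mpP => m; rewrite mcf0; apply: indep; first exact: (pover_coef sKK m PsiK).
by rewrite -mcf_map -/red -[red _]/((red \o Psi) p) redE p0 mcf0.
Qed.

Lemma pder_sub_mp w p : pder w (sub_mp p) = sub_mp (pder (z w) p).
Proof.
elim/mp_ind: p => [p q IHp IHq|c|p x IHp].
- by rewrite rmorphD !pderD IHp IHq rmorphD.
- by rewrite mpevC !pderC rmorph0.
rewrite rmorphM pderM pderMX IHp rmorphD rmorphM rmorphMn mpevX; congr (_ + _).
have := sigmaE x; case sx: (sigma x) => [w'|y] xE; last first.
  rewrite pderC mulr0; case: eqP => [xz|_]; last by rewrite mulr0n.
  by move: sx; rewrite xz sigmaz.
rewrite pderX mulr_natr xE; congr (_ *+ nat_of_bool _).
by apply/eqP/eqP => [->//|/(congr1 sigma)]; rewrite !sigmaz => -[].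
Qed.

(** If [w] disappeared, the image of the derivative of [p] in [z w] would be zero, hence by
    injectivity the derivative itself. *)
Lemma occ_sub_mp w p : [pchar E] =i pred0 -> pover K (fun=> True) p ->
  occ p (z w) -> occ (sub_mp p) w.
Proof.
move=> ch pK pz; apply: contrapT => np; have := pder_neq0 ch pz.
rewrite (sub_mp_inj (pover_pder sK pK)) ?eqxx //.
by rewrite -pder_sub_mp pder_eq0.
Qed.

End Substitution.

HB.lock Definition mp_cder (E : fieldType) (X : choiceType) (delta : E -> E)
    (p : mp (X * nat)%type E) : mp (X * nat)%type E :=
  \sum_(m <- mpsupp p) mpc (delta (mcf p m)) * mpm m.

Section DerivationOfPolynomials.
Context (E : fieldType) (delta : E -> E) (Hdelta : is_derivation delta).
Context (X : choiceType).
Local Notation mpX := (mp (X * nat)%type E).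
Local Notation mp_cder := (mp_cder delta).
Implicit Types (p q : mpX) (x y v : X * nat).

Definition succ x : X * nat := (x.1, x.2.+1).
Definition mp_der p : mpX := to_mp (dderiv delta (of_mp p)).

Lemma to_mpZ c (q : dpoly E X) : to_mp (c *: q) = mpc c * to_mp q.
Proof.
rewrite mpcE; have <- : to_mp (c%:MP * q) = to_mp c%:MP * to_mp q by exact: rmorphM.
by rewrite mul_malgC.
Qed.

Lemma to_mpU c (m : {cmonom (X * nat)%type}) : to_mp << c *g m >> = mpc c * mpm m :> mpX.
Proof.
by apply/mpP => k; rewrite mcfm /mcf to_mpK mcoeffU.
Qed.

Lemma mcf_cder p m : mcf (mp_cder p) m = delta (mcf p m).
Proof.
rewrite mp_cder.unlock mcf_sum; have [pm|pm] := boolP (m \in mpsupp p); last first.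
  rewrite (mcf_out pm) (der0 Hdelta) big1_seq // => k /= kp; rewrite mcfm.
  by case: eqP => // km; rewrite km (negPf pm) in kp.
rewrite (big_fsetD1 _ pm) /= big1_seq ?addr0 => [|k]; first by rewrite mcfm eqxx.
by rewrite in_fsetD1 mcfm => /andP[_ /andP[/negPf -> _]].
Qed.

Lemma mp_cderD p q : mp_cder (p + q) = mp_cder p + mp_cder q.
Proof. by apply/mpP => m; rewrite mcfD !mcf_cder mcfD derD. Qed.

Lemma mp_cder0 : mp_cder 0 = 0 :> mpX.
Proof. by apply/mpP => m; rewrite mcf_cder !mcf0 der0. Qed.

Lemma mp_cderC c : mp_cder (mpc c : mpX) = mpc (delta c).
Proof.
apply/mpP => m; rewrite mcf_cder !mcfC; case: eqP; rewrite ?mulr1n ?mulr0n //.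
by rewrite der0.
Qed.

Lemma mp_cderMX p x : mp_cder (p * mpx x) = mp_cder p * mpx x.
Proof.
by apply/mpP => m; rewrite mcf_cder !mcfMX mcf_cder; case: ifP; rewrite // der0.
Qed.

Lemma occ_cder p x : occ (mp_cder p) x -> occ p x.
Proof.
case=> m; rewrite -mcf_neq0 mcf_cder => nz mx; exists m => //; rewrite -mcf_neq0.
by apply: contraNneq nz => ->; rewrite der0.
Qed.

(** The list is left free so that the chain rules of several polynomials can be summed over a common
    one. *)
Lemma mp_derE (L : seq (X * nat)) p : uniq L -> (forall x, occ p x -> x \in L) ->
  mp_der p = mp_cder p + \sum_(x <- L) pder x p * mpx (succ x).
Proof.
move=> uL pL; pose G x (m : {cmonom (X * nat)%type}) :=
  if (0 < m x)%N then mpc ((m x)%:R * mcf p m) * mpm (divcm m (ucm x)) else 0 : mpX.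
have -> : \sum_(x <- L) pder x p * mpx (succ x) =
    \sum_(m <- mpsupp p) \sum_(x <- L) G x m * mpx (succ x).
  rewrite exchange_big; apply: eq_bigr => x _.
  rewrite -mulr_suml; congr (_ * _); rewrite pder.unlock [LHS]big_mkcond.
  by apply: eq_bigr => m _; rewrite /G.
rewrite mp_cder.unlock -big_split /mp_der /dderiv rmorph_sum /= big_seq [RHS]big_seq.
apply: eq_bigr => m pm; rewrite rmorphD to_mpU to_mpZ; congr (_ + _).
rewrite /dmon rmorph_sum mulr_sumr [RHS](bigID (fun x => x \in finsupp m)) /= [X in _ = _ + X]big1 ?addr0; last first.
  by move=> x; rewrite -cmE_eq0 /G => /eqP ->; rewrite mul0r.
rewrite -[RHS]big_filter [RHS](perm_big (enum_fset (finsupp m))) /=; last first.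
  apply: uniq_perm; rewrite ?filter_uniq // => x; rewrite mem_filter andb_idr //.
  by move=> xm; apply: pL; exists m; rewrite // lt0n cmE_neq0.
rewrite big_seq [RHS]big_seq; apply: eq_bigr => x xm.
have mx : (0 < m x)%N by rewrite lt0n cmE_neq0.
rewrite to_mpZ /G mx -mulrA -mpmM -[in RHS](mulrC (mcf p m)) (rmorphM (@mpc _ E)) -mulrA.
by [].
Qed.

Definition occ_list p : seq (X * nat) :=
  undup (flatten [seq enum_fset (finsupp m) | m : {cmonom (X * nat)%type} <- mpsupp p]).

Lemma occ_listP p x : occ p x -> x \in occ_list p.
Proof.
case=> m pm mx; rewrite mem_undup; apply/flattenP; exists (enum_fset (finsupp m)).
  by apply/mapP; exists m.
by rewrite -cmE_neq0 -lt0n.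
Qed.

Lemma mp_der_ev (b : X * nat -> E) p : (forall x, b (succ x) = delta (b x)) ->
  mpev (idfun : {rmorphism E -> E}) b (mp_der p) = delta (mpev (idfun : {rmorphism E -> E}) b p).
Proof.
move=> bS; set ev := mpev _ _.
suff main (L : seq (X * nat)) : uniq L -> (forall x, occ p x -> x \in L) ->
    ev (mp_cder p) + \sum_(x <- L) ev (pder x p) * b (succ x) = delta (ev p).
  rewrite (mp_derE (undup_uniq _) (@occ_listP p)) rmorphD.
  rewrite -(main _ (undup_uniq _) (@occ_listP p)) (rmorph_sum ev).
  by congr (_ + _); apply: eq_bigr => x _; rewrite rmorphM mpevX.
move=> uL pL; have pK : pover (fun=> True) (fun x => x \in L) p.
  by move=> m pm; split=> // x mx; apply: pL; exists m.
elim/pover_ind: pK => {pL} [|q r IHq IHr|c _|q x xL IHq].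
- rewrite mp_cder0 !rmorph0 der0 // add0r big1 // => x _.
  by rewrite pder0 rmorph0 mul0r.
- rewrite mp_cderD !rmorphD derD // -IHq -IHr [RHS]addrACA -big_split; congr (_ + _).
  by apply: eq_bigr => x _; rewrite pderD rmorphD mulrDl.
- rewrite mp_cderC !mpevC big1 ?addr0 // => x _.
  by rewrite pderC rmorph0 mul0r.
rewrite mp_cderMX !rmorphM derM // !mpevX -IHq mulrDl -addrA; congr (_ + _).
rewrite -bS mulr_suml.
under eq_bigr => y _ do rewrite pderMX rmorphD rmorphM rmorphMn !mpevX mulrDl.
rewrite big_split /=; congr (_ + _).
  by apply: eq_bigr => y _; rewrite mulrAC.
rewrite (bigD1_seq x) //= eqxx mulr1n big1 ?addr0 // => y /negPf yx.
by rewrite eq_sym yx mulr0n mul0r.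
Qed.

Lemma occ_mp_der p y : occ (mp_der p) y -> occ p y \/ exists2 x, occ p x & y = succ x.
Proof.
move=> oy; apply: contrapT => ny; case: oy.
rewrite (mp_derE (undup_uniq _) (@occ_listP p)) -/(occ_list p) => m.
pose S y := occ p y \/ exists2 x, occ p x & y = succ x.
have sT : subring_pred (fun _ : E => True) by split.
suff pS : pover (fun=> True) S (mp_cder p + \sum_(x <- occ_list p) pder x p * mpx (succ x)).
  by move=> mm my; apply: ny; have [_ +] := pS m mm; apply.
apply: (poverD sT).
  by apply/(pover_occ _ _ sT); split=> // x /occ_cder px; left.
apply: (pover_sum sT) => x _; have [px|npx] := pselect (occ p x); last first.
  by rewrite pder_eq0 // mul0r; apply: (pover0 _ sT).
apply: (poverM sT); last by apply: (poverX sT); right; exists x.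
by apply/(pover_occ _ _ sT); split=> // z /pder_occ pz; left.
Qed.

(** Only the term of [v] in the chain rule contains [succ v], and it does so linearly. This is why
    derivatives of [g] have its separant as initial. *)
Lemma pder_mp_der p v : ~ occ p (succ v) -> pder (succ v) (mp_der p) = pder v p.
Proof.
move=> nv; rewrite (mp_derE (undup_uniq _) (@occ_listP p)) -/(occ_list p) pderD.
rewrite pder_eq0 ?add0r; last by move/occ_cder.
rewrite (big_morph (pder (succ v)) (pderD _) (pder0 _ _)).
have pdx x : pder (succ v) (pder x p * mpx (succ x)) = pder x p *+ (x == v).
  rewrite pderMX pder_eq0 ?mul0r ?add0r; last by move/pder_occ.
  by congr (_ *+ nat_of_bool _); case: x v {nv} => [x k] [y l]; rewrite /succ !xpair_eqE eqSS.
under eq_bigr => x _ do rewrite pdx.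
have [pv|npv] := pselect (occ p v).
  rewrite (bigD1_seq v) ?undup_uniq ?occ_listP //= eqxx mulr1n big1 ?addr0 //.
  by move=> x /negPf ->; rewrite mulr0n.
rewrite [RHS]pder_eq0 // big1 // => x _; case: eqP => [->|_]; last by rewrite mulr0n.
by rewrite pder_eq0 // mul0rn.
Qed.

Lemma to_mp_iter_dderiv i (q : dpoly E X) :
  to_mp (iter i (@dderiv E delta X) q) = iter i mp_der (to_mp q).
Proof.
elim: i => [|i IHi]; first exact: erefl.
by rewrite [in RHS]iterS -IHi /mp_der to_mpK.
Qed.

End DerivationOfPolynomials.

Lemma dsubfield_subfield (E : fieldType) (delta : E -> E) K :
  is_dsubfield delta K -> is_subfield K.
Proof. by case=> [K0 [K1 [KB [KM [KV Kd]]]]]; split. Qed.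

Lemma dgen_dsubfield (E : fieldType) (delta : E -> E) F S :
  is_dsubfield delta (dgen delta F S).
Proof.
split; first by move=> L [].
split; first by move=> L [_ []].
split; first by move=> x y Hx Hy L sL FL SL; have [_ [_ [LB _]]] := sL; apply: LB; [exact: Hx | exact: Hy].
split; first by move=> x y Hx Hy L sL FL SL; have [_ [_ [_ [LM _]]]] := sL; apply: LM; [exact: Hx | exact: Hy].
split; first by move=> x Hx L sL FL SL; have [_ [_ [_ [_ [LV _]]]]] := sL; apply: LV; exact: Hx.
by move=> x Hx L sL FL SL; have [_ [_ [_ [_ [_ Ld]]]]] := sL; apply: Ld; exact: Hx.
Qed.

Lemma dgen_subfield (E : fieldType) (delta : E -> E) F S : is_subfield (dgen delta F S).
Proof. exact/dsubfield_subfield/dgen_dsubfield. Qed.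

Lemma dgen_base (E : fieldType) (delta : E -> E) (F S : E -> Prop) x : F x -> dgen delta F S x.
Proof. by move=> Fx L _ FL _; apply: FL. Qed.

Lemma dgen_gen (E : fieldType) (delta : E -> E) (F S : E -> Prop) x k :
  S x -> dgen delta F S (iter k delta x).
Proof.
move=> Sx; have [_ [_ [_ [_ [_ Kd]]]]] := dgen_dsubfield delta F S.
by elim: k => [|k IHk] /=; [move=> L _ _; apply | apply: Kd].
Qed.

Lemma iter_derM (E : fieldType) (delta : E -> E) (Hdelta : is_derivation delta) k x y :
  iter k delta (x * y) =
  \sum_(l < k.+1) (iter l delta x * iter (k - l) delta y) *+ 'C(k, l).
Proof.
elim: k => [|k IHk]; first by rewrite big_ord1 bin0.
rewrite iterS IHk (der_sum Hdelta).
have derMn z j : delta (z *+ j) = delta z *+ j.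
  by elim: j => [|j IHj]; rewrite ?mulr0n ?(der0 Hdelta) // !mulrS (derD Hdelta) IHj.
pose t l := iter l delta x * iter (k.+1 - l) delta y.
rewrite (eq_bigr (fun l : 'I_k.+1 => t l *+ 'C(k, l) + t l.+1 *+ 'C(k, l))); last first.
  move=> l _; have lk : (l <= k)%N by rewrite -ltnS.
  by rewrite derMn (derM Hdelta) mulrnDl [LHS]addrC /t (subSn lk) subSS -!iterS.
rewrite big_split /= [in RHS]big_ord_recl /=.
rewrite [X in X + _]big_ord_recl [X in _ + X]big_ord_recr /= -!addrA !bin0; congr (_ + _).
rewrite [in RHS]big_ord_recr /= !binn addrA -big_split /=; congr (_ + _).
by apply: eq_bigr => l _; rewrite /bump /= !add1n binS mulrnDr /t.
Qed.

(** * Values of the generic forms and their relations *)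

Section Generic.
Context (E : fieldType) (delta : E -> E) (F : E -> Prop)
  (Hdelta : is_derivation delta) (Hchar : [pchar E] =i pred0)
  (HF : is_dsubfield delta F)
  (n d : nat) (xi : 'I_n -> E) (s m : 'I_d.+1 -> nat) (u : coef_idx n s m -> E).
Hypothesis Hu : forall L : seq (coef_idx n s m * nat), uniq L ->
  alg_indep (dgen delta F (fun y => exists j, y = xi j)) [seq iter p.2 delta (u p.1) | p <- L].

Local Notation V := (coef_idx n s m * nat)%type.
Local Notation W := ('I_d.+1 * nat)%type.
Local Notation Fx := (dgen delta F (fun y => exists j, y = xi j)).
Local Notation K := (dgen delta F
  (fun y => exists2 v : coef_idx n s m, gmon_deg (tagged v) != 0%N & y = u v)).
Local Notation zeta := (gen_zeta delta xi u).
Local Notation idE := (idfun : {rmorphism E -> E}).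

Lemma gmon_deg0 k l (mu : gmon n k l) : gmon_deg mu = 0%N -> mu = gmon0 n k l.
Proof.
move=> mu0; apply: val_inj; apply/ffunP => x /=; rewrite ffunE; apply: val_inj => /=.
by move/eqP: mu0; rewrite sum_nat_eq0 => /forallP/(_ x)/implyP/(_ isT)/eqP.
Qed.

Lemma gmon_deg_gmon0 k l : gmon_deg (gmon0 n k l) = 0%N.
Proof. by rewrite /gmon_deg big1 // => x _; rewrite ffunE. Qed.

Definition zvar (w : W) : V := (cvar (gmon0 n (s w.1) (m w.1)), w.2).

Definition split_var (x : V) : W + V :=
  if gmon_deg (tagged x.1) == 0%N then inl (tag x.1, x.2) else inr x.

Lemma split_zvar w : split_var (zvar w) = inl w.
Proof. by rewrite /split_var /= gmon_deg_gmon0; case: w. Qed.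

Lemma split_varE x : match split_var x with inl w => x = zvar w | inr y => x = y end.
Proof.
rewrite /split_var; case: eqP => // /gmon_deg0; case: x => [[i mu] k] /= ->.
by [].
Qed.

Definition uval (x : V) : E := iter x.2 delta (u x.1).
Definition zval (w : W) : E := iter w.2 delta (zeta w.1).
(** The generic point of the overview: [u_i0] is given the value [zeta_i] instead of its own value
    under [u]. *)
Definition val_at (x : V) : E := match split_var x with inl w => zval w | inr y => uval y end.
Local Notation ev := (mpev idE val_at).

Lemma sFx : is_subfield Fx. Proof. exact: dgen_subfield. Qed.
Lemma sK : is_subfield K. Proof. exact: dgen_subfield. Qed.
Let rFx := subfield_subring sFx.
Let rK := subfield_subring sK.

Lemma Fx_xi k i : Fx (iter k delta (xi i)).
Proof. by apply: dgen_gen; exists i. Qed.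

Lemma Fx_delta k x : Fx x -> Fx (iter k delta x).
Proof.
move=> Hx; have [_ [_ [_ [_ [_ Kd]]]]] := dgen_dsubfield delta F (fun y => exists j, y = xi j).
by elim: k => [|k IHk] //=; apply: Kd.
Qed.

Lemma Fx_gmon k l (mu : gmon n k l) : Fx (gmon_eval delta xi mu).
Proof.
apply: (subfield_prod _ sFx) => x _; apply: (subfieldX _ sFx); exact: Fx_xi.
Qed.

Lemma u_indep (q : mp V E) : pover Fx (fun=> True) q -> mpev idE uval q = 0 -> q = 0.
Proof.
move=> qK q0; have [L [uL _ qL]] := vars_list q [::].
apply: (ind_no_relation sFx (a := uval) (L := L) _ _ q0).
  by apply/(alg_indepP sFx); apply: Hu.
by move=> k kq; have [Kk _] := qK k kq; split=> // x xk; apply: qL; exists k.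
Qed.

Lemma K_uval y x : split_var x = inr y -> K (uval y).
Proof.
rewrite /split_var; case: eqP => // /eqP ux [<-]; apply: dgen_gen; by exists x.1.
Qed.

Definition subu : {rmorphism mp V E -> mp W E} := sub_mp split_var uval.

Lemma subu_ev p : mpev idE zval (subu p) = ev p.
Proof.
have e : mpev idE zval \o subu =1 ev; last exact: e.
apply: mp_rmorph_eq => [c|x] /=; first by rewrite !mpevC.
rewrite !mpevX /val_at; case: (split_var x) => [w|y]; by rewrite ?mpevX ?mpevC.
Qed.

Lemma subu_inj p : pover Fx (fun=> True) p -> subu p = 0 -> p = 0.
Proof. by move=> pK; apply: (sub_mp_inj split_varE rFx u_indep pK). Qed.

Lemma occ_subu w p : pover Fx (fun=> True) p -> occ p (zvar w) -> occ (subu p) w.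
Proof. by move=> pK; apply: (occ_sub_mp split_zvar split_varE rFx u_indep Hchar pK). Qed.

Lemma subu_pover p : pover F (fun=> True) p -> pover K (fun w => occ p (zvar w)) (subu p).
Proof.
move=> pF; have rF := subfield_subring (dsubfield_subfield HF).
apply: (sub_mp_pover split_varE (K := F)) => //.
- by move=> c; apply: dgen_base.
- by move=> x y; apply: K_uval.
by apply/(pover_occ _ _ rF); split=> // k; apply: (pover_coef rF k pF).
Qed.

(** The Leibniz expansion of [zeta_i^(k)], a linear form in the derivatives of the coefficients.
    Leaving [A] and [U] free lets it serve for actual values, indeterminates and points of a
    line. *)
Definition zform (A : comNzRingType) (f : E -> A) (U : V -> A) (w : W) : A :=
  - \sum_(mu : gmon n (s w.1) (m w.1) | gmon_deg mu != 0%N) \sum_(l < w.2.+1)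
      (U (cvar mu, l : nat) * f (iter (w.2 - l) delta (gmon_eval delta xi mu))) *+ 'C(w.2, l).

Lemma iter_derN k x : iter k delta (- x) = - iter k delta x.
Proof. by elim: k => //= k ->; rewrite (derN Hdelta). Qed.

Lemma iter_der_sum k (I : Type) (r : seq I) (P : pred I) (G : I -> E) :
  iter k delta (\sum_(i <- r | P i) G i) = \sum_(i <- r | P i) iter k delta (G i).
Proof. by elim: k => //= k ->; rewrite (der_sum Hdelta). Qed.

Lemma zvalE w : zval w = zform id uval w.
Proof.
rewrite /zval /gen_zeta iter_derN iter_der_sum; congr (- _); apply: eq_bigr => mu _.
by rewrite (iter_derM Hdelta).
Qed.

(** The point whose coordinates [z_i^(k)] are forced by the coefficients [U]; for [U = uval] it is
    [val_at]. *)
Definition theta (A : comNzRingType) (f : E -> A) (U : V -> A) (x : V) : A :=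
  match split_var x with inl w => zform f U w | inr y => U y end.

Lemma zform_morph (A B : comNzRingType) (f : E -> A) (g : {rmorphism A -> B}) U w :
  g (zform f U w) = zform (g \o f) (g \o U) w.
Proof.
rewrite rmorphN rmorph_sum; congr (- _); apply: eq_bigr => mu _.
by rewrite rmorph_sum; apply: eq_bigr => l _; rewrite rmorphMn rmorphM.
Qed.

(* The coefficients being independent over [F<xi>], a relation at the generic point holds
   identically in them. *)
Lemma generic_relation (p : mp V E) (A : comNzRingType) (f : {rmorphism E -> A}) (U : V -> A) :
  pover Fx (fun=> True) p -> ev p = 0 -> mpev f (theta f U) p = 0.
Proof.
move=> pK p0.
pose T : {rmorphism mp V E -> mp V E} := mpev (@mpc V E) (theta (@mpc V E) mpx).
have sP := pover_subring (fun _ : V => True) rFx.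
have TK : pover Fx (fun=> True) (T p).
  elim/pover_ind: pK {p0} => {p} [|p q Hp Hq|c Kc|p x _ Hp].
  - by rewrite rmorph0; apply: (pover0 _ rFx).
  - by rewrite rmorphD; apply: (poverD rFx).
  - by rewrite mpevC; apply: poverC.
  rewrite rmorphM mpevX; apply: (poverM rFx) => //; rewrite /theta.
  case: (split_var x) => [w|y]; last exact: (poverX rFx).
  apply: (subring_predN sP); apply: (pover_sum rFx) => mu _; apply: (pover_sum rFx) => l _.
  apply: (subring_predMn sP); apply: (poverM rFx); first exact: (poverX rFx).
  by apply: poverC; exact: (Fx_delta _ (Fx_gmon _)).
have T0 : T p = 0.
  apply: u_indep => //.
  have e : mpev idE uval \o T =1 ev; last by have /= -> := e p.
  apply: mp_rmorph_eq => [c|x] /=; first by rewrite !mpevC.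
  rewrite !mpevX /theta /val_at; case: (split_var x) => [w|y]; last by rewrite mpevX.
  rewrite zform_morph zvalE /zform; congr (- _); apply: eq_bigr => mu _; apply: eq_bigr => l _ /=.
  by rewrite mpevX mpevC.
have e : mpev f U \o T =1 mpev f (theta f U); last by rewrite -e /= T0 rmorph0.
apply: mp_rmorph_eq => [c|x] /=; first by rewrite !mpevC.
rewrite !mpevX /theta; case: (split_var x) => [w|y]; last by rewrite mpevX.
rewrite zform_morph /zform; congr (- _); apply: eq_bigr => mu _; apply: eq_bigr => l _ /=.
by rewrite mpevX mpevC.
Qed.

(** Since the forms are linear in their coefficients, a line of coefficients yields a line of
    points. *)
Lemma theta_line (u0 u1 : V -> E) x :
  theta (@polyC E) (fun y => (u0 y)%:P + u1 y *: 'X) x =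
  (theta id u0 x)%:P + theta id u1 x *: 'X.
Proof.
rewrite /theta; case: (split_var x) => // w; rewrite /zform.
rewrite scaleNr scaler_suml polyCN rmorph_sum -opprD -big_split; congr (- _).
apply: eq_bigr => mu _; rewrite scaler_suml rmorph_sum -big_split; apply: eq_bigr => l _ /=.
rewrite polyCMn polyCM mulrDl mulrnDl; congr (_ + _); rewrite -scalerMnl.
by congr (_ *+ _); rewrite -!mul_polyC polyCM mulrAC.
Qed.

(* [u_mu^(M)] enters [zeta_i^(M)] with coefficient [- mu(xi)] and no [zeta_i^(k)] with [k < M]. *)
Lemma pder_coefficient i (mu : gmon n (s i) (m i)) M (p : mp V E) :
  gmon_deg mu != 0%N -> pover Fx (fun=> True) p -> ev p = 0 ->
  (forall k, occ p (zvar (i, k)) -> (k <= M)%N) ->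
  ev (pder (cvar mu, M) p) = gmon_eval delta xi mu * ev (pder (zvar (i, M)) p).
Proof.
move=> mu0 pK p0 zM; pose w0 : V := (cvar mu, M).
(* The coefficients move in the direction of [u_mu^(M)] alone, and [D] is the resulting direction of
   the point. A relation vanishes along that whole line, so its first-order term is zero. *)
pose u1 (y : V) : E := (y == w0)%:R; pose D := theta id u1.
have w0z : w0 != zvar (i, M).
  by apply: contra_neq mu0 => /(congr1 split_var); rewrite split_zvar /split_var /=; case: eqP.
have [L [uL lL pL]] := vars_list p [:: w0; zvar (i, M)].
have w0L : w0 \in L by apply: lL; rewrite mem_head.
have zL : zvar (i, M) \in L by apply: lL; rewrite in_cons mem_head orbT.
have [_] := mpev_dual val_at D uL pL.
have -> : (fun x => (val_at x)%:P + D x *: 'X) =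
    theta (@polyC E) (fun y => (uval y)%:P + u1 y *: 'X).
  apply: funext => x; rewrite theta_line; congr (_%:P + _).
  by rewrite /val_at /theta; case: (split_var x) => // w; rewrite zvalE.
rewrite generic_relation // coef0.
have Dw0 : D w0 = 1.
  by rewrite /D /theta /split_var /= (negPf mu0) /u1 eqxx.
have Dz k : (k <= M)%N -> D (zvar (i, k)) = - gmon_eval delta xi mu *+ (k == M).
  move=> kM; rewrite /D /theta split_zvar /zform mulNrn; congr (- _) => /=.
  rewrite (bigD1 mu) //= [X in _ + X]big1 ?addr0; last first.
    move=> nu /andP[_ numu]; rewrite big1 // => l _; rewrite /u1 xpair_eqE.
    by rewrite eq_Tagged /= (negPf numu) /= mul0r mul0rn.
  have [->|kM'] := eqVneq k M; last first.
    rewrite big1 ?mulr0n // => l _; rewrite /u1 xpair_eqE eqxx /=.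
    by rewrite ltn_eqF ?mul0r ?mul0rn // (leq_trans (ltn_ord l)) // ltn_neqAle kM'.
  rewrite big_ord_recr /= big1 ?add0r => [|l _].
    by rewrite /u1 !eqxx subnn binn mul1r.
  by rewrite /u1 xpair_eqE eqxx /= ltn_eqF ?mul0r ?mul0rn.
have Dj j k : j != i -> D (zvar (j, k)) = 0.
  move=> ji; rewrite /D /theta split_zvar /zform big1 ?oppr0 // => nu _.
  rewrite big1 // => l _; rewrite /u1 xpair_eqE /=.
  rewrite (_ : (cvar nu == cvar mu) = false) ?mul0r ?mul0rn //.
  by apply/eqP => /(congr1 tag) /= /eqP; rewrite (negPf ji).
rewrite (bigD1_seq w0 w0L uL) /= Dw0 mul1r.
rewrite big_mkcond (bigD1_seq (zvar (i, M)) zL uL) /= eq_sym w0z Dz // eqxx mulr1n.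
rewrite big1 ?addr0 => [e|x xz].
  by apply/eqP; rewrite -subr_eq0 -mulNr -e.
case: ifP => // xw; have [px|npx] := pselect (occ p x); last first.
  by rewrite pder_eq0 // rmorph0 mulr0.
suff -> : D x = 0 by rewrite mul0r.
have := split_varE x; case sx: (split_var x) => [[j k]|y] xE; last first.
  by rewrite /D /theta sx /u1 -xE (negPf xw).
rewrite xE; have [ji|] := eqVneq j i; last exact: Dj.
rewrite ji in xE *; rewrite Dz; last by apply: zM; rewrite -xE.
by case: eqP => [kM|_]; rewrite ?mulr0n //; move: xz; rewrite xE kM eqxx.
Qed.
End Generic.

(** * Specialization of generic forms *)

Section FiniteDependence.
Context (E : fieldType).
Implicit Types (S T : E -> Prop) (xs l : seq E).

Definition unionp S T : E -> Prop := fun x => S x \/ T x.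

Lemma dependence_finite S T xs : ~ ind (unionp S T) xs ->
  exists2 l, (forall y, y \in l -> T y) & ~ ind (addl S l) xs.
Proof.
elim: xs => [|x xs IHxs] /=; first by case.
move=> nind; have [ixs|/IHxs[l lT nl]] := pselect (ind (unionp S T) xs); last first.
  by exists l => // -[_].
have /acl_finite[l0 l0S cx] : acl (addl (unionp S T) xs) x.
  by apply: contrapT => nc; apply: nind.
exists [seq y <- l0 | `[< T y >]]; first by move=> y; rewrite mem_filter => /andP[/asboolP].
case=> nx _; apply: nx; apply: acl_mono cx => y yl0.
have [[Sy|Ty]|yxs] := l0S y yl0; [by left; left| |by right].
by left; right; rewrite mem_filter yl0 andbT; apply/asboolP.
Qed.

Lemma ind_fgen S xs : ind (fgen S) xs <-> ind S xs.
Proof.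
split; apply: ind_base => y; first by move/fgen_ext/acl_ext.
exact: fgen_acl.
Qed.

Lemma seq_preimage (I : choiceType) (f : I -> E) (P : I -> Prop) l :
  (forall y, y \in l -> exists2 x, P x & y = f x) ->
  exists L, [/\ uniq L, forall x, x \in L -> P x & {subset l <= map f L}].
Proof.
elim: l => [|y l IHl] H; first by exists [::].
have [|L [uL PL lL]] := IHl; first by move=> z zl; apply: H; rewrite inE zl orbT.
have [x Px yE] := H y (mem_head _ _).
exists (undup (x :: L)); split; first exact: undup_uniq.
  by move=> z; rewrite mem_undup inE => /predU1P[->|/PL].
move=> z; rewrite inE => /predU1P[->|/lL/mapP[t tL ->]].
  by rewrite yE; apply: map_f; rewrite mem_undup mem_head.
by apply: map_f; rewrite mem_undup inE tL orbT.
Qed.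

End FiniteDependence.

Lemma gmon_var (E : fieldType) (delta : E -> E) n k l (xi : 'I_n -> E) (b : 'I_n) (c : 'I_k.+1) :
  (0 < l)%N -> exists mu : gmon n k l,
    gmon_deg mu = 1%N /\ gmon_eval delta xi mu = iter c delta (xi b).
Proof.
case: l => // l _; pose f : {ffun 'I_n * 'I_k.+1 -> 'I_l.+2} := [ffun x => inord (x == (b, c))].
have fE x : f x = (x == (b, c)) :> nat by rewrite ffunE inordK //; case: eqP.
have sf : (\sum_x (f x : nat) = 1)%N.
  rewrite (bigD1 (b, c)) //= fE eqxx big1 // => x /negPf xb.
  by rewrite fE xb.
have fl : (\sum_x (f x : nat) <= l.+1)%N by rewrite sf.
exists (exist _ f fl); split; first exact: sf.
rewrite /gmon_eval (bigD1 (b, c)) //= fE eqxx expr1 big1 ?mulr1 // => x /negPf xb.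
by rewrite fE xb.
Qed.

Section Specialization.
Context (E : fieldType) (delta : E -> E) (F : E -> Prop)
  (Hdelta : is_derivation delta) (Hchar : [pchar E] =i pred0)
  (HF : is_dsubfield delta F)
  (n d : nat) (xi : 'I_n -> E) (s m : 'I_d.+1 -> nat) (Hm : forall i, (0 < m i)%N)
  (u : coef_idx n s m -> E).
Hypothesis Hu : forall L : seq (coef_idx n s m * nat), uniq L ->
  alg_indep (dgen delta F (fun y => exists j, y = xi j)) [seq iter p.2 delta (u p.1) | p <- L].

Local Notation V := (coef_idx n s m * nat)%type.
Local Notation W := ('I_d.+1 * nat)%type.
Local Notation Fx := (dgen delta F (fun y => exists j, y = xi j)).
Local Notation K := (dgen delta F
  (fun y => exists2 v : coef_idx n s m, gmon_deg (tagged v) != 0%N & y = u v)).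
Local Notation zvar := (zvar n s m).
Local Notation split_var := (@split_var n d s m).
Local Notation uval := (uval delta u).
Local Notation zval := (zval delta xi u).
Local Notation ev := (mpev (idfun : {rmorphism E -> E}) (val_at delta xi u)).

Definition Uset (y : E) : Prop := exists2 x : V, gmon_deg (tagged x.1) != 0%N & y = uval x.

Lemma Uset_K y : Uset y -> K y.
Proof. by case=> x ux ->; apply: dgen_gen; exists x.1. Qed.

Lemma acl_FU_delta y : acl (unionp F Uset) y -> acl (unionp F Uset) (delta y).
Proof.
have [_ [_ [_ [_ [_ Fd]]]]] := HF.
apply: (acl_delta Hdelta Hchar) => z; first exact: acl_ext.
case=> [Fz|[[v k] uv ->]]; apply: acl_ext; [by left; apply: Fd|right].
by exists (v, k.+1).
Qed.

Lemma K_acl y : K y -> acl (unionp F Uset) y.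
Proof.
apply; last first.
- by move=> _ [v uv ->]; apply: acl_ext; right; exists (v, 0%N).
- by move=> z Fz; apply: acl_ext; left.
have sA := acl_subfield (unionp F Uset); have [A1 AB AM AV] := sA.
split; first exact: subfield0 sA.
by do 4!split=> //; exact: acl_FU_delta.
Qed.

(** Replaces the differential field [K] by explicit generators, of which a given dependence involves
    finitely many. The reason is that the algebraic closure of these generators is stable under
    [delta]. *)
Lemma ind_K xs : ind K xs <-> ind (unionp F Uset) xs.
Proof.
split; apply: ind_base => y; last exact: K_acl.
by case=> [Fy|/Uset_K Ky]; apply: acl_ext => //; apply: dgen_base.
Qed.

Lemma ind_U S (L : seq V) : (forall y, S y -> Fx y) -> uniq L -> ind S (map uval L).
Proof.
move=> SF uL; apply: (ind_base (S' := Fx)) => [y /SF|]; first exact: acl_ext.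
by apply/(alg_indepP (sFx _ _ _)); apply: Hu.
Qed.

(** The finitely many coefficients involved are independent over [F<xi>], hence over [S] and [xs];
    by symmetry [xs] stays independent once they are adjoined. *)
Lemma ind_transfer S xs : (forall y, S y -> Fx y) -> (forall x, x \in xs -> Fx x) ->
  ind S xs -> ind (unionp S Uset) xs.
Proof.
move=> SF xF ix; apply: contrapT => /dependence_finite[l lU]; apply.
have [L [uL _ lL]] := seq_preimage lU.
have H : ind S (map uval L ++ xs).
  by apply/ind_cat; split=> //; apply: ind_U => // y [/SF|/xF].
have /ind_cat[_] : ind S (xs ++ map uval L) by apply: ind_perm H; rewrite perm_catC.
by apply: ind_base => y [Sy|/lL yL]; apply: acl_ext; [left|right].
Qed.

(** The coefficients of the forms involved in the dependence become variables of the relation, so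
    its own coefficients remain in the field generated by [S]. *)
Lemma relation_of_dependent S (L : seq W) : (forall y, S y -> Fx y) -> uniq L ->
  ~ ind (unionp S Uset) (map zval L) ->
  exists p, [/\ pover (fgen S) (fun x => (exists2 w, w \in L & x = zvar w) \/
      gmon_deg (tagged x.1) != 0%N) p, p != 0 & ev p = 0].
Proof.
move=> SF uL /dependence_finite[l lU nind].
have [Lu [uLu LuP lLu]] := seq_preimage lU.
have zinj : injective zvar by move=> w w' /(congr1 split_var); rewrite !split_zvar => -[].
pose LL := map zvar L ++ Lu.
have uLL : uniq LL.
  rewrite cat_uniq map_inj_uniq // uL uLu andbT /=; apply/hasPn => x /LuP xu.
  apply/mapP => -[w _ xw]; move: xu; rewrite xw.
  have := split_zvar n s m w; rewrite /split_var; case: eqP => // -> //.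
have nLL : ~ ind (fgen S) (map (val_at delta xi u) LL).
  move/ind_fgen; rewrite map_cat -map_comp => iLL; apply: nind.
  have e1 : map (val_at delta xi u \o zvar) L = map zval L.
    by apply: eq_map => w; rewrite /= /val_at split_zvar.
  have e2 : map (val_at delta xi u) Lu = map uval Lu.
    apply/eq_in_map => x /LuP xu; rewrite /val_at /split_var.
    by rewrite (negPf xu).
  move: iLL; rewrite e1 e2 => /ind_cat[_]; apply: ind_base => y [Sy|/lLu yL]; apply: acl_ext.
    by left.
  by right.
have [p [pK p0 ep]] := dependent_relation (fgen_subfield S) uLL nLL.
exists p; split=> //; apply: poverS pK => // x; rewrite mem_cat => /orP[/mapP[w wL ->]|/LuP].
  by left; exists w.
by right.
Qed.

End Specialization.

Section Specialize.
Context (E : fieldType) (delta : E -> E) (F : E -> Prop)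
  (Hdelta : is_derivation delta) (Hchar : [pchar E] =i pred0)
  (HF : is_dsubfield delta F)
  (n d : nat) (xi : 'I_n -> E) (s m : 'I_d.+1 -> nat) (Hm : forall i, (0 < m i)%N)
  (u : coef_idx n s m -> E).
Hypothesis Hu : forall L : seq (coef_idx n s m * nat), uniq L ->
  alg_indep (dgen delta F (fun y => exists j, y = xi j)) [seq iter p.2 delta (u p.1) | p <- L].

Local Notation V := (coef_idx n s m * nat)%type.
Local Notation W := ('I_d.+1 * nat)%type.
Local Notation Fx := (dgen delta F (fun y => exists j, y = xi j)).
Local Notation zvar := (zvar n s m).
Local Notation split_var := (@split_var n d s m).
Local Notation uval := (uval delta u).
Local Notation zval := (zval delta xi u).
Local Notation Uset := (Uset delta u).
Local Notation theta := (theta delta xi (s := s) (m := m)).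
Local Notation ev := (mpev (idfun : {rmorphism E -> E}) (val_at delta xi u)).

Lemma coef_pover_subring K1 (S : W -> Prop) : subring_pred K1 ->
  subring_pred (fun Q : {poly mp W E} => forall k, pover K1 S Q`_k).
Proof.
move=> rK; have [K1_1 _ _] := rK; split=> [k|P Q PK QK k|P Q PK QK k].
- rewrite coef1; apply: (subring_predMn (pover_subring S rK)).
  by have [] := pover_subring S rK.
- by rewrite coefB; have [_ HB _] := pover_subring S rK; apply: HB.
- by rewrite coefM; apply: (pover_sum rK) => l _; apply: (poverM rK).
Qed.

Section Line.
Variable ubar : V -> E.

Let U (y : V) : {poly E} := (ubar y)%:P + (uval y - ubar y) *: 'X.

(** The polynomial variable is the parameter of the line: 0 gives [ubar] and 1 the generic
    coefficients, while the [z] variables are left alone. *)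
Definition line_poly : {rmorphism mp V E -> {poly mp W E}} :=
  mpev (@polyC (mp W E) \o @mpc W E : {rmorphism E -> {poly mp W E}})
    (fun x => match split_var x with inl w => (mpx w)%:P | inr y => map_poly (@mpc W E) (U y) end).

Lemma line_poly1 p : (line_poly p).[1] = subu delta u p.
Proof.
have e : (horner_eval (1 : mp W E) : {rmorphism {poly mp W E} -> mp W E}) \o line_poly =1 subu delta u;
  last exact: e.
apply: mp_rmorph_eq => [c|x] /=; rewrite /horner_eval; first by rewrite !mpevC /= hornerC.
rewrite !mpevX; case: (split_var x) => [w|y]; first by rewrite hornerC.
rewrite -[X in _.[X]](rmorph1 (@mpc W E)) horner_map; congr (mpc _).
by rewrite /U hornerD hornerC hornerZ hornerX mulr1 addrC subrK.
Qed.

Let lift : {rmorphism mp W E -> {poly E}} :=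
  mpev (@polyC E : {rmorphism E -> {poly E}}) (fun w => theta (@polyC E) U (zvar w)).

Lemma line_poly_ev p : pover Fx (fun=> True) p -> ev p = 0 ->
  (map_poly lift (line_poly p)).['X] = 0.
Proof.
move=> pK p0; have <- := generic_relation Hdelta Hu (@polyC E : {rmorphism E -> {poly E}}) U pK p0.
have e : (horner_eval ('X : {poly E}) : {rmorphism {poly {poly E}} -> {poly E}}) \o
  (map_poly lift : {rmorphism {poly mp W E} -> {poly {poly E}}}) \o line_poly =1
  mpev (@polyC E : {rmorphism E -> {poly E}}) (theta (@polyC E) U); last exact: e.
apply: mp_rmorph_eq => [c|x] /=; rewrite /horner_eval.
  by rewrite !mpevC /= map_polyC hornerC /= mpevC.
rewrite !mpevX; have := split_varE x; rewrite /theta.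
case sx: (split_var x) => [w|y] xE; first by rewrite map_polyC hornerC /= mpevX /theta split_zvar.
rewrite -map_poly_comp (eq_map_poly (g := polyC)); first exact: comp_polyXr.
by move=> c; rewrite /= mpevC.
Qed.

Lemma line_poly0 (Q : mp W E) : (lift Q).[0] =
  mpev (idfun : {rmorphism E -> E}) (fun w => theta id ubar (zvar w)) Q.
Proof.
have e : (horner_eval (0 : E) : {rmorphism {poly E} -> E}) \o lift =1
  mpev (idfun : {rmorphism E -> E}) (fun w => theta id ubar (zvar w)); last exact: e.
apply: mp_rmorph_eq => [c|x] /=; rewrite /horner_eval; first by rewrite !mpevC hornerC.
by rewrite !mpevX theta_line hornerD hornerC hornerZ hornerX mulr0 addr0.
Qed.

Lemma line_poly_pover K1 (L : seq W) p : subring_pred K1 ->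
  (forall y, K1 (ubar y)) -> (forall y, Uset y -> K1 y) ->
  pover K1 (fun x => (exists2 w, w \in L & x = zvar w) \/ gmon_deg (tagged x.1) != 0%N) p ->
  forall k, pover K1 (fun w => w \in L) (line_poly p)`_k.
Proof.
move=> rK Kbar KU; have sP := coef_pover_subring (fun w => w \in L) rK.
have [_ _ PM] := sP; have PD := subring_predD sP.
have CP (q : mp W E) : pover K1 (fun w => w \in L) q -> forall k, pover K1 (fun w => w \in L) (q%:P)`_k.
  by move=> qK k; rewrite coefC; case: eqP => // _; apply: (pover0 _ rK).
elim/pover_ind => {p} [k|p q Hp Hq|c Kc|p x xS Hp].
- by rewrite rmorph0 coef0; apply: (pover0 _ rK).
- by rewrite rmorphD; apply: (PD).
- by rewrite mpevC; apply: CP; apply: poverC.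
rewrite rmorphM mpevX; apply: (PM) => //.
case: xS => [[w wL ->]|xu]; first by rewrite split_zvar; apply: CP; apply: (poverX rK).
rewrite /split_var (negPf xu) => k; rewrite coef_map; apply: poverC.
have [_ KB _] := rK; have K0 := subring_pred0 rK.
rewrite /U coefD coefC coefZ coefX; apply: (subring_predD rK); first by case: eqP.
by case: (k == 1%N); rewrite ?mulr0 // mulr1; apply: (KB); [apply: KU; exists x|].
Qed.

(* A relation between the generic values, restricted to the line from [ubar] to the generic
   coefficients and divided by the largest possible power of the parameter, gives a nontrivial
   relation between the values at [ubar]. *)
Lemma ind_specialize S (L : seq W) : (forall y, S y -> Fx y) -> uniq L ->
  (forall y, fgen S (ubar y)) ->
  ind (unionp S Uset) [seq theta id ubar (zvar w) | w <- L] -> ind (unionp S Uset) (map zval L).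
Proof.
move=> SF uL Sbar ibar; apply: contrapT => /(relation_of_dependent SF uL)[p [pK p0 ep]].
have SFx y : fgen S y -> Fx y by apply; [exact: sFx|].
have pFx : pover Fx (fun=> True) p by apply: poverS pK.
(* At parameter 1 it specializes to [subu p], which is nonzero because the coefficients are
   independent. *)
have Q0 : line_poly p != 0.
  apply: contra_neq p0 => Q0; apply: (subu_inj Hu pFx).
  by rewrite -line_poly1 Q0 horner0.
have ex : exists k, (line_poly p)`_k != 0.
  by exists (size (line_poly p)).-1; rewrite -lead_coefE lead_coef_eq0.
case: (ex_minnP ex) => r r0 rmin.
have QE : line_poly p = drop_poly r (line_poly p) * 'X^r.
  rewrite -{1}[line_poly p](poly_take_drop r) (_ : take_poly r _ = 0) ?add0r //.
  apply/polyP => k; rewrite coef_take_poly coef0; case: ltnP => // kr.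
  by apply/eqP; apply: contraTT kr => /rmin; rewrite -leqNgt.
have : (map_poly lift (drop_poly r (line_poly p))).['X] * 'X^r = 0.
  by have := line_poly_ev pFx ep; rewrite {1}QE rmorphM /= map_polyXn hornerM hornerXn.
move/eqP; rewrite mulf_eq0 -[_ ^+ r == 0]size_poly_eq0 size_polyXn orbF => /eqP e0.
(* After division by the power of the parameter, setting the parameter to 0 leaves only the
   coefficient of index [r], evaluated at the values for [ubar]. *)
have {}e0 : (lift (line_poly p)`_r).[0] = 0.
  have := congr1 (fun P => P.[0]) e0; rewrite horner0.
  rewrite -[X in (X.['X]).[0]](poly_take_drop 1) hornerD hornerM /=.
  rewrite hornerD hornerM hornerXn expr1 hornerX mulr0 addr0.
  rewrite (_ : take_poly 1 _ = (lift (line_poly p)`_r)%:P) ?hornerC //.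
  apply/polyP => k; rewrite coef_take_poly coefC coef_map coef_drop_poly.
  by case: k.
rewrite line_poly0 in e0; move/eqP: r0; apply.
have rK := fgen_subfield (unionp S Uset).
apply: (ind_no_relation rK (a := fun w => theta id ubar (zvar w)) (L := L) _ _ e0).
  exact/ind_fgen.
apply: line_poly_pover => [|y|y Uy|]; first exact: subfield_subring.
- by apply: fgen_mono (Sbar y) => z; left.
- by apply: fgen_ext; right.
by apply: poverS pK => // c; apply: fgen_mono => z; left.
Qed.

End Line.
End Specialize.

Section OtherForms.
Context (E : fieldType) (delta : E -> E) (F : E -> Prop)
  (Hdelta : is_derivation delta) (Hchar : [pchar E] =i pred0)
  (HF : is_dsubfield delta F)
  (n d : nat) (xi : 'I_n -> E) (s m : 'I_d.+1 -> nat) (Hm : forall i, (0 < m i)%N)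
  (u : coef_idx n s m -> E).
Hypothesis Hu : forall L : seq (coef_idx n s m * nat), uniq L ->
  alg_indep (dgen delta F (fun y => exists j, y = xi j)) [seq iter p.2 delta (u p.1) | p <- L].

Local Notation V := (coef_idx n s m * nat)%type.
Local Notation W := ('I_d.+1 * nat)%type.
Local Notation Fx := (dgen delta F (fun y => exists j, y = xi j)).
Local Notation zvar := (zvar n s m).
Local Notation zval := (zval delta xi u).
Local Notation Uset := (Uset delta u).
Local Notation theta := (theta delta xi (s := s) (m := m)).

Definition others (i : 'I_d.+1) := [seq j <- enum 'I_d.+1 | j != i].

Lemma others_uniq i : uniq (others i).
Proof. by rewrite filter_uniq ?enum_uniq. Qed.

Lemma mem_others i j : (j \in others i) = (j != i).
Proof. by rewrite mem_filter mem_enum andbT. Qed.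

Lemma size_others i : size (others i) = d.
Proof.
have /perm_size /= : perm_eq (enum 'I_d.+1) (i :: others i).
  apply: uniq_perm; [exact: enum_uniq| |].
    by rewrite cons_uniq others_uniq andbT /others mem_filter eqxx.
  by move=> j; rewrite mem_enum in_cons /others mem_filter mem_enum andbT; case: eqP.
by rewrite size_enum_ord => -[].
Qed.

(** Indexed by the order [k] of the derivatives of [xi] that the value reaches, hence the shift by
    [s j]. *)
Definition other_vars i T r : seq W :=
  [seq (j, (k - s j)%N) | k <- iota T.+1 r, j <- others i].

Lemma other_vars_uniq i T r : (forall j, (s j <= T)%N) -> uniq (other_vars i T r).
Proof.
move=> sT; apply: allpairs_uniq; rewrite ?iota_uniq ?others_uniq //.
move=> [k j] [k' j'] /allpairsP[[k0 j0] /= [kT _ [-> ->]]] /allpairsP[[k1 j1] /= [k'T _ [-> ->]]] /=.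
move=> [jj kk]; rewrite jj in kk *; congr pair; move: kT k'T; rewrite !mem_iota.
by have := sT j1; lia.
Qed.

(** The value -1 compensates the sign in [gen_zeta]. Derivatives of coefficients are set to 0, as
    for constants, and so is the whole [i]-th form. *)
Definition form_point (mu : forall j, gmon n (s j) (m j)) i (y : V) : E :=
  if (y == (cvar (mu (tag y.1)), 0%N)) && (tag y.1 != i) then -1 else 0.

Lemma theta_form_point mu i j k : gmon_deg (mu j) != 0%N -> j != i ->
  theta id (form_point mu i) (zvar (j, k)) = iter k delta (gmon_eval delta xi (mu j)).
Proof.
move=> muj ji; rewrite /theta split_zvar /zform (bigD1 (mu j)) //= [X in _ + X]big1 ?addr0; last first.
  move=> nu /andP[_ nuj]; rewrite big1 // => l _; rewrite /form_point xpair_eqE eq_Tagged /=.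
  by rewrite (negPf nuj) mul0r mul0rn.
rewrite big_ord_recl big1 ?addr0 => [|l _]; last first.
  by rewrite /form_point xpair_eqE andbF mul0r mul0rn.
by rewrite /form_point !eqxx ji /= subn0 bin0 mulN1r opprK.
Qed.

(* Specializing the form of index [j <> i] to [z_j - y_b^(s_j)], for distinct elements [b] of a
   parametric set, the values become the derivatives of the [xi_b] beyond [T]. *)
Lemma ind_other_forms i B X T r : size B = d -> {subset X <= jet delta xi T} ->
  (forall j, (s j <= T)%N) -> ind F (range delta xi B T r ++ X) ->
  ind (unionp (addl F X) Uset) (map zval (other_vars i T r)).
Proof.
move=> szB XJ sT iBX; have XFx x : x \in X -> Fx x.
  by move/XJ/jetP => [j [k [_ ->]]]; apply: Fx_xi.
have SFx y : addl F X y -> Fx y by case=> [|/XFx//]; exact: dgen_base.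
(* An empty parametric set means [d = 0], and then there is no other form. *)
case: B szB iBX => [|b0 B] szB iBX.
  have jE : others i = [::] by apply: size0nil; rewrite size_others -szB.
  by rewrite /other_vars jE; elim: (iota _ _).
pose b j := nth b0 (b0 :: B) (index j (others i)).
have bE : map b (others i) = b0 :: B.
  apply: (@eq_from_nth _ b0) => [|k]; rewrite size_map size_others ?szB // => kd.
  by rewrite (nth_map i) ?size_others // /b index_uniq ?others_uniq ?size_others.
(* [ord_max] selects the derivative of order [s j], so that the value of order [k - s j] becomes a
   derivative of order exactly [k]. *)
pose ex j := cid (gmon_var delta xi (b j) (@ord_max (s j)) (Hm j)).
pose mu j := projT1 (ex j); have muP j := projT2 (ex j).
have muE j : gmon_eval delta xi (mu j) = iter (s j) delta (xi (b j)) by have := proj2 (muP j).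
have mu0 j : gmon_deg (mu j) != 0%N by rewrite (proj1 (muP j)).
have Sbar y : fgen (addl F X) (form_point mu i y).
  have [S1 SB _ _] := fgen_subfield (addl F X); have S0 := subfield0 (fgen_subfield (addl F X)).
  by rewrite /form_point; case: ifP => // _; rewrite -[-1]add0r; apply: (SB).
apply: (ind_specialize Hdelta Hu SFx (other_vars_uniq i r sT) Sbar).
have -> : [seq theta id (form_point mu i) (zvar w) | w <- other_vars i T r] =
    range delta xi (b0 :: B) T r.
  rewrite /other_vars map_allpairs /range -bE.
  rewrite [RHS]allpairs_mapr.
  apply/eq_in_allpairs => k j; rewrite mem_iota => kT; rewrite mem_others => ji.
  rewrite theta_form_point // muE -iterD subnK //; have := sT j; lia.
apply: (ind_transfer Hu SFx); last by have /ind_cat[] := iBX.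
by move=> y /rangeP[k [c [_ _ ->]]]; apply: Fx_xi.
Qed.
End OtherForms.

(** * Orders of relations between generic forms *)

Section Counting.
Context (E : fieldType) (delta : E -> E) (F : E -> Prop)
  (Hdelta : is_derivation delta) (Hchar : [pchar E] =i pred0)
  (HF : is_dsubfield delta F)
  (n d h T : nat) (xi : 'I_n -> E) (s m : 'I_d.+1 -> nat) (Hm : forall i, (0 < m i)%N)
  (u : coef_idx n s m -> E).
Hypothesis Hu : forall L : seq (coef_idx n s m * nat), uniq L ->
  alg_indep (dgen delta F (fun y => exists j, y = xi j)) [seq iter p.2 delta (u p.1) | p <- L].
Hypothesis Hxi : forall t, (T <= t)%N -> has_trdeg F (jet delta xi t) (d * t.+1 + h)%N.
Hypothesis sT : forall j, (s j <= T)%N.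

Local Notation W := ('I_d.+1 * nat)%type.
Local Notation Fx := (dgen delta F (fun y => exists j, y = xi j)).
Local Notation zval := (zval delta xi u).
Local Notation FU := (unionp F (Uset delta u)).
Local Notation jet := (jet delta xi).

Let sF : is_subfield F. Proof. exact: dsubfield_subfield HF. Qed.
Let dF x : F x -> F (delta x). Proof. by have [_ [_ [_ [_ [_ Fd]]]]] := HF; apply: Fd. Qed.

Lemma jet_acl_delta t y : acl (addl FU (jet t)) y -> acl (addl FU (jet t.+1)) (delta y).
Proof.
apply: (acl_delta Hdelta Hchar) => z; first by case=> [Hz|/(jet_mono (leqnSn t)) zJ];
  apply: acl_ext; [left|right].
case=> [Hz|/jet_delta zJ]; last by apply: acl_ext; right.
by apply: acl_mono (acl_FU_delta Hdelta Hchar HF (acl_ext Hz)) => x; left.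
Qed.

Lemma zval_jet j k t : (k + s j <= t)%N -> acl (addl FU (jet t)) (zval (j, k)).
Proof.
move=> kt; apply: (acl_mono (S := addl FU (jet (k + s j)))).
  by move=> x [Hx|/(jet_mono kt) xJ]; [left|right].
rewrite {t kt} /zval /=; elim: k => [|k IHk]; last exact: jet_acl_delta.
rewrite add0n /= /gen_zeta; have sA := acl_subfield (addl FU (jet (s j))); have [_ _ AM _] := sA.
apply: (subfieldN sA). apply: (subfield_sum _ sA) => mu mu0; apply: (AM).
  by apply: acl_ext; left; right; exists (cvar mu, 0%N).
apply: (subfield_prod _ sA) => x _; apply: (subfieldX _ sA); apply: acl_ext; right.
by apply/jetP; exists x.1, x.2; split=> //; rewrite -ltnS.
Qed.

(** Orders the values by the order [k + s_j] of the derivatives of [xi] in them, ties being broken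
    by the index of the form. Differentiation adds the constant [d.+1] to every key and so respects
    comparisons. *)
Definition form_key (w : W) : nat := ((w.2 + s w.1) * d.+1 + w.1)%N.

Lemma form_key_inj : injective form_key.
Proof.
move=> [j k] [j' k'] /= e; have ej : j = j'.
  apply: ord_inj; have := congr1 (fun x => x %% d.+1)%N e.
  by rewrite /form_key /= !modnMDl !modn_small.
rewrite -ej in e *; congr pair; move/eqP: e.
by rewrite /form_key /= eqn_add2r eqn_pmul2r // eqn_add2r => /eqP.
Qed.

Lemma form_key_le w z : (form_key w < form_key z)%N -> (w.2 + s w.1 <= z.2 + s z.1)%N.
Proof.
rewrite /form_key; move: (w.2 + s w.1)%N (z.2 + s z.1)%N => a b lt; rewrite leqNgt; apply/negP => ba.
have /leq_trans/(_ (leq_addr w.1 _)) : (b * d.+1 + z.1 < a * d.+1)%N.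
  by apply: (leq_trans (n := b.+1 * d.+1)); rewrite ?leq_pmul2r // mulSn addnC ltn_add2r.
by rewrite ltnNge ltnW.
Qed.

Definition below i y : E -> Prop :=
  fun x => FU x \/ exists w, [/\ w.1 != i, (form_key w < form_key y)%N & x = zval w].

Lemma below_succ i y x : acl (below i y) x -> acl (below i (succ y)) (delta x).
Proof.
have key_succ w : form_key (succ w) = (form_key w + d.+1)%N.
  by rewrite /form_key /= addSn mulSn; lia.
apply: (acl_delta Hdelta Hchar) => z.
  case=> [Hz|[w [wi wy ->]]]; apply: acl_ext; [by left|right; exists w; split=> //].
  by rewrite key_succ (leq_trans wy) ?leq_addr.
case=> [Hz|[w [wi wy ->]]]; first by apply: acl_mono (acl_FU_delta Hdelta Hchar HF (acl_ext Hz)) => t; left.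
by apply: acl_ext; right; exists (succ w); rewrite !key_succ ltn_add2r.
Qed.

(* A dependence of a value on values of smaller key persists under differentiation, hence reaches
   the orders at which the values are independent over [jet T]. *)
Lemma not_below i y : y.1 != i -> ~ acl (below i y) (zval y).
Proof.
move=> yi ay; have [B [X [szB [XJ szX iX spX iBX]]]] := jet_basis Hdelta Hchar sF dF Hxi.
have {ay} [z [zi zT az]] : exists z, [/\ z.1 != i, (T < z.2 + s z.1)%N & acl (below i z) (zval z)].
  exists (y.1, (T.+1 + y.2)%N); split=> //=; first by rewrite -addnA ltn_addr.
  elim: T.+1 => [|e IHe]; first by case: y ay {yi}.
  by rewrite addSn; apply: (below_succ IHe).
pose r := (z.2 + s z.1 - T)%N; pose L := [seq w <- other_vars s i T r | (form_key w < form_key z)%N].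
have := ind_other_forms Hdelta Hm Hu i szB XJ sT (iBX r).
have uO : uniq (other_vars s i T r) by exact: other_vars_uniq.
have mO w : w.1 != i -> (T < w.2 + s w.1 <= z.2 + s z.1)%N -> w \in other_vars s i T r.
  move=> wi wT; apply/allpairsP; exists ((w.2 + s w.1)%N, w.1) => /=.
  rewrite mem_iota mem_others wi; split=> //; last by rewrite addnK; case: (w).
  case/andP: wT => w1 w2; by rewrite w1 addSn ltnS subnKC // ltnW.
have zO : z \in other_vars s i T r by apply: (mO); rewrite // zT leqnn.
have zL : z \notin L by rewrite mem_filter ltnn.
have /(perm_map zval) pO : perm_eq (other_vars s i T r)
    ([seq w <- other_vars s i T r | w \notin z :: L] ++ z :: L).
  apply: uniq_perm => //.
    rewrite cat_uniq filter_uniq // cons_uniq zL filter_uniq // !andbT.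
    by apply/hasPn => w wL; rewrite mem_filter wL.
  move=> w; rewrite mem_cat mem_filter; case: (boolP (w \in z :: L)) => //=; last by rewrite orbF.
  by rewrite in_cons => /predU1P[->//|]; rewrite mem_filter => /andP[].
move=> /(ind_perm pO); rewrite map_cat => /ind_cat[/= [naz _] _] {pO}; apply: naz.
apply: acl_min az => x [[Fx|Ux]|[w [wi wz ->]]].
- by apply: acl_ext; left; left; left.
- by apply: acl_ext; left; right.
(* Smaller values reaching beyond [T] belong to the independent list; the others are algebraic over
   the coefficients and [X], which are already in the base. *)
have [wT|wT] := leqP (w.2 + s w.1) T; last first.
  apply: acl_ext; right; apply: map_f; rewrite mem_filter wz mO // wT /=.
  exact: form_key_le.
have := zval_jet wT; rewrite -surjective_pairing; apply: acl_min => v [[Fv|Uv]|/spX].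
- by apply: acl_ext; left; left; left.
- by apply: acl_ext; left; right.
by apply: acl_mono => t [Ft|tX]; left; left; [left|right].
Qed.

(** Sorted by decreasing key, no value is algebraic over those after it, by [not_below]. *)
Lemma ind_others i (L : seq W) : uniq L -> (forall w, w \in L -> w.1 != i) -> ind FU (map zval L).
Proof.
move=> uL Li; pose le w w' := (form_key w' <= form_key w)%N.
have tle : total le by move=> w w'; rewrite /le leq_total.
apply: (ind_perm (xs := map zval (sort le L))); first by apply: perm_map; rewrite perm_sort.
have : sorted le (sort le L) by exact: sort_sorted.
have : uniq (sort le L) by rewrite sort_uniq.
have : forall w, w \in sort le L -> w.1 != i by move=> w; rewrite mem_sort => /Li.
elim: (sort le L) => //= w l IHl wi /andP[wl ul] pl.
have tr : transitive le by move=> a b c; rewrite /le => ab ca; exact: leq_trans ca ab.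
split; last by apply: IHl => // [v vl|]; [apply: wi; rewrite inE vl orbT | exact: path_sorted pl].
move=> aw; apply: (@not_below i w); first by apply: wi; rewrite mem_head.
apply: acl_mono aw => x [Hx|/mapP[v vl ->]]; [by left|right; exists v; split=> //].
  by apply: wi; rewrite inE vl orbT.
rewrite ltn_neqAle; have := order_path_min tr pl => /allP/(_ v vl); rewrite /le => ->.
rewrite andbT; apply: contraNneq wl => /form_key_inj <-; exact: vl.
Qed.

End Counting.

Lemma size_allpairs_dep (S T R : Type) (f : S -> T -> R) (xs : seq S) (ys : S -> seq T) :
  size [seq f x y | x <- xs, y <- ys x] = (\sum_(x <- xs) size (ys x))%N.
Proof. by rewrite size_flatten /shape -map_comp sumnE big_map; apply: eq_bigr => x _ /=; rewrite size_map. Qed.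

Lemma sum_subn (I : Type) (r : seq I) (f : I -> nat) t : (forall i, f i <= t)%N ->
  (\sum_(i <- r) (t - f i) = size r * t - \sum_(i <- r) f i)%N.
Proof.
move=> ft; suff H : (\sum_(i <- r) (t - f i) + \sum_(i <- r) f i = size r * t)%N by rewrite -H addnK.
rewrite -big_split /= (eq_bigr (fun=> t)) => [|i _]; last by rewrite subnK.
by rewrite big_const_seq count_predT iter_addn_0 mulnC.
Qed.

Lemma occ_bound (X : choiceType) (R : comNzRingType) (p : mp (X * nat)%type R) :
  exists N, forall x, occ p x -> (x.2 <= N)%N.
Proof.
have [L [_ _ pL]] := vars_list p [::]; exists (\max_(x <- L) x.2)%N => x /pL xL.
exact: leq_bigmax_seq.
Qed.

Lemma occ_max (X : choiceType) (R : comNzRingType) (p : mp (X * nat)%type R) v k :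
  occ p (v, k) -> exists M, occ p (v, M) /\ forall l, occ p (v, l) -> (l <= M)%N.
Proof.
move=> pk; have [N pN] := occ_bound p.
have ex : exists k, `[< occ p (v, k) >] by exists k; apply/asboolP.
have bd l : `[< occ p (v, l) >] -> (l <= N)%N by move/asboolP/pN.
case: (ex_maxnP ex bd) => M /asboolP pM max; exists M; split=> // l pl.
by apply: max; apply/asboolP.
Qed.

Section Relations.
Context (E : fieldType) (delta : E -> E) (F : E -> Prop)
  (Hdelta : is_derivation delta) (Hchar : [pchar E] =i pred0)
  (HF : is_dsubfield delta F)
  (n d h T : nat) (xi : 'I_n -> E) (s m : 'I_d.+1 -> nat) (Hm : forall i, (0 < m i)%N)
  (u : coef_idx n s m -> E).
Hypothesis Hu : forall L : seq (coef_idx n s m * nat), uniq L ->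
  alg_indep (dgen delta F (fun y => exists j, y = xi j)) [seq iter p.2 delta (u p.1) | p <- L].
Hypothesis Hxi : forall t, (T <= t)%N -> has_trdeg F (jet delta xi t) (d * t.+1 + h)%N.
Hypothesis sT : forall j, (s j <= T)%N.

Local Notation V := (coef_idx n s m * nat)%type.
Local Notation W := ('I_d.+1 * nat)%type.
Local Notation Fx := (dgen delta F (fun y => exists j, y = xi j)).
Local Notation zvar := (zvar n s m).
Local Notation split_var := (@split_var n d s m).
Local Notation uval := (uval delta u).
Local Notation zval := (zval delta xi u).
Local Notation val_at := (val_at delta xi u).
Local Notation ev := (mpev (idfun : {rmorphism E -> E}) val_at).
Local Notation FU := (unionp F (Uset delta u)).
Local Notation jet := (jet delta xi).
Local Notation S := (\sum_(l < d.+1) s l)%N.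

Let sF : is_subfield F. Proof. exact: dsubfield_subfield HF. Qed.
Let rF := subfield_subring sF.
Let dF x : F x -> F (delta x). Proof. by have [_ [_ [_ [_ [_ Fd]]]]] := HF; apply: Fd. Qed.
Let Fx_F y : F y -> Fx y. Proof. exact: dgen_base. Qed.

Definition low_vars (r : seq 'I_d.+1) t : seq W :=
  [seq (j, k) | j <- r, k <- iota 0 (t.+1 - s j)].

Lemma low_varsP r t w : (s w.1 <= t)%N ->
  (w \in low_vars r t) = (w.1 \in r) && (w.2 + s w.1 <= t)%N.
Proof.
move=> st; apply/allpairsPdep/andP => [[j [k [jr]]]|[wr wt]].
  by rewrite mem_iota add0n => kt -> /=; split=> //; rewrite -ltnS addnC -ltn_subRL.
exists w.1, w.2; split; [exact: wr| |exact: surjective_pairing].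
by rewrite mem_iota add0n ltn_subRL ltnS addnC.
Qed.

Lemma low_vars_uniq r t : uniq r -> uniq (low_vars r t).
Proof.
move=> ur; apply: allpairs_uniq_dep => // [j _|]; first exact: iota_uniq.
by move=> [j k] [j' k'] _ _ /= [-> ->].
Qed.

Lemma low_vars_size r t : (forall j, s j <= t)%N ->
  size (low_vars r t) = (size r * t.+1 - \sum_(j <- r) s j)%N.
Proof.
move=> st; rewrite size_allpairs_dep (eq_bigr (fun j => t.+1 - s j)%N) => [|j _].
  by apply: sum_subn => j; rewrite (leq_trans (st j)).
by rewrite size_iota.
Qed.

(** With [S] the sum of the [s_j], the bound [t = S + h] is the least for which the number
    [(d + 1)(t + 1) - S] of values with [k + s_j <= t] exceeds the rank bound [d(t + 1) + h]. *)
Definition all_low := low_vars (enum 'I_d.+1) (S + h).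

Lemma leq_S j : (s j <= S)%N.
Proof. by rewrite (bigD1 j) //= leq_addr. Qed.

Lemma all_lowP w : (w \in all_low) = (w.2 <= h + S - s w.1)%N.
Proof.
rewrite low_varsP ?mem_enum /=; last by rewrite (leq_trans (leq_S _)) ?leq_addr.
have := leq_S w.1; rewrite addnC; move: (s w.1) S w.2 => a b c ab; lia.
Qed.

Lemma all_low_dependent : ~ ind FU (map zval all_low).
Proof.
move=> iz; have [X [XJ iX spX szX]] := rank_basis F (jet (S + h)).
have : (size (map zval all_low) <= size X)%N.
  apply: ind_leq iz _ => _ /mapP[[j k] jk ->].
  have : acl (addl FU (jet (S + h))) (zval (j, k)).
    apply: zval_jet => //; move: jk; rewrite low_varsP //=; last first.
      by rewrite (leq_trans (leq_S _)) ?leq_addr.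
    by case/andP.
  apply: acl_min => y [Hy|/spX]; first by apply: acl_ext; left.
  by apply: acl_mono => t [Ft|tX]; [left; left|right].
rewrite szX size_map low_vars_size; last by move=> j; rewrite (leq_trans (leq_S _)) ?leq_addr.
move=> le; have := leq_trans le (rank_jet_le Hdelta Hchar sF dF Hxi (S + h)).
rewrite size_enum_ord big_enum; have -> : \sum_(j in 'I_d.+1) s j = S by apply: eq_bigl.
by move: S => b; nia.
Qed.

Definition zu_var (x : V) := (exists2 w, w \in all_low & x = zvar w) \/ gmon_deg (tagged x.1) != 0%N.

(** Take one of least total degree: a partial derivative in an occurring variable that vanished at
    the generic point would be a smaller relation. *)
Lemma minimal_relation : exists p, [/\ pover F zu_var p, p != 0, ev p = 0 &
  forall x, occ p x -> ev (pder x p) != 0].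
Proof.
have FFx y : F y -> Fx y by exact: dgen_base.
have uL : uniq all_low by apply: low_vars_uniq; exact: enum_uniq.
have [p0 [p0K p00 ep0]] := relation_of_dependent FFx uL all_low_dependent.
pose Q N := `[< exists p, [/\ pover F zu_var p, p != 0, ev p = 0 & mpsize p = N] >].
have ex : exists N, Q N.
  exists (mpsize p0); apply/asboolP; exists p0; split=> //.
  by apply: poverS p0K => // c; apply.
case: (ex_minnP ex) => N /asboolP[p [pK pn0 ep szp]] min; exists p; split=> // x px.
apply/eqP => epx; have := pder_mpsize x pn0; rewrite szp ltnNge => /negP; apply.
apply: min; apply/asboolP; exists (pder x p); split=> //; first exact: (pover_pder rF).
exact: pder_neq0.
Qed.

Lemma relation_zvar p : pover F (fun=> True) p -> p != 0 -> ev p = 0 -> exists w, occ p (zvar w).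
Proof.
move=> pF pn0 ep; apply: contrapT => nz; move/eqP: pn0; apply.
have [L [uL _ pL]] := vars_list p [::].
pose L' := [seq x <- L | gmon_deg (tagged x.1) != 0%N].
apply: (ind_no_relation sF (a := val_at) (L := L') _ _ ep).
  have -> : map val_at L' = map uval L'.
    apply/eq_in_map => x; rewrite mem_filter => /andP[xu _].
    by rewrite /val_at /split_var (negPf xu).
  by apply: (ind_U Hu) => //; exact: filter_uniq.
move=> k kp; have [Fk _] := pF k kp; split=> // x xk; have px : occ p x by exists k.
rewrite mem_filter pL // andbT; apply: contra_not_neq nz => x0.
have := split_varE x; rewrite /split_var x0 eqxx => xE.
by exists (tag x.1, x.2); rewrite -xE.
Qed.

Definition all_zvals : E -> Prop := fun y => FU y \/ exists w, y = zval w.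

Lemma ev_acl A (p : mp V E) : (forall y, FU y -> A y) ->
  (forall w, occ p (zvar w) -> A (zval w)) -> pover F (fun=> True) p -> acl A (ev p).
Proof.
move=> FA zA pF; apply: (subfield_ev (K := F) (S := occ p)).
- exact: acl_subfield.
- by move=> c Fc; apply: acl_ext; apply: FA; left.
- move=> x px; apply: acl_ext; have := split_varE x; rewrite /val_at.
  case sx: (split_var x) => [w|y] xE; first by apply: zA; rewrite -xE.
  apply: FA; right; exists y => //; move: sx; rewrite /split_var.
  by case: eqP => // /eqP xu [<-].
by apply/(pover_occ _ _ rF); split=> // k; apply: (pover_coef rF k pF).
Qed.

Lemma all_zvals_delta y : acl all_zvals y -> acl all_zvals (delta y).
Proof.
apply: (acl_delta Hdelta Hchar) => z; first exact: acl_ext.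
case=> [Hz|[w ->]]; last by apply: acl_ext; right; exists (succ w).
by apply: acl_mono (acl_FU_delta Hdelta Hchar HF (acl_ext Hz)) => t; left.
Qed.

(** For a minimal relation of order [M] in [u_i0], [pder_coefficient] with the monomial [y_j] writes
    [xi_j] as a quotient of two partial derivatives, the denominator being nonzero by minimality.
    Further derivatives follow by differentiation. *)
Lemma xi_acl j k : acl all_zvals (iter k delta (xi j)).
Proof.
elim: k => [|k IHk]; last exact: all_zvals_delta.
have [p [pK pn0 ep tight]] := minimal_relation.
have pF : pover F (fun=> True) p by apply: poverS pK.
have [[i k] /occ_max[M [pM maxM]]] := relation_zvar pF pn0 ep.
have pFx : pover Fx (fun=> True) p by apply: poverS pF.
have [mu [mu1 muE]] := gmon_var delta xi j (@ord0 (s i)) (Hm i).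
have mu0 : gmon_deg mu != 0%N by rewrite mu1.
have := pder_coefficient Hdelta Hu mu0 pFx ep maxM; rewrite muE /= => e.
have sA := acl_subfield all_zvals; have [_ _ AM AV] := sA.
have dA x : acl all_zvals (ev (pder x p)).
  apply: ev_acl => [y|w _|]; [by left|by right; exists w|].
  exact: (pover_pder rF).
have -> : xi j = ev (pder (cvar mu, M) p) / ev (pder (zvar (i, M)) p).
  by rewrite e mulfK //; exact: tight.
by apply: (AM); [exact: dA | apply: (AV); exact: dA].
Qed.

End Relations.

Lemma acl_chain (E : fieldType) (A : nat -> E -> Prop) S (xs : seq E) :
  (forall r r' y, (r <= r')%N -> A r y -> A r' y) -> (forall y, S y -> exists r, A r y) ->
  (forall x, x \in xs -> acl S x) -> exists r, forall x, x \in xs -> acl (A r) x.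
Proof.
move=> mono SA.
have chain (P : nat -> E -> Prop) (l : seq E) : (forall r r' y, (r <= r')%N -> P r y -> P r' y) ->
    (forall y, y \in l -> exists r, P r y) -> exists r, forall y, y \in l -> P r y.
  move=> monoP; elim: l => [|y l IHl] H; first by exists 0%N.
  have [z zl|r0 Hr0] := IHl; first by apply: H; rewrite inE zl orbT.
  have [r1 Hr1] := H y (mem_head _ _); exists (maxn r0 r1) => z.
  rewrite inE => /predU1P[->|/Hr0]; [move: Hr1|]; apply: monoP; rewrite ?leq_maxl ?leq_maxr //.
move=> H; apply: (chain) => [r r' y rr|x /H /acl_finite[l lS ax]].
  by apply: acl_mono => z; apply: mono.
have [r Hr] := chain A l mono (fun y yl => SA y (lS y yl)).
by exists r; apply: acl_mono ax.
Qed.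

Section LowerBound.
Context (E : fieldType) (delta : E -> E) (F : E -> Prop)
  (Hdelta : is_derivation delta) (Hchar : [pchar E] =i pred0)
  (HF : is_dsubfield delta F)
  (n d h T : nat) (xi : 'I_n -> E) (s m : 'I_d.+1 -> nat) (Hm : forall i, (0 < m i)%N)
  (u : coef_idx n s m -> E).
Hypothesis Hu : forall L : seq (coef_idx n s m * nat), uniq L ->
  alg_indep (dgen delta F (fun y => exists j, y = xi j)) [seq iter p.2 delta (u p.1) | p <- L].
Hypothesis Hxi : forall t, (T <= t)%N -> has_trdeg F (jet delta xi t) (d * t.+1 + h)%N.
Hypothesis sT : forall j, (s j <= T)%N.

Local Notation W := ('I_d.+1 * nat)%type.
Local Notation Fx := (dgen delta F (fun y => exists j, y = xi j)).
Local Notation zvar := (zvar n s m).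
Local Notation zval := (zval delta xi u).
Local Notation val_at := (val_at delta xi u).
Local Notation ev := (mpev (idfun : {rmorphism E -> E}) val_at).
Local Notation FU := (unionp F (Uset delta u)).
Local Notation jet := (jet delta xi).
Local Notation S := (\sum_(l < d.+1) s l)%N.

Let sF : is_subfield F. Proof. exact: dsubfield_subfield HF. Qed.
Let dF x : F x -> F (delta x). Proof. by have [_ [_ [_ [_ [_ Fd]]]]] := HF; apply: Fd. Qed.
Let Fx_F y : F y -> Fx y. Proof. exact: dgen_base. Qed.

Local Notation FU_delta := (acl_FU_delta Hdelta Hchar HF).

Section LowOrder.
Variables (i : 'I_d.+1) (N : nat).

Let rest : E -> Prop := fun y => FU y \/ exists w, (w.1 != i \/ (w.2 < N)%N) /\ y = zval w.

Hypothesis aN : acl rest (zval (i, N)).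

(** Differentiation leads out of the generators only at [zeta_i^(N)], which is covered by [aN]. *)
Lemma rest_delta y : acl rest y -> acl rest (delta y).
Proof.
apply: (acl_delta Hdelta Hchar) => z; first exact: acl_ext.
case=> [Hz|[[j k] /= [H ->]]]; first by apply: acl_mono (FU_delta (acl_ext Hz)) => t; left.
have [ji|ji] := eqVneq j i; last by apply: acl_ext; right; exists (j, k.+1); split=> //; left.
rewrite {j}ji in H *; case: H => [|kN]; first by rewrite eqxx.
move: (kN); rewrite leq_eqVlt => /predU1P[kE|kN'].
  by rewrite -[delta _]/(zval (i, k.+1)) kE.
by apply: acl_ext; right; exists (i, k.+1); split=> //; right.
Qed.

Lemma rest_zval w : acl rest (zval w).
Proof.
case: w => j k; have [->|ji] := eqVneq j i; last by apply: acl_ext; right; exists (j, k); split=> //; left.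
have [kN|Nk] := ltnP k N; first by apply: acl_ext; right; exists (i, k); split=> //; right.
rewrite -(subnK Nk); elim: (k - N)%N => [|e IHe]; first by rewrite add0n.
by rewrite addSn; exact: rest_delta.
Qed.

(** The [d r] values of the other forms beyond [T] and the [d(T + 1) + h] elements of [X] are
    independent, yet algebraic over [N] derivatives of [zeta_i] and [d(T + r + 1) - (S - s_i)]
    values of the other forms. Comparing sizes, [r] cancels. *)
Lemma order_bound : (h + S - s i <= N)%N.
Proof.
have [B [X [szB [XJ szX iX spX iBX]]]] := jet_basis Hdelta Hchar sF dF Hxi.
pose L r := low_vars s (others i) (T + r) ++ [seq (i, k) | k <- iota 0 N].
(* Every element of [X] is algebraic over the values available; as [X] is finite, a bounded order of
   the other forms suffices. *)
have [r Xr] : exists r, forall x, x \in X -> acl (addl FU (map zval (L r))) x.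
  apply: (acl_chain (S := rest)) => [r r' y rr [Hy|/mapP[w wL ->]]|y [Hy|[w [wiN ->]]]|x xX].
  - by left.
  - right; apply: map_f; move: wL; rewrite !mem_cat => /orP[|->]; last by rewrite orbT.
    rewrite !low_varsP ?(leq_trans (sT _)) ?leq_addr // => /andP[-> wT].
    by rewrite (leq_trans wT) ?leq_add2l.
  - by exists 0%N; left.
  - have wNi : w.1 = i -> (w.2 < N)%N by case: wiN => // /eqP.
    exists (w.2 + s w.1)%N; right; apply: map_f; rewrite mem_cat.
    rewrite low_varsP; last by rewrite (leq_trans (sT _)) ?leq_addr.
    rewrite mem_others leq_addl andbT; case: eqP => //= wi.
    by apply/mapP; exists w.2; rewrite ?mem_iota ?wNi // -wi -surjective_pairing.
  have /jetP[j [k [_ ->]]] := XJ x xX.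
  have := xi_acl Hdelta Hchar HF Hm Hu Hxi j k.
  apply: acl_min => y [Hy|[w ->]]; last exact: rest_zval.
  by apply: acl_ext; left.
have iX' : ind FU X.
  by apply: (ind_transfer Hu) => // x /XJ/jetP[j [k [_ ->]]]; exact: Fx_xi.
have iL : ind FU (map zval (other_vars s i T r) ++ X).
  apply/ind_cat; split=> //; have := ind_other_forms Hdelta Hm Hu i szB XJ sT (iBX r).
  apply: ind_base => y [[Fy|Uy]|yX]; apply: acl_ext; [by left; left|by right|by left; right].
have sp : spans FU (map zval (L r)) (map zval (other_vars s i T r) ++ X).
  move=> x; rewrite mem_cat => /orP[/mapP[w wO ->]|/Xr //]; apply: acl_ext; right; apply: map_f.
  rewrite mem_cat; apply/orP; left; case/allpairsP: wO => [[k j] /= [kT ji ->]].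
  rewrite low_varsP /=; last by rewrite (leq_trans (sT _)) ?leq_addr.
  move: kT; rewrite mem_iota ji => /andP[Tk kT] /=; rewrite subnK //; last by rewrite (leq_trans (sT j)) ?(ltnW Tk).
have := ind_leq iL sp; rewrite size_cat !size_map szX size_cat size_allpairs size_map !size_iota.
rewrite low_vars_size; last by move=> j; rewrite (leq_trans (sT _)) ?leq_addr.
rewrite size_others.
have sO : (s i + \sum_(j <- others i) s j = S)%N.
  by rewrite [RHS](bigD1 i) //= big_filter big_enum_cond.
have : (\sum_(j <- others i) s j <= d * T)%N.
  rewrite -[X in (_ <= X * _)%N](size_others i) -sum1_size big_distrl /=.
  by apply: leq_sum => j _; rewrite mul1n.
by move: sO; move: (\sum_(j <- others i) s j)%N S (s i) => a b c; nia.
Qed.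
End LowOrder.

(** Otherwise the values in [p] are among the first [h + S - s i] derivatives of [zeta_i] and values
    of other forms. These are independent: start from [ind_others] and add derivatives of [zeta_i]
    one by one with [order_bound]. *)
Lemma order_lower_bound i p : pover F (fun=> True) p -> p != 0 -> ev p = 0 ->
  exists k, (h + S - s i <= k)%N /\ occ p (zvar (i, k)).
Proof.
move=> pF pn0 ep; apply: contrapT => nk.
have pFx : pover Fx (fun=> True) p by apply: poverS pF.
have [L0 [uL0 _ pL0]] := vars_list (subu delta u p) [::].
pose Lo := [seq w <- L0 | w.1 != i].
(* [rev] puts the highest order in front, where [ind] compares it with all that follows. *)
pose Li N : seq W := [seq (i, k) | k <- rev (iota 0 N)].
have : ~ ind FU (map zval (Li (h + S - s i)%N ++ Lo)).
  move/(ind_K Hdelta Hchar HF u) => iL; move/eqP: pn0; apply; apply: (subu_inj Hu pFx).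
  have eq0 : mpev (idfun : {rmorphism E -> E}) zval (subu delta u p) = 0 by rewrite subu_ev.
  apply: (ind_no_relation (sK delta F u) iL _ eq0) => k kp.
  have [Kk pk] := subu_pover HF pF kp; split=> // w wk.
  rewrite mem_cat mem_filter; have [wi|wi] := eqVneq w.1 i; last first.
    by rewrite pL0 ?orbT //; exists k.
  apply/orP; left; apply/mapP; exists w.2; last by rewrite -wi -surjective_pairing.
  rewrite mem_rev mem_iota /= add0n ltnNge; apply/negP => le; case: nk.
  by exists w.2; split=> //; rewrite -wi -surjective_pairing; exact: pk.
apply; suff iLi N : (N <= h + S - s i)%N -> ind FU (map zval (Li N ++ Lo)) by exact: iLi.
elim: N => [|N IHN] NS.
  rewrite /Li /=; apply: (ind_others Hdelta Hchar HF Hm Hu Hxi sT (i := i)); first exact: filter_uniq.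
  by move=> w; rewrite mem_filter => /andP[].
have -> : Li N.+1 = (i, N) :: Li N by rewrite /Li -[N.+1]addn1 iotaD rev_cat.
split; last by apply: IHN; exact: ltnW.
move=> aN; have : (h + S - s i <= N)%N; last by rewrite leqNgt NS.
apply: order_bound; apply: acl_mono aN => y [Hy|/mapP[w wL ->]]; [by left|right; exists w; split=> //].
move: wL; rewrite mem_cat => /orP[/mapP[k kN ->]|]; last by rewrite mem_filter => /andP[]; left.
by right; move: kN; rewrite mem_rev mem_iota.
Qed.

End LowerBound.

(** * Saturated ideals and leaders *)

Section ToMp.
Context (X : choiceType) (R : comNzRingType).
Local Notation malg := {malg R[{cmonom X}]}.
Implicit Types (p q : malg).

Lemma to_mpM p q : to_mp (p * q) = to_mp p * to_mp q.
Proof. exact: rmorphM. Qed.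

Lemma to_mpXn p e : to_mp (p ^+ e) = to_mp p ^+ e.
Proof. exact: rmorphXn. Qed.

Lemma to_mpXnM a c e p : to_mp ((a * c) ^+ e * p) = (to_mp a * to_mp c) ^+ e * to_mp p.
Proof.
transitivity (to_mp ((a * c) ^+ e) * to_mp p); first exact: to_mpM.
by congr (_ * _); transitivity (to_mp (a * c) ^+ e); [exact: to_mpXn|congr (_ ^+ _); exact: to_mpM].
Qed.

Lemma to_mp_sum (I : Type) (r : seq I) (P : pred I) (f : I -> malg) :
  to_mp (\sum_(i <- r | P i) f i) = \sum_(i <- r | P i) to_mp (f i).
Proof. exact: rmorph_sum. Qed.

Lemma to_mp_inj p q : to_mp p = to_mp q -> p = q.
Proof. exact: (can_inj (@to_mpK X R)). Qed.

Lemma mcf_to_mp p m : mcf (to_mp p) m = p@_m.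
Proof. by rewrite /mcf to_mpK. Qed.
End ToMp.

Lemma occurs_occ (E : fieldType) (X : choiceType) (p : dpoly E X) x k :
  occurs p x k <-> occ (to_mp p) (x, k).
Proof. by rewrite /occurs /occ /mpsupp to_mpK. Qed.

Lemma coeffs_pover (E : fieldType) (X : choiceType) (K : E -> Prop) (p : {malg E[{cmonom X}]}) :
  is_subfield K -> coeffs_in K p <-> pover K (fun=> True) (to_mp p).
Proof.
move=> sK; have rK := subfield_subring sK; split.
  by move=> pK; apply/(pover_occ _ _ rK); split=> // m; rewrite mcf_to_mp.
by move=> /(pover_occ _ _ rK)[pK _] m; rewrite -mcf_to_mp.
Qed.

Lemma to_mp_separant (E : fieldType) (X : choiceType) (q : dpoly E X) v :
  to_mp (separant q v) = pder v (to_mp q).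
Proof.
rewrite /separant to_mp_sum pder.unlock /mpsupp to_mpK.
by apply: eq_bigr => m _; rewrite to_mpU mcf_to_mp.
Qed.

Lemma mp_const (R : comNzRingType) (X : choiceType) (p : mp X R) :
  (forall x, ~ occ p x) -> p = mpc (mcf p mone).
Proof.
move=> np; apply/mpP => m; rewrite mcfC; case: eqP => [->|m1]; first by rewrite mulr1n.
rewrite mulr0n; apply: mcf_out; apply/negP => pm; apply: m1; apply/eqP; rewrite -mdeg_eq0.
rewrite mdegE big1 // => x _; apply/eqP; rewrite -leqn0 leqNgt; apply/negP => mx.
by apply: (np x); exists m.
Qed.

Section Leader.
Context (E : fieldType) (delta : E -> E) (Hdelta : is_derivation delta)
  (Hchar : [pchar E] =i pred0) (N : nat) (K : E -> Prop) (HK : is_dsubfield delta K)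
  (b : 'I_N * nat -> E) (bS : forall x, b (succ x) = delta (b x)) (qd : dpoly E 'I_N).
Local Notation W := ('I_N * nat)%type.
Local Notation mpW := (mp W E).
Local Notation ev := (mpev (idfun : {rmorphism E -> E}) b).
Local Notation q := (to_mp qd).
Local Notation D := (@mp_der E delta 'I_N).
Implicit Types (p : mpW) (v w x y : W).

Let sK : is_subfield K.
Proof. by have [K0 [K1 [KB [KM [KV Kd]]]]] := HK; split. Qed.
Let rK := subfield_subring sK.
Local Notation overK := (pover K (fun _ : W => True)).

Hypothesis qK : overK q.
Hypothesis sat : forall pd : dpoly E 'I_N,
  (coeffs_in K pd /\ peval b pd = 0) <-> in_sat delta K qd pd.

Lemma rank_le_trans y x z : rank_le x y -> rank_le y z -> rank_le x z.
Proof. rewrite /rank_le; lia. Qed.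

Lemma rank_le_anti x y : rank_le x y -> rank_le y x -> x = y.
Proof.
case: x y => [i k] [j l]; rewrite /rank_le /= => h1 h2.
by congr pair; [apply: val_inj => /=|]; lia.
Qed.

Lemma rank_le_succ x y : rank_le (succ x) (succ y) = rank_le x y.
Proof. by []. Qed.

Lemma rank_le_next x : rank_le x (succ x).
Proof. by rewrite /rank_le /= leqnn. Qed.

Lemma coeffs_overK (pd : dpoly E 'I_N) : coeffs_in K pd <-> overK (to_mp pd).
Proof. exact: coeffs_pover. Qed.

Lemma in_dideal_mp (pd : dpoly E 'I_N) : in_dideal delta K qd pd <->
  exists r (c : nat -> mpW), (forall i, overK (c i)) /\
    to_mp pd = \sum_(i < r) c i * iter i D q.
Proof.
split=> [[r [c [cK ->]]]|[r [c [cK e]]]].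
  exists r, (fun i => to_mp (c i)); split=> [i|]; first exact/coeffs_overK.
  rewrite to_mp_sum; apply: eq_bigr => i _; by rewrite to_mpM to_mp_iter_dderiv.
exists r, (fun i => of_mp (c i)); split=> [i|]; first by apply/coeffs_overK; rewrite of_mpK.
apply: to_mp_inj; rewrite e to_mp_sum; apply: eq_bigr => i _.
by rewrite to_mpM to_mp_iter_dderiv of_mpK.
Qed.

Definition HS v : mpW := to_mp (initial qd v) * pder v q.

Lemma overK_HS v : overK (HS v).
Proof.
apply: (poverM rK); last exact: (pover_pder rK).
rewrite /initial to_mp_sum; apply: (pover_sum rK) => m _; apply/(pover_occ _ _ rK); split=> // m'.
rewrite to_mpU mcfm; apply: (subring_predMn rK); rewrite -mcf_to_mp.
exact: (pover_coef rK _ qK).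
Qed.

Lemma in_sat_mp p : overK p -> ev p = 0 <->
  exists v, is_leader qd v /\ exists e r (c : nat -> mpW), (forall i, overK (c i)) /\
    HS v ^+ e * p = \sum_(i < r) c i * iter i D q.
Proof.
have HSE v e : HS v ^+ e * p = to_mp ((initial qd v * separant qd v) ^+ e * of_mp p).
  by rewrite /HS -to_mp_separant -[p in LHS]of_mpK; apply/esym; exact: to_mpXnM.
move=> pK; have epE : ev p = peval b (of_mp p) by rewrite -mpev_peval of_mpK.
have pK' : coeffs_in K (of_mp p) by apply/coeffs_overK; rewrite of_mpK.
split=> [ep|[v [lv [e [r [c [cK eq]]]]]]].
  have /sat[_ [v [lv [e /in_dideal_mp[r [c [cK eq]]]]]]] : coeffs_in K (of_mp p) /\ peval b (of_mp p) = 0.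
    by rewrite -epE.
  by exists v; split=> //; exists e, r, c; split=> //; rewrite HSE.
rewrite epE; apply: (proj2 (proj2 (sat (of_mp p)) _)); split=> //; exists v; split=> //; exists e.
by apply/in_dideal_mp; exists r, c; split=> //; rewrite -HSE.
Qed.

(** Membership of 0 in the saturation already exhibits a leader. *)
Lemma leader_exists : exists v, is_leader qd v.
Proof.
have [v [lv _]] := proj1 (in_sat_mp (pover0 _ rK)) (rmorph0 ev).
by exists v.
Qed.

Lemma leader_uniq v v' : is_leader qd v -> is_leader qd v' -> v = v'.
Proof. by move=> [vq vmax] [v'q v'max]; apply: rank_le_anti; [apply: v'max|apply: vmax]. Qed.

Lemma ev_q : ev q = 0.
Proof.
have [v lv] := leader_exists; apply/(in_sat_mp qK); exists v; split=> //.
exists 0%N, 1%N, (fun=> 1); split=> [_|]; first by have [] := pover_subring (fun _ : W => True) rK.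
by rewrite expr0 big_ord1 /= !mul1r.
Qed.

(** If it vanished, it would lie in the saturation, and one more power of it would put 1 there
    too. *)
Lemma ev_HS v : is_leader qd v -> ev (HS v) != 0.
Proof.
move=> lv; apply/eqP => e0; have [v' [lv' [e [r [c [cK eq]]]]]] := proj1 (in_sat_mp (@overK_HS v)) e0.
have vv := leader_uniq lv lv'; subst v'.
have K1 : overK 1 by have [] := pover_subring (fun _ : W => True) rK.
have : ev 1 = 0.
  apply/(in_sat_mp K1); exists v; split=> //; exists e.+1, r, c; split=> //.
  by rewrite mulr1 exprSr.
by move/eqP; rewrite rmorph1 oner_eq0.
Qed.

Lemma occ_iter_der v i y : is_leader qd v -> occ (iter i D q) y -> rank_le y (v.1, (v.2 + i)%N).
Proof.
move=> [_ vmax]; elim: i y => [|i IHi] y /=.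
  by rewrite addn0 -surjective_pairing => qy; apply: vmax; apply/occurs_occ; rewrite -surjective_pairing.
rewrite addnS -[(v.1, _)]/(succ (v.1, (v.2 + i)%N)).
case/(occ_mp_der Hdelta) => [/IHi yv|[x /IHi xv ->]]; last by rewrite rank_le_succ.
exact: rank_le_trans yv (rank_le_next _).
Qed.

(** Each differentiation raises the leader by one order and is linear in it with the separant as
    coefficient, the raised variable being of higher rank than everything before. *)
Lemma pder_iter_der v i : is_leader qd v ->
  pder (v.1, (v.2 + i)%N) (iter i D q) = pder v q.
Proof.
move=> lv; elim: i => [|i IHi] /=; first by rewrite addn0 -surjective_pairing.
rewrite addnS -IHi -[(v.1, _.+1)]/(succ (v.1, (v.2 + i)%N)); apply: (pder_mp_der Hdelta).
by move/(occ_iter_der lv); rewrite /rank_le /= ltnNge leqnSn /= gtn_eqF.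
Qed.

Lemma ev_iter_der i : ev (iter i D q) = 0.
Proof.
elim: i => [|i IHi] /=; first exact: ev_q.
by rewrite (mp_der_ev Hdelta) // IHi (der0 Hdelta).
Qed.

Lemma pder_sum x (I : Type) (r : seq I) (P : pred I) (f : I -> mpW) :
  pder x (\sum_(i <- r | P i) f i) = \sum_(i <- r | P i) pder x (f i).
Proof. exact: (big_morph (pder x) (pderD x) (pder0 _ x)). Qed.

(* Differentiate the membership relation of a nonzero element free of the variables of rank at least
   that of the leader: the cofactors vanish at the generic point, from the top one down. *)
Lemma leader_reduced p v : is_leader qd v -> overK p -> p != 0 -> ev p = 0 ->
  exists w, occ p w /\ (rank_le w v -> w = v).
Proof.
move=> lv pK pn0 ep; apply: contrapT => nw.
pose Q k := `[< exists p, [/\ overK p, p != 0, ev p = 0,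
  forall w, occ p w -> rank_le w v /\ w <> v & mpsize p = k] >].
have ex : exists k, Q k.
  exists (mpsize p); apply/asboolP; exists p; split=> // w pw.
  by split; [|move=> wv]; apply: contrapT => H; apply: nw; exists w; split=> //; rewrite wv.
case: (ex_minnP ex) => k /asboolP[{nw ex ep pn0 pK} p' [pK pn0 ep pv szp]] min.
move: p' => {}p in pK pn0 ep pv szp *.
have [v' [lv' [e [r [c [cK eq]]]]]] := proj1 (in_sat_mp pK) ep.
have vv := leader_uniq lv lv'; subst v'.
have eH := ev_HS lv; have eS : ev (pder v q) != 0.
  by apply: contra_neq eH => e0; rewrite /HS rmorphM [X in _ * X]e0 mulr0.
have eqx x : ev (HS v) ^+ e * ev (pder x p) = \sum_(i < r) ev (c i) * ev (pder x (iter i D q)).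
  have e1 := congr1 (fun p => ev (pder x p)) eq.
  rewrite pderM pder_sum rmorphD (rmorphM ev _ p) [ev p]ep mulr0 add0r rmorphM rmorphXn in e1.
  rewrite [LHS]e1 rmorph_sum; apply: eq_bigr => i _.
  by rewrite pderM rmorphD !rmorphM [ev (iter _ _ _)]ev_iter_der mulr0 add0r.
(* Differentiate in the [l]-th derivative of the leader. Neither [p] nor the derivatives of [q] of
   order below [l] contain it, and the cofactors above [l] are already zero; there remains the
   cofactor of index [l] times the separant, which does not vanish. *)
have c0 i : (i < r)%N -> ev (c i) = 0.
  suff top j : (forall i, (r - j <= i < r)%N -> ev (c i) = 0) by move=> ir; apply: (top r); lia.
  elim: j => [|j IHj] l lr; first by lia.
  have [lj|lj] := boolP (r - j <= l < r)%N; first exact: IHj.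
  have lr' : (l < r)%N by lia.
  have := eqx (v.1, (v.2 + l)%N); rewrite (bigD1 (Ordinal lr')) //= pder_iter_der //.
  rewrite pder_eq0; last first.
    move=> /pv[le ne]; apply: ne; apply: (rank_le_anti le).
    by move: le; rewrite /rank_le /=; lia.
  rewrite rmorph0 mulr0 big1 ?addr0 => [/esym/eqP|o ol].
    by rewrite mulf_eq0 (negPf eS) orbF => /eqP.
  have [lo|ol'] := ltnP l o; first by rewrite IHj ?mul0r //; have := ltn_ord o; lia.
  rewrite pder_eq0 ?rmorph0 ?mulr0 // => /(occ_iter_der lv); rewrite /rank_le /=.
  have : o != l :> nat by apply: contraNneq ol => e1; apply/eqP/val_inj.
  lia.
(* All cofactors vanish, so every partial derivative of [p] is again a relation. By minimality of
   the degree no variable can occur in [p], which is then a constant of value 0. *)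
have px0 x : ev (pder x p) = 0.
  apply: (mulfI (expf_neq0 e eH)); rewrite eqx mulr0 big1 // => i _.
  by rewrite c0 ?mul0r.
have [[x px]|np] := pselect (exists x, occ p x).
  have := pder_mpsize x pn0; rewrite szp ltnNge => /negP; apply; apply: min; apply/asboolP.
  exists (pder x p); split=> //; [exact: (pover_pder rK)|exact: pder_neq0|].
  by move=> w /pder_occ/pv.
have pE := mp_const (fun x px => np (ex_intro _ x px)).
by move/eqP: pn0; apply; move: ep; rewrite {1}pE mpevC => /= e1; rewrite pE e1 rmorph0.
Qed.

End Leader.

Lemma occ_zvar n d (s m : 'I_d.+1 -> nat) (E : fieldType) (delta : E -> E) F
  (u : coef_idx n s m -> E) (HF : is_dsubfield delta F) p w :
  pover F (fun=> True) p -> occ (subu delta u p) w -> occ p (zvar n s m w).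
Proof. by move=> pF [k kp kw]; have [_] := subu_pover HF pF kp; apply. Qed.

(** * Orders of the generalized Chow form *)

Section Chow.
Context (E : fieldType) (delta : E -> E) (F : E -> Prop)
  (Hdelta : is_derivation delta) (Hchar : [pchar E] =i pred0)
  (HF : is_dsubfield delta F)
  (n d h T : nat) (xi : 'I_n -> E) (s m : 'I_d.+1 -> nat) (Hm : forall i, (0 < m i)%N)
  (u : coef_idx n s m -> E).
Hypothesis Hu : forall L : seq (coef_idx n s m * nat), uniq L ->
  alg_indep (dgen delta F (fun y => exists j, y = xi j)) [seq iter p.2 delta (u p.1) | p <- L].
Hypothesis Hxi : forall t, (T <= t)%N -> has_trdeg F (jet delta xi t) (d * t.+1 + h)%N.
Hypothesis sT : forall j, (s j <= T)%N.

Local Notation V := (coef_idx n s m * nat)%type.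
Local Notation W := ('I_d.+1 * nat)%type.
Local Notation Fx := (dgen delta F (fun y => exists j, y = xi j)).
Local Notation zvar := (zvar n s m).
Local Notation split_var := (@split_var n d s m).
Local Notation zval := (zval delta xi u).
Local Notation val_at := (val_at delta xi u).
Local Notation ev := (mpev (idfun : {rmorphism E -> E}) val_at).
Local Notation jet := (jet delta xi).
Local Notation S := (\sum_(l < d.+1) s l)%N.

Let sF : is_subfield F. Proof. exact: dsubfield_subfield HF. Qed.
Let rF := subfield_subring sF.
Let Fx_F y : F y -> Fx y. Proof. exact: dgen_base. Qed.

Local Notation K := (dgen delta F
  (fun y => exists2 v : coef_idx n s m, gmon_deg (tagged v) != 0%N & y = u v)).
Local Notation overF := (pover F (fun _ : V => True)).
Local Notation subu := (subu delta u).

Lemma to_mp_subst_u (g : dpoly E (coef_idx n s m)) : to_mp (subst_u delta u g) = subu (to_mp g).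
Proof.
rewrite /subu /sub_mp mpevE /pev /mmap /subst_u to_mp_sum; apply: eq_bigr => k _.
rewrite to_mpZ; congr (mpc _ * _); rewrite /mnm_ev.
transitivity (\prod_(x <- finsupp k) to_mp ((if gmon_deg (tagged x.1) == 0%N
    then dvar E (tag x.1) x.2 else (iter x.2 delta (u x.1))%:MP : dpoly E 'I_d.+1) ^+ k x)).
  exact: rmorph_prod.
apply: eq_bigr => x _; rewrite to_mpXn; congr (_ ^+ _).
by rewrite /split_var; case: ifP => // _; rewrite mpcE.
Qed.

Context (g : dpoly E (coef_idx n s m)).
Hypothesis Hg_irr : irreducible_over F g.
Hypothesis Hg_sat : forall p : dpoly E 'I_d.+1,
  (coeffs_in K p /\ deval delta (gen_zeta delta xi u) p = 0) <-> in_sat delta K (subst_u delta u g) p.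

Local Notation gt := (to_mp g).
Local Notation qd := (subst_u delta u g).

Lemma gt_over : overF gt.
Proof. by have [gF _ _] := Hg_irr; apply/coeffs_pover. Qed.

Lemma gt_neq0 : gt != 0.
Proof.
have [_ gc _] := Hg_irr; apply/eqP => g0; apply: gc; exists 0; apply: to_mp_inj.
by rewrite g0 -mpcE rmorph0.
Qed.

Lemma q_over : pover K (fun=> True) (to_mp qd).
Proof. by rewrite to_mp_subst_u; apply: poverS (subu_pover HF gt_over). Qed.

Let KD : is_dsubfield delta K := dgen_dsubfield delta F _.
Let bS (x : W) : zval (succ x) = delta (zval x). Proof. by []. Qed.

Lemma gt_ev : ev gt = 0.
Proof.
transitivity (mpev (idfun : {rmorphism E -> E}) zval (to_mp qd)).
  by rewrite to_mp_subst_u subu_ev.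
exact: (ev_q KD q_over Hg_sat).
Qed.

Lemma overFx p : overF p -> pover Fx (fun=> True) p.
Proof. exact: poverS. Qed.

Section Leader.
Variables (v : W) (lv : is_leader qd v).

Lemma gt_leader : occ gt (zvar v).
Proof.
have [/occurs_occ qv _] := lv; move: qv; rewrite -surjective_pairing to_mp_subst_u.
exact: (occ_zvar HF gt_over).
Qed.

Lemma gt_rank w : occ gt (zvar w) -> rank_le w v.
Proof.
move/(occ_subu Hchar Hu (overFx gt_over)) => qw; have [_] := lv; apply.
by apply/occurs_occ; rewrite -surjective_pairing to_mp_subst_u.
Qed.

(** The reduction property holds over the field generated by the coefficients; [subu] brings it back
    to polynomials over [F]. *)
Lemma relation_reduced p : overF p -> p != 0 -> ev p = 0 ->
  exists w, occ p (zvar w) /\ (rank_le w v -> w = v).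
Proof.
move=> pF pn0 ep.
have [|||w [pw wv]] := leader_reduced Hdelta Hchar KD bS q_over Hg_sat (p := subu p) lv.
- by apply: poverS (subu_pover HF pF).
- by apply: contra_neq pn0; apply: (subu_inj Hu (overFx pF)).
- by rewrite subu_ev.
by exists w; split=> //; exact: (occ_zvar HF pF pw).
Qed.

(* Otherwise the leader could be eliminated between [p] and [g]. *)
Lemma relation_multiple p : overF p -> (forall w, occ p (zvar w) -> rank_le w v) -> ev p = 0 ->
  exists c, p = c * gt.
Proof.
move=> pF pv ep; pose f := sf_inj sF.
have fF c : (exists y, c = f y) <-> F c by apply: iff_sym; exact: sf_injP.
have toF S p' : pover (fun c => exists y, c = f y) S p' -> pover F S p' by apply: poverS => // c /fF.
have ofF p' : overF p' -> pover (fun c => exists y, c = f y) xpredT p' by apply: poverS => // c /fF.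
have irr a b : pover (fun c => exists y, c = f y) xpredT a ->
    pover (fun c => exists y, c = f y) xpredT b -> gt = a * b ->
    (exists c, a = mpc c) \/ (exists c, b = mpc c).
  move=> /toF aF /toF bF gE; have [_ _ irr] := Hg_irr.
  have toC p' : is_const (of_mp p') -> exists c, p' = mpc c.
    by case=> c pc; exists c; rewrite mpcE -pc of_mpK.
  case: (irr (of_mp a) (of_mp b)) => [|||/toC|/toC]; [| | |by left|by right].
  - by apply/(coeffs_pover _ sF); rewrite of_mpK; apply: poverS aF.
  - by apply/(coeffs_pover _ sF); rewrite of_mpK; apply: poverS bF.
  by apply: to_mp_inj; rewrite to_mpM !of_mpK.
have [[c _ ->]|[a [b [r [rE rn0 rO]]]]] := irreducible_coprime (ofF _ gt_over) (ofF _ pF) irr gt_leader.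
  by exists c.
have rF' : overF r by apply: poverS (toF _ _ _ rO).
have er : ev r = 0 by rewrite rE rmorphD !rmorphM ep gt_ev !mulr0 addr0.
have [w [rw wv]] := relation_reduced rF' rn0 er.
have [k kr kw] := rw; have [_ /(_ _ kw)[gpw /eqP]] := rO k kr; case.
by rewrite wv //; case: gpw => [/gt_rank|/pv].
Qed.

Lemma chow_orders i :
  occ gt (zvar (i, (h + S - s i)%N)) /\
  forall (mu : gmon n (s i) (m i)) k, occ gt (cvar mu, k) -> (k <= h + S - s i)%N.
Proof.
have [p [pz pn0 ep _]] := minimal_relation Hdelta Hchar HF u Hxi.
have pF : overF p by apply: poverS pz.
have LBg j := order_lower_bound Hdelta Hchar HF Hm Hu Hxi sT j gt_over gt_neq0 gt_ev.
have pz_le w : occ p (zvar w) -> (w.2 <= h + S - s w.1)%N.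
  case=> k kp kw; have [_ /(_ _ kw)[[w' w'L /(congr1 split_var)]|]] := pz k kp.
    by rewrite !split_zvar => -[->]; rewrite -all_lowP.
  by rewrite gmon_deg_gmon0.
(* The order of [p] in each [z_j] is at most [h + S - s j], and [g] attains at least that order. So
   every [z] variable of [p] is ranked at most as high as one of [g], hence at most as high as
   [v]. *)
have pv w : occ p (zvar w) -> rank_le w v.
  move/pz_le => we; have [k [ek /gt_rank]] := LBg w.1; apply: rank_le_trans.
  by rewrite /rank_le /= leqnn andbT orbC -leq_eqVlt (leq_trans we).
have [c pE] := relation_multiple pF pv ep.
have gp x : occ gt x -> occ p x by rewrite pE; apply: occ_multiple; rewrite -pE.
have ge j k : occ gt (zvar (j, k)) -> (k <= h + S - s j)%N by move/gp/pz_le.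
split.
  have [k [ek gk]] := LBg i; suff -> : (h + S - s i)%N = k by [].
  by apply/eqP; rewrite eqn_leq ek ge.
move=> mu k gk; have [/gmon_deg0 mu0|mu0] := eqVneq (gmon_deg mu) 0%N.
  by apply: ge; rewrite /zvar -mu0.
rewrite leqNgt; apply/negP => ke.
have kM l : occ gt (zvar (i, l)) -> (l <= k)%N by move/ge => le; rewrite (leq_trans le) ?(ltnW ke).
have := pder_coefficient Hdelta Hu mu0 (overFx gt_over) gt_ev kM.
(* Here [k] exceeds the order of [g] in [z_i], so the right-hand side of [pder_coefficient] is
   zero. *)
rewrite [pder (zvar _) _]pder_eq0 ?rmorph0 ?mulr0; last by move/ge; rewrite leqNgt ke.
move=> e0; have [||c' e1] := relation_multiple (p := pder (cvar mu, k) gt) _ _ e0.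
- exact: (pover_pder rF gt_over).
- by move=> w /pder_occ/gt_rank.
exact: pder_not_multiple Hchar gk e1.
Qed.

End Leader.
End Chow.

Theorem theorem6p3
  (E : fieldType) (delta : E -> E) (F : E -> Prop)
  (Hdelta : is_derivation delta) (Hchar : [pchar E] =i pred0)
  (HF : is_dsubfield delta F)
  (n d h : nat) (xi : 'I_n -> E)
  (Hxi : exists T : nat, forall t : nat, (T <= t)%N ->
     has_trdeg F [seq iter j delta (xi j0) | j0 <- enum 'I_n, j <- iota 0 t.+1]
               (d * t.+1 + h)%N)
  (s m : 'I_d.+1 -> nat) (Hm : forall i, (0 < m i)%N)
  (u : coef_idx n s m -> E)
  (Hu : forall L : seq (coef_idx n s m * nat), uniq L ->
     alg_indep (dgen delta F (fun y => exists j, y = xi j))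
               [seq iter p.2 delta (u p.1) | p <- L])
  (g : dpoly E (coef_idx n s m))
  (Hg_irr : irreducible_over F g)
  (Hg_sat : forall p : dpoly E 'I_d.+1,
     (coeffs_in (dgen delta F
                   (fun y => exists2 v : coef_idx n s m,
                               gmon_deg (tagged v) != 0%N & y = u v)) p /\
      deval delta (gen_zeta delta xi u) p = 0)
     <->
     in_sat delta (dgen delta F
                   (fun y => exists2 v : coef_idx n s m,
                               gmon_deg (tagged v) != 0%N & y = u v))
            (subst_u delta u g) p) :
  forall i : 'I_d.+1,
    has_ord g (cvar (gmon0 n (s i) (m i))) (h + \sum_(l < d.+1) s l - s i)%N /\
    has_ordG g i (h + \sum_(l < d.+1) s l - s i)%N.
Proof.
(* The threshold is enlarged so that it also bounds every [s j]. *)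
move=> i; have [T HT] := Hxi; pose T' := (T + \sum_(l < d.+1) s l)%N.
have HT' t : (T' <= t)%N -> has_trdeg F (jet delta xi t) (d * t.+1 + h)%N.
  by move=> Tt; apply: HT; apply: leq_trans Tt; apply: leq_addr.
have sT j : (s j <= T')%N by rewrite /T' (bigD1 j) //= addnCA leq_addr.
have [v lv] := leader_exists (dgen_dsubfield delta F _) Hg_sat.
have [gi gmax] := chow_orders Hdelta Hchar HF Hm Hu HT' sT Hg_irr Hg_sat lv i.
split; split.
- exact/occurs_occ.
- by move=> k /occurs_occ; apply: gmax.
- by exists (gmon0 n (s i) (m i)); apply/occurs_occ.
by move=> mu k /occurs_occ; apply: gmax.
Qed.
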